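(* Let $F\in\mathcal S$ satisfy (G1)–(G3). Then for the Markov process $\Pi(F)$: (1) there are only finitely many ergodic stationary probability measures; (2) their supports are contained in pairwise disjoint, vertically ordered trapping domains; (3) for every ergodic stationary measure $\mu$ and every $k$ there exist an attracting fixed point $a$ of a simple return and a simple transition $f$ with $A_{\mu,k}=f(a)$; the same holds for $B_{\mu,k}$; (4) the random Lyapunov exponent $\lambda(\mu)=\sum_{i}\int_I\log f_i'(x)\,d\mu_i(x)$ of every ergodic stationary measure $\mu$ is negative.
   Context: Setting: $N\ge1$; $\{0,1\}$-matrix $A=(a_{ij})$ with some power having all entries positive; stochastic matrix $\Pi=(\pi_{ij})$ with $\pi_{ij}>0$ iff $a_{ij}=1$, with stationary probability vector $p$. $I=[0,1]$; $f_1,\dots,f_N:I\to I$ are strictly increasing $C^1$ diffeomorphisms onto their images with $f_k(I)\subset(0,1)$ ($F$ denotes this tuple; $\mathcal S$ the space of such tuples). $\mathcal I=\{1,\dots,N\}\times I$, $I_k=\{k\}\times I$ (identified with $I$). $(k,m)$ is admissible if $\pi_{km}>0$. The Markov process $\Pi(F)$ on $\mathcal I$ jumps from $(i,x)$ to $(j,f_i(x))$ with probability $\pi_{ij}$. For a probability $\mu$ on $\mathcal I$, $\mu_k$ is its restriction to $I_k$; $\mu$ is stationary if $\mu_j=\sum_i\pi_{ij}(f_i)_*\mu_i$ for all $j$; ergodic stationary measures are the extreme points of the set of stationary probabilities. $A_{\mu,k}=\min\operatorname{supp}\mu_k$, $B_{\mu,k}=\max\operatorname{supp}\mu_k$. A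 domain is $D=\bigsqcup_k\{k\}\times D_k$ with every $D_k\subset I$ a nonempty interval; it is trapping if $f_k(D_k)\subset\mathrm{int}\,D_m$ for all admissible $(k,m)$. Finitely many domains are vertically ordered if they can be enumerated so that for every $k$ and $i<j$ the $k$-th interval of the $i$-th domain lies below that of the $j$-th domain. Admissible composition: $f_{w_1\dots w_n}=f_{w_n}\circ\dots\circ f_{w_1}:I_{w_1}\to I_{w_{n+1}}$ with each $(w_i,w_{i+1})$, $1\le i\le n$, admissible; simple transition if $w_1,\dots,w_{n+1}$ are pairwise distinct; simple return if $w_1,\dots,w_n$ are pairwise distinct and $w_{n+1}=w_1$. Genericity: (G1) every fixed point $q$ of every simple return $g$ has $g'(q)\ne1$; (G2) no simple transition maps an attracting fixed point of a simple return to a repelling fixed point of a simple return, nor a repelling one to an attracting one; (G3) there are no $a_1,\dots,a_N\in I$ with $f_i(a_i)=a_j$ for all admissible $(i,j)$. *)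

(* Defs.v *)
From Stdlib Require Import Reals Lra Lia List.
Import ListNotations.
Open Scope R_scope.

Inductive borel : (R -> Prop) -> Prop :=
  | borel_interval (a b : R) : borel (fun x => a < x < b)
  | borel_compl (B : R -> Prop) : borel B -> borel (fun x => ~ B x)
  | borel_union (Bn : nat -> R -> Prop) :
      (forall n, borel (Bn n)) -> borel (fun x => exists n, Bn n x).

Definition inI (x : R) : Prop := 0 <= x <= 1.

(** A set function, meaningful on Borel sets. *)
Definition meas := (R -> Prop) -> R.

Definition is_fmeas_I (m : meas) : Prop :=
  (forall B C, borel B -> (forall x, B x <-> C x) -> m B = m C) /\
  (forall B, borel B -> 0 <= m B) /\
  (forall B, borel B -> m B = m (fun x => B x /\ inI x)) /\
  (forall Bn : nat -> R -> Prop,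
      (forall n, borel (Bn n)) ->
      (forall n p x, n <> p -> Bn n x -> Bn p x -> False) ->
      infinite_sum (fun n => m (Bn n)) (m (fun x => exists n, Bn n x))).

(** A probability measure mu on {0..N-1} x I, given by its restrictions mu k. *)
Definition is_prob (N : nat) (mu : nat -> meas) : Prop :=
  (forall k, (k < N)%nat -> is_fmeas_I (mu k)) /\
  sum_f_R0 (fun k => mu k inI) (N - 1) = 1.

Definition meq (N : nat) (mu nu : nat -> meas) : Prop :=
  forall k B, (k < N)%nat -> borel B -> mu k B = nu k B.

Definition stationary (N : nat) (Pi : nat -> nat -> R) (F : nat -> R -> R)
  (mu : nat -> meas) : Prop :=
  is_prob N mu /\
  forall j B, (j < N)%nat -> borel B ->
    mu j B = sum_f_R0 (fun i => Pi i j * mu i (fun x => B (F i x))) (N - 1).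

(** Ergodic = extreme point of the convex set of stationary probabilities. *)
Definition ergodic (N : nat) (Pi : nat -> nat -> R) (F : nat -> R -> R)
  (mu : nat -> meas) : Prop :=
  stationary N Pi F mu /\
  forall nu1 nu2 t, stationary N Pi F nu1 -> stationary N Pi F nu2 -> 0 < t < 1 ->
    (forall k B, (k < N)%nat -> borel B -> mu k B = t * nu1 k B + (1 - t) * nu2 k B) ->
    meq N nu1 nu2.

Definition supp (m : meas) (x : R) : Prop :=
  forall eps, 0 < eps -> m (fun y => x - eps < y < x + eps) > 0.

Definition is_min (P : R -> Prop) (x : R) : Prop := P x /\ forall y, P y -> x <= y.
Definition is_max (P : R -> Prop) (x : R) : Prop := P x /\ forall y, P y -> y <= x.

(** Lebesgue integral of a bounded function over I w.r.t. a finite measure,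
    via finite Borel partitions of I and simple functions below/above g. *)
Definition lo_sum (m : meas) (P : list ((R -> Prop) * R * R)) : R :=
  fold_right (fun '(A, lo, _) s => lo * m A + s) 0 P.
Definition hi_sum (m : meas) (P : list ((R -> Prop) * R * R)) : R :=
  fold_right (fun '(A, _, hi) s => hi * m A + s) 0 P.

Definition is_integral (m : meas) (g : R -> R) (L : R) : Prop :=
  forall eps, 0 < eps ->
    exists P : list ((R -> Prop) * R * R),
      (forall A lo hi, In (A, lo, hi) P ->
         borel A /\ forall x, A x -> inI x -> lo <= g x <= hi) /\
      (forall x, inI x -> exists A lo hi, In (A, lo, hi) P /\ A x) /\
      (forall i j x, i <> j -> (i < length P)%nat -> (j < length P)%nat ->
         fst (fst (nth i P ((fun _ => False), 0, 0))) x ->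
         fst (fst (nth j P ((fun _ => False), 0, 0))) x -> False) /\
      L - eps <= lo_sum m P /\ hi_sum m P <= L + eps.

Fixpoint adm (Pi : nat -> nat -> R) (w : list nat) : Prop :=
  match w with
  | a :: ((b :: _) as t) => Pi a b > 0 /\ adm Pi t
  | _ => True
  end.

(** wmap F [w1;...;w_{n+1}] = f_{w_n} o ... o f_{w_1} (identity if n = 0). *)
Fixpoint wmap (F : nat -> R -> R) (w : list nat) (x : R) : R :=
  match w with
  | a :: ((_ :: _) as t) => wmap F t (F a x)
  | _ => x
  end.

Definition word_ok (N : nat) (Pi : nat -> nat -> R) (w : list nat) : Prop :=
  w <> [] /\ (forall a, In a w -> (a < N)%nat) /\ adm Pi w.

Definition simple_transition (N : nat) (Pi : nat -> nat -> R) (w : list nat) : Prop :=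
  word_ok N Pi w /\ NoDup w.

Definition simple_return (N : nat) (Pi : nat -> nat -> R) (w : list nat) : Prop :=
  word_ok N Pi w /\ (2 <= length w)%nat /\ NoDup (removelast w) /\
  last w 0%nat = hd 0%nat w.

Definition fixed_pt (F : nat -> R -> R) (r : list nat) (q : R) : Prop :=
  inI q /\ wmap F r q = q.

Definition attracting (N : nat) (Pi : nat -> nat -> R) (F : nat -> R -> R)
  (r : list nat) (q : R) : Prop :=
  simple_return N Pi r /\ fixed_pt F r q /\
  exists d, derivable_pt_lim (wmap F r) q d /\ Rabs d < 1.

Definition repelling (N : nat) (Pi : nat -> nat -> R) (F : nat -> R -> R)
  (r : list nat) (q : R) : Prop :=
  simple_return N Pi r /\ fixed_pt F r q /\
  exists d, derivable_pt_lim (wmap F r) q d /\ Rabs d > 1.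

Definition stochastic (N : nat) (Pi : nat -> nat -> R) : Prop :=
  (forall i j, (i < N)%nat -> (j < N)%nat -> 0 <= Pi i j) /\
  (forall i, (i < N)%nat -> sum_f_R0 (fun j => Pi i j) (N - 1) = 1).

(** Some power of A (a_ij = 1 iff pi_ij > 0) has all entries positive. *)
Definition primitive_mat (N : nat) (Pi : nat -> nat -> R) : Prop :=
  exists m : nat, forall i j, (i < N)%nat -> (j < N)%nat ->
    exists w, word_ok N Pi w /\ length w = S m /\ hd 0%nat w = i /\ last w 0%nat = j.

(** F in S: each f_k is (the restriction to I of) a C^1 map with derivative F' k,
    strictly increasing with positive derivative on I (a C^1 diffeomorphism
    onto its image), and f_k(I) in (0,1). *)
Definition in_S (N : nat) (F F' : nat -> R -> R) : Prop :=
  forall k, (k < N)%nat ->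
    (forall x, derivable_pt_lim (F k) x (F' k x)) /\
    continuity (F' k) /\
    (forall x, inI x -> 0 < F' k x) /\
    (forall x y, inI x -> inI y -> x < y -> F k x < F k y) /\
    (forall x, inI x -> 0 < F k x < 1).

Definition G1 (N : nat) (Pi : nat -> nat -> R) (F : nat -> R -> R) : Prop :=
  forall r q, simple_return N Pi r -> fixed_pt F r q ->
    ~ derivable_pt_lim (wmap F r) q 1.

Definition G2 (N : nat) (Pi : nat -> nat -> R) (F : nat -> R -> R) : Prop :=
  forall r1 r2 w q1 q2,
    simple_transition N Pi w -> hd 0%nat w = hd 0%nat r1 -> last w 0%nat = hd 0%nat r2 ->
    wmap F w q1 = q2 ->
    ~ (attracting N Pi F r1 q1 /\ repelling N Pi F r2 q2) /\
    ~ (repelling N Pi F r1 q1 /\ attracting N Pi F r2 q2).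

Definition G3 (N : nat) (Pi : nat -> nat -> R) (F : nat -> R -> R) : Prop :=
  ~ exists a : nat -> R, (forall i, (i < N)%nat -> inI (a i)) /\
      forall i j, (i < N)%nat -> (j < N)%nat -> Pi i j > 0 -> F i (a i) = a j.

Definition is_interval_I (D : R -> Prop) : Prop :=
  (exists x, D x) /\ (forall x y z, D x -> D y -> x <= z <= y -> D z) /\
  (forall x, D x -> inI x).

Definition is_domain (N : nat) (D : nat -> R -> Prop) : Prop :=
  forall k, (k < N)%nat -> is_interval_I (D k).

Definition interior_R (S : R -> Prop) (y : R) : Prop :=
  exists eps, 0 < eps /\ forall z, y - eps < z < y + eps -> S z.

Definition trapping (N : nat) (Pi : nat -> nat -> R) (F : nat -> R -> R)
  (D : nat -> R -> Prop) : Prop :=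
  forall k m, (k < N)%nat -> (m < N)%nat -> Pi k m > 0 ->
    forall x, D k x -> interior_R (D m) (F k x).

(* Main.v *)
(** The lower end A_k of the support of a stationary measure satisfies A_j = min_i f_i(A_i) over the
    admissible (i,j); call (i,j) tight when f_i(A_i) = A_j. Following tight edges backwards exhibits
    A_k as the image under a simple transition of a fixed point of a simple return made of tight
    edges. By (G3) the A_k carry no atoms. If some tight cycle were repelling, then by (G2) all tight
    cycles upstream of it would be, and after rescaling by shortest-path potentials every tight edge
    there would expand, so that the mass of a shrinking one-sided neighbourhood of the A_k would
    stay bounded below and create an atom. So all tight cycles attract, which also gives trapping
    neighbourhoods. Upper ends B_k follow by reflecting the interval.

    For an ergodic measure, extremality and (G3) force a crossing: two admissible words of equal
    length with the same last letter, one mapping the upper end below the image of the lower end by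
    the other. Hence the total oscillation of a monotone function over the intervals [A_k, B_k]
    contracts exponentially under the Markov operator. It follows that ergodic measures with
    overlapping hulls coincide, so the hulls are ordered and, the possible values of A_k being
    finite in number by (G1), there are finitely many of them. Applied to the coordinate function, the
    contraction says that the expected length of the image of [A_k, B_k] decays exponentially;
    comparing the logarithm of the derivative with the logarithm of that length gives a negative
    exponent. *)

Require Import Defs.
From Stdlib Require Import ZArith Reals Lra Lia List ClassicalEpsilon
  FunctionalExtensionality PropExtensionality Sorting.Sorted.
Import ListNotations.
Open Scope R_scope.

(** No measure on orbits is constructed: statements about random orbits are statements about powers
    of the Markov operator, and integrals are finite sums over step functions, a class that this
    operator preserves. Extremality is used only through a zero-one law for forward invariant sets.
    Monotone functions are the natural test class: the fibre maps increase, so the operator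
    preserves monotonicity, and a finite measure is determined by its values on down-sets, so
    contraction on monotone functions already yields uniqueness. Contraction comes from two losses,
    one at each end of the hull; at a crossing they add up to the whole oscillation in that fibre.
    In the exponent estimate the derivatives are merely continuous. Distortion is therefore bounded
    by an arbitrary [e] per step plus a multiple of the current length; the expected lengths have a
    bounded sum, and [e] is taken below the contraction rate. Jensen's inequality for the final
    logarithm is replaced by a tangent line, which can be averaged term by term. *)

(** * Finite sums indexed from zero *)

Fixpoint rsum (f : nat -> R) (n : nat) : R :=
  match n with O => 0 | S m => rsum f m + f m end.

Lemma sum_f_R0_rsum f N : (1 <= N)%nat -> sum_f_R0 f (N - 1) = rsum f N.
Proof.
  destruct N as [|n]; [lia|]; intros _. replace (S n - 1)%nat with n by lia.
  induction n as [|n IH]; simpl; [lra|]. rewrite IH. simpl. lra.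
Qed.

Lemma rsum_ext f g n : (forall k, (k < n)%nat -> f k = g k) -> rsum f n = rsum g n.
Proof.
  induction n as [|n IH]; simpl; intros H; [reflexivity|].
  rewrite IH, H by auto with arith. reflexivity.
Qed.

Lemma rsum_plus f g n : rsum (fun k => f k + g k) n = rsum f n + rsum g n.
Proof. induction n; simpl; lra. Qed.

Lemma rsum_minus f g n : rsum (fun k => f k - g k) n = rsum f n - rsum g n.
Proof. induction n; simpl; lra. Qed.

Lemma rsum_scal c f n : rsum (fun k => c * f k) n = c * rsum f n.
Proof. induction n; simpl; lra. Qed.

Lemma rsum_zero n : rsum (fun _ => 0) n = 0.
Proof. induction n; simpl; lra. Qed.

Lemma rsum_const c n : rsum (fun _ => c) n = INR n * c.
Proof. induction n; [simpl; lra|]. rewrite S_INR. simpl. lra. Qed.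

Lemma rsum_head f n : rsum f (S n) = f 0%nat + rsum (fun i => f (S i)) n.
Proof. induction n as [|n IH]; [simpl; lra|]. simpl in *. rewrite IH. lra. Qed.

Lemma rsum_add f n m : rsum f (n + m) = rsum f n + rsum (fun i => f (n + i)%nat) m.
Proof.
  induction m as [|m IH]; [rewrite Nat.add_0_r; simpl; lra|].
  rewrite Nat.add_succ_r. simpl. rewrite IH. lra.
Qed.

Lemma rsum_le f g n : (forall k, (k < n)%nat -> f k <= g k) -> rsum f n <= rsum g n.
Proof.
  induction n as [|n IH]; simpl; intros H; [lra|].
  apply Rplus_le_compat; auto with arith.
Qed.

Lemma rsum_nonneg f n : (forall k, (k < n)%nat -> 0 <= f k) -> 0 <= rsum f n.
Proof. intros H. rewrite <- (rsum_zero n). apply rsum_le, H. Qed.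

Lemma rsum_swap (f : nat -> nat -> R) n m :
  rsum (fun i => rsum (f i) m) n = rsum (fun j => rsum (fun i => f i j) n) m.
Proof.
  induction n as [|n IH]; simpl.
  - symmetry. apply rsum_zero.
  - rewrite IH. symmetry. apply rsum_plus.
Qed.

Lemma rsum_term_le f n k :
  (forall i, (i < n)%nat -> 0 <= f i) -> (k < n)%nat -> f k <= rsum f n.
Proof.
  induction n as [|n IH]; simpl; intros H Hk; [lia|].
  assert (0 <= rsum f n) by (apply rsum_nonneg; auto with arith).
  destruct (Nat.eq_dec k n) as [->|Hne]; [lra|].
  assert (f k <= rsum f n) by (apply IH; [auto with arith|lia]).
  assert (0 <= f n) by auto with arith. lra.
Qed.

Lemma rsum_zero_term f n k :
  (forall i, (i < n)%nat -> 0 <= f i) -> rsum f n <= 0 -> (k < n)%nat -> f k = 0.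
Proof.
  intros H H0 Hk. pose proof (rsum_term_le f n k H Hk). specialize (H k Hk). lra.
Qed.

Lemma rsum_lt f g n k :
  (forall i, (i < n)%nat -> f i <= g i) -> (k < n)%nat -> f k < g k -> rsum f n < rsum g n.
Proof.
  intros H Hk Hlt.
  pose proof (rsum_term_le (fun i => g i - f i) n k) as E. rewrite rsum_minus in E.
  enough (0 < g k - f k <= rsum g n - rsum f n) by lra. split; [lra|].
  apply E; [|exact Hk]. intros i Hi. specialize (H i Hi). lra.
Qed.

(** * Statements valid for all small parameters *)

(** A germ at [0+]: finitely many smallness demands can be imposed together without computing a
    threshold. *)
Definition evsmall (P : R -> Prop) : Prop :=
  exists t0, 0 < t0 /\ forall t, 0 < t < t0 -> P t.

Lemma evsmall_and P Q : evsmall P -> evsmall Q -> evsmall (fun t => P t /\ Q t).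
Proof.
  intros [a [Ha HP]] [b [Hb HQ]]. exists (Rmin a b).
  split; [apply Rmin_pos; assumption|]. intros t Ht.
  pose proof (Rmin_l a b). pose proof (Rmin_r a b). split; [apply HP|apply HQ]; lra.
Qed.

Lemma evsmall_mono (P Q : R -> Prop) : (forall t, P t -> Q t) -> evsmall P -> evsmall Q.
Proof. intros H [a [Ha HP]]. exists a. split; auto. Qed.

Lemma evsmall_fin n (P : nat -> R -> Prop) :
  (forall i, (i < n)%nat -> evsmall (P i)) ->
  evsmall (fun t => forall i, (i < n)%nat -> P i t).
Proof.
  induction n as [|n IH]; intros H.
  - exists 1. split; [lra|]. intros. lia.
  - assert (H1 := evsmall_and _ _ (IH (fun i Hi => H i (Nat.lt_lt_succ_r _ _ Hi)))
                              (H n (Nat.lt_succ_diag_r n))).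
    revert H1. apply evsmall_mono. intros t [Ha Hb] i Hi.
    destruct (Nat.eq_dec i n) as [->|]; [exact Hb|]. apply Ha. lia.
Qed.

Lemma evsmall_imp (C : Prop) P : (C -> evsmall P) -> evsmall (fun t => C -> P t).
Proof.
  intros H. destruct (classic C) as [c|nc].
  - generalize (H c). apply evsmall_mono. auto.
  - exists 1. split; [lra|]. intros. contradiction.
Qed.

Lemma evsmall_ex P : evsmall P -> exists t, 0 < t /\ P t.
Proof. intros [a [Ha H]]. exists (a / 2). split; [lra|]. apply H. lra. Qed.

(** * Finite choices *)

Lemma finite_choice {X : Type} (x0 : X) n (P : nat -> X -> Prop) :
  (forall i, (i < n)%nat -> exists x, P i x) ->
  exists f : nat -> X, forall i, (i < n)%nat -> P i (f i).
Proof.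
  induction n as [|n IH]; intros H.
  - exists (fun _ => x0). intros. lia.
  - destruct IH as [f Hf]; [auto with arith|].
    destruct (H n) as [x Hx]; [lia|].
    exists (fun i => if Nat.eq_dec i n then x else f i). intros i Hi.
    destruct (Nat.eq_dec i n) as [->|]; [exact Hx|]. apply Hf. lia.
Qed.

Lemma finite_argmin {X : Type} (L : list X) (Q : X -> Prop) (f : X -> R) :
  (exists x, In x L /\ Q x) ->
  exists x, In x L /\ Q x /\ forall y, In y L -> Q y -> f x <= f y.
Proof.
  induction L as [|a L IH]; intros [x [Hx HQ]]; [destruct Hx|].
  destruct (classic (exists y, In y L /\ Q y)) as [HL|HL].
  - destruct (IH HL) as [m [Hm [HQm Hmin]]].
    destruct (classic (Q a /\ f a <= f m)) as [[Ha Hle]|Hn].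
    + exists a. split; [now left|]. split; [exact Ha|]. intros y [<-|Hy] HQy; [lra|].
      specialize (Hmin y Hy HQy). lra.
    + exists m. split; [now right|]. split; [exact HQm|]. intros y [<-|Hy] HQy; [|auto].
      apply Rnot_lt_le. intros Hlt. apply Hn. split; [exact HQy|lra].
  - destruct Hx as [<-|Hx]; [|exfalso; eauto].
    exists a. split; [now left|]. split; [exact HQ|]. intros y [<-|Hy] HQy; [lra|].
    exfalso; eauto.
Qed.

Lemma index_argmin n (Q : nat -> Prop) (f : nat -> R) :
  (exists i, (i < n)%nat /\ Q i) ->
  exists i, (i < n)%nat /\ Q i /\ forall j, (j < n)%nat -> Q j -> f i <= f j.
Proof.
  intros [i [Hi HQ]].
  destruct (finite_argmin (seq 0 n) Q f) as [m [Hm [HQm H]]].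
  - exists i. rewrite in_seq. split; [lia|exact HQ].
  - exists m. rewrite in_seq in Hm. split; [lia|]. split; [exact HQm|].
    intros j Hj HQj. apply H; [rewrite in_seq; lia|exact HQj].
Qed.

(** The list repeats words; it serves only as a finite carrier for minimisation over simple paths
    and cycles and for finiteness of fixed points. *)
Fixpoint words (N n : nat) : list (list nat) :=
  match n with
  | O => [[]]
  | S m => words N m ++ flat_map (fun a => map (cons a) (words N m)) (seq 0 N)
  end.

Lemma in_words N n w :
  (length w <= n)%nat -> (forall a, In a w -> (a < N)%nat) -> In w (words N n).
Proof.
  revert w; induction n as [|n IH]; intros w Hl Ha.
  - destruct w; simpl in *; [now left|lia].
  - simpl. apply in_or_app. destruct w as [|a w].
    + left. apply IH; simpl; [lia|easy].
    + right. apply in_flat_map. exists a. split.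
      * apply in_seq. specialize (Ha a (or_introl eq_refl)). lia.
      * apply in_map, IH; [simpl in Hl; lia|]. intros b Hb. apply Ha. now right.
Qed.

Lemma NoDup_below_length N w :
  NoDup w -> (forall a, In a w -> (a < N)%nat) -> (length w <= N)%nat.
Proof.
  intros H Ha. rewrite <- (length_seq N 0). apply NoDup_incl_length; [exact H|].
  intros a Hin. apply in_seq. specialize (Ha a Hin). lia.
Qed.

(** * Borel sets *)

Lemma pred_ext (B C : R -> Prop) : (forall x, B x <-> C x) -> B = C.
Proof.
  intros H. apply functional_extensionality. intros x. apply propositional_extensionality, H.
Qed.

Lemma borel_iff B C : borel B -> (forall x, B x <-> C x) -> borel C.
Proof. intros HB H. rewrite <- (pred_ext B C H). exact HB. Qed.

Lemma borel_false : borel (fun _ => False).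
Proof. apply (borel_iff _ _ (borel_interval 0 0)). intros x. split; [lra|tauto]. Qed.

Lemma borel_true : borel (fun _ => True).
Proof. apply (borel_iff _ _ (borel_compl _ borel_false)). tauto. Qed.

Lemma borel_const_and (P : Prop) B : borel B -> borel (fun x => P /\ B x).
Proof.
  intros HB. destruct (classic P) as [p|np].
  - apply (borel_iff _ _ HB). tauto.
  - apply (borel_iff _ _ borel_false). tauto.
Qed.

Lemma borel_or B C : borel B -> borel C -> borel (fun x => B x \/ C x).
Proof.
  intros HB HC.
  apply (borel_iff (fun x => exists n : nat, (match n with O => B | _ => C end) x)).
  - apply (borel_union (fun n => match n with O => B | _ => C end)). intros [|n]; assumption.
  - intros x. split.
    + intros [[|n] H]; auto.
    + intros [H|H]; [exists O|exists 1%nat]; exact H.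
Qed.

Lemma borel_and B C : borel B -> borel C -> borel (fun x => B x /\ C x).
Proof.
  intros HB HC.
  apply (borel_iff (fun x => ~ (~ B x \/ ~ C x))).
  - apply borel_compl, borel_or; apply borel_compl; assumption.
  - intros x. split; [intros H; split; apply NNPP; tauto|tauto].
Qed.

Lemma borel_diff B C : borel B -> borel C -> borel (fun x => B x /\ ~ C x).
Proof. intros HB HC. apply borel_and; [|apply borel_compl]; assumption. Qed.

Lemma archimed_nat x : exists n : nat, x < INR n.
Proof.
  destruct (Rle_lt_dec x 0) as [H|H].
  - exists 1%nat. simpl. lra.
  - destruct (archimed x) as [H1 _]. exists (Z.to_nat (up x)).
    rewrite INR_IZR_INZ, Z2Nat.id; [lra|]. apply le_IZR. lra.
Qed.

Lemma inv_INR_small e : 0 < e -> exists n : nat, / INR (S n) < e.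
Proof.
  intros He. destruct (archimed_nat (/ e)) as [n Hn]. exists n.
  rewrite S_INR. rewrite <- (Rinv_inv e). apply Rinv_lt_contravar; [|lra].
  assert (0 < / e) by (apply Rinv_0_lt_compat; lra). apply Rmult_lt_0_compat; lra.
Qed.

Lemma inv_INR_pos n : 0 < / INR (S n).
Proof. apply Rinv_0_lt_compat, lt_0_INR. lia. Qed.

Lemma borel_lt a : borel (fun x => x < a).
Proof.
  apply (borel_iff (fun x => exists n, a - INR n < x < a)).
  - apply borel_union. intros n. apply borel_interval.
  - intros x. split; [intros [n H]; lra|]. intros H.
    destruct (archimed_nat (a - x)) as [n Hn]. exists n. lra.
Qed.

Lemma borel_gt a : borel (fun x => a < x).
Proof.
  apply (borel_iff (fun x => exists n, a < x < a + INR n)).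
  - apply borel_union. intros n. apply borel_interval.
  - intros x. split; [intros [n H]; lra|]. intros H.
    destruct (archimed_nat (x - a)) as [n Hn]. exists n. lra.
Qed.

Lemma borel_le a : borel (fun x => x <= a).
Proof. apply (borel_iff _ _ (borel_compl _ (borel_gt a))). intros x. lra. Qed.

Lemma borel_ge a : borel (fun x => a <= x).
Proof. apply (borel_iff _ _ (borel_compl _ (borel_lt a))). intros x. lra. Qed.

Lemma borel_inI : borel inI.
Proof. apply borel_and; [apply borel_ge|apply borel_le]. Qed.

(** An open set is the union of the intervals of rational centre [(a - b) / (n + 1)] and radius
    [2 / (n + 1)] that it contains. Three indices in [nat] keep the union countable in the required
    form, and intervals not contained in [U] are switched off by a constant conjunct. *)
Lemma borel_open (U : R -> Prop) :
  (forall x, U x -> exists e, 0 < e /\ forall y, x - e < y < x + e -> U y) -> borel U.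
Proof.
  intros HU.
  set (c := fun n a b => (INR a - INR b) * / INR (S n)).
  set (J := fun n a b x => c n a b - 2 * / INR (S n) < x < c n a b + 2 * / INR (S n)).
  apply (borel_iff (fun x => exists n, exists a, exists b,
    (forall y, J n a b y -> U y) /\ J n a b x)).
  - do 3 (apply borel_union; intro). apply borel_const_and, borel_interval.
  - intros x. split.
    + intros [n [a [b [H HJ]]]]. auto.
    + intros Hx. destruct (HU x Hx) as [e [He Hy]].
      destruct (inv_INR_small (e / 3)) as [n Hn]; [lra|].
      pose proof (inv_INR_pos n) as Hp.
      assert (HS : 0 < INR (S n)) by (apply lt_0_INR; lia).
      assert (Hinv : INR (S n) * / INR (S n) = 1) by (apply Rinv_r; lra).
      destruct (archimed (x * INR (S n))) as [H1 H2].
      set (z := up (x * INR (S n))) in *.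
      assert (Hz : INR (Z.to_nat z) - INR (Z.to_nat (- z)) = IZR z).
      { destruct (Z_le_gt_dec 0 z) as [Hz|Hz].
        - rewrite (INR_IZR_INZ (Z.to_nat z)), Z2Nat.id by lia.
          replace (Z.to_nat (- z)) with O by lia. simpl. lra.
        - replace (Z.to_nat z) with O by lia.
          rewrite (INR_IZR_INZ (Z.to_nat (- z))), Z2Nat.id, opp_IZR by lia. simpl. lra. }
      assert (E1 : x < IZR z * / INR (S n)).
      { apply (Rmult_lt_reg_r (INR (S n))); [lra|].
        rewrite Rmult_assoc, (Rmult_comm (/ _)), Hinv. lra. }
      assert (E2 : IZR z * / INR (S n) <= x + / INR (S n)).
      { apply (Rmult_le_reg_r (INR (S n))); [lra|].
        rewrite Rmult_plus_distr_r, Rmult_assoc, (Rmult_comm (/ _)), Hinv. lra. }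
      exists n, (Z.to_nat z), (Z.to_nat (- z)). unfold J, c. rewrite Hz.
      split; [intros y Hyy; apply Hy|]; lra.
Qed.

Lemma borel_preimage f B : continuity f -> borel B -> borel (fun x => B (f x)).
Proof.
  intros Hf HB. induction HB as [a b|B HB IH|Bn HB IH].
  - apply borel_open. intros x Hx.
    destruct (Hf x (Rmin (f x - a) (b - f x))) as [d [Hd H]]; [apply Rmin_pos; lra|].
    exists d. split; [exact Hd|]. intros y Hy.
    destruct (Req_dec x y) as [<-|Hne]; [exact Hx|].
    specialize (H y). simpl in H. unfold R_dist in H.
    assert (Hyx : Rabs (y - x) < d) by (apply Rabs_def1; lra).
    specialize (H (conj (conj I Hne) Hyx)). apply Rabs_def2 in H.
    pose proof (Rmin_l (f x - a) (b - f x)). pose proof (Rmin_r (f x - a) (b - f x)). lra.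
  - exact (borel_compl _ IH).
  - exact (borel_union _ IH).
Qed.

(** * Finite measures *)

Lemma infinite_sum_const c l : infinite_sum (fun _ => c) l -> c = 0.
Proof.
  intros H. apply NNPP. intros Hc.
  destruct (H (Rabs c / 2)) as [n Hn]; [apply Rabs_pos_lt in Hc; lra|].
  pose proof (Hn n (le_n n)) as H1. pose proof (Hn (S n) (Nat.le_succ_diag_r n)) as H2.
  simpl in H2. unfold Rdist in *. revert H1 H2. unfold Rabs.
  repeat destruct Rcase_abs; lra.
Qed.

Lemma infinite_sum_finite u n l :
  (forall k, (n < k)%nat -> u k = 0) -> infinite_sum u l -> l = sum_f_R0 u n.
Proof.
  intros Hu H. apply (UL_sequence (sum_f_R0 u)); [exact H|].
  intros e He. exists n. intros m Hm.
  replace (sum_f_R0 u m) with (sum_f_R0 u n); [unfold Rdist; rewrite Rminus_diag, Rabs_R0; exact He|].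
  induction Hm as [|m Hm IH]; [reflexivity|]. simpl. rewrite IH, (Hu (S m)) by lia. lra.
Qed.

Section Measure.

Context (m : meas) (Hm : is_fmeas_I m).

Lemma meas_ext B C : borel B -> (forall x, inI x -> (B x <-> C x)) -> borel C -> m B = m C.
Proof using Hm.
  destruct Hm as [He [_ [HI _]]]. intros HB H HC.
  rewrite (HI B HB), (HI C HC). apply He.
  - apply borel_and, borel_inI; exact HB.
  - intros x. specialize (H x). tauto.
Qed.

Lemma meas_nonneg B : borel B -> 0 <= m B.
Proof using Hm. apply Hm. Qed.

Lemma meas_false : m (fun _ => False) = 0.
Proof using Hm.
  destruct Hm as [_ [_ [_ H]]].
  refine (infinite_sum_const _ _ (H (fun _ _ => False) _ _)); intros; [apply borel_false|easy].
Qed.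

Lemma meas_null B : borel B -> (forall x, inI x -> ~ B x) -> m B = 0.
Proof using Hm.
  intros HB H. rewrite <- meas_false. apply meas_ext; [exact HB| |apply borel_false].
  intros x Hx. specialize (H x Hx). tauto.
Qed.

Lemma meas_or B C : borel B -> borel C -> (forall x, B x -> C x -> False) ->
  m (fun x => B x \/ C x) = m B + m C.
Proof using Hm.
  intros HB HC Hd. pose proof Hm as [_ [_ [_ H]]].
  set (Bn := fun n : nat => match n with O => B | S O => C | _ => fun _ => False end).
  assert (HBn : forall n, borel (Bn n)) by (intros [|[|n]]; try assumption; apply borel_false).
  rewrite <- (pred_ext (fun x => exists n, Bn n x) (fun x => B x \/ C x)).
  - rewrite (infinite_sum_finite (fun n => m (Bn n)) 1 (m (fun x => exists n, Bn n x))).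
    + reflexivity.
    + intros [|[|k]] Hk; try lia. apply meas_false.
    + apply H; [exact HBn|]. intros [|[|n]] [|[|p]] x Hne; simpl; try easy; try tauto; eauto.
  - intros x. split.
    + intros [[|[|n]] Hx]; simpl in Hx; tauto.
    + intros [Hx|Hx]; [exists O|exists 1%nat]; exact Hx.
Qed.

Lemma meas_split B C : borel B -> borel C ->
  m B = m (fun x => B x /\ C x) + m (fun x => B x /\ ~ C x).
Proof using Hm.
  intros HB HC. rewrite <- meas_or.
  - apply meas_ext; [exact HB| |].
    + intros x _. destruct (classic (C x)); tauto.
    + apply borel_or; [apply borel_and|apply borel_diff]; assumption.
  - apply borel_and; assumption.
  - apply borel_diff; assumption.
  - tauto.
Qed.

Lemma meas_mono B C : borel B -> borel C -> (forall x, inI x -> B x -> C x) -> m B <= m C.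
Proof using Hm.
  intros HB HC H. rewrite (meas_split C B HC HB).
  rewrite (meas_ext (fun x => C x /\ B x) B); [|apply borel_and; assumption| |exact HB].
  - pose proof (meas_nonneg (fun x => C x /\ ~ B x) (borel_diff _ _ HC HB)). lra.
  - intros x Hx. specialize (H x Hx). tauto.
Qed.

Lemma meas_le_total B : borel B -> m B <= m inI.
Proof using Hm. intros HB. apply meas_mono; [exact HB|apply borel_inI|tauto]. Qed.

Lemma meas_compl B : borel B -> m (fun x => ~ B x) = m inI - m B.
Proof using Hm.
  intros HB. rewrite (meas_split inI B borel_inI HB).
  rewrite (meas_ext (fun x => inI x /\ B x) B).
  - rewrite (meas_ext (fun x => inI x /\ ~ B x) (fun x => ~ B x)); [lra| | |].
    + apply borel_diff; [apply borel_inI|exact HB].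
    + tauto.
    + apply borel_compl, HB.
  - apply borel_and; [apply borel_inI|exact HB].
  - tauto.
  - exact HB.
Qed.

Lemma meas_incr_union_le (Bn : nat -> R -> Prop) v :
  (forall n, borel (Bn n)) -> (forall n x, Bn n x -> Bn (S n) x) ->
  (forall n, m (Bn n) <= v) -> m (fun x => exists n, Bn n x) <= v.
Proof using Hm.
  intros HB Hinc Hv. pose proof Hm as [_ [_ [_ H]]].
  (* The increments are disjoint, and their partial sums of measures telescope to [m (Bn n)]. *)
  set (C := fun n => match n with O => Bn O | S p => fun x => Bn (S p) x /\ ~ Bn p x end).
  assert (HC : forall n, borel (C n)) by (intros [|n]; [apply HB|apply borel_diff; apply HB]).
  assert (Hle : forall n p x, (n <= p)%nat -> Bn n x -> Bn p x)
    by (intros n p x Hnp; induction Hnp; auto).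
  assert (HCn : forall n x, C n x -> Bn n x) by (intros [|n] x; simpl; tauto).
  assert (Hlt : forall n p x, (n < p)%nat -> C n x -> C p x -> False).
  { intros n [|p] x Hnp Hn Hp; [lia|]. destruct Hp as [_ Hp]. apply Hp.
    apply (Hle n); [lia|auto]. }
  assert (Hsum : infinite_sum (fun n => m (C n)) (m (fun x => exists n, Bn n x))).
  { rewrite (pred_ext (fun x => exists n, Bn n x) (fun x => exists n, C n x)).
    - apply H; [exact HC|]. intros n p x Hne Hn Hp.
      destruct (Nat.lt_total n p) as [|[|]]; eauto.
    - intros x. split; intros [n Hn]; [|eauto].
      induction n as [|n IH]; [exists O; exact Hn|].
      destruct (classic (Bn n x)) as [Hx|Hx]; [auto|]. exists (S n). split; assumption. }
  assert (Hpart : forall n, sum_f_R0 (fun n => m (C n)) n = m (Bn n)).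
  { induction n as [|n IH]; [reflexivity|]. simpl. rewrite IH.
    rewrite (meas_split (Bn (S n)) (Bn n)) by auto. f_equal.
    rewrite (meas_ext (fun x => Bn (S n) x /\ Bn n x) (Bn n)); [reflexivity| |firstorder|auto].
    apply borel_and; auto. }
  apply Rnot_lt_le. intros Hlt'.
  destruct (Hsum (m (fun x => exists n, Bn n x) - v)) as [n Hn]; [lra|].
  specialize (Hn n (le_n n)). rewrite Hpart in Hn. unfold Rdist in Hn.
  apply Rabs_def2 in Hn. specialize (Hv n). lra.
Qed.

Lemma meas_lt_left a v : (forall b, b < a -> m (fun x => x < b) <= v) -> m (fun x => x < a) <= v.
Proof using Hm.
  intros H.
  rewrite (pred_ext (fun x => x < a) (fun x => exists n : nat, x < a - / INR (S n))).
  - apply meas_incr_union_le.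
    + intros n. apply borel_lt.
    + intros n x Hx. assert (/ INR (S (S n)) <= / INR (S n)); [|lra].
      apply Rinv_le_contravar; [apply lt_0_INR; lia|]. apply le_INR. lia.
    + intros n. apply H. pose proof (inv_INR_pos n). lra.
  - intros x. split.
    + intros Hx. destruct (inv_INR_small (a - x)) as [n Hn]; [lra|]. exists n. lra.
    + intros [n Hn]. pose proof (inv_INR_pos n). lra.
Qed.

(** Continuity from above, read off from continuity from below on the complements because the mass
    is finite. For the lower end [a] of a support and [v > 0] it detects an atom at [a]. *)
Lemma meas_le_right a v :
  (forall b, a < b -> v <= m (fun x => x < b)) -> v <= m (fun x => x <= a).
Proof using Hm.
  intros H.
  assert (E : m (fun x => a < x) <= m inI - v).
  { rewrite (pred_ext (fun x => a < x) (fun x => exists n : nat, a + / INR (S n) <= x)).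
    - apply meas_incr_union_le.
      + intros n. apply borel_ge.
      + intros n x Hx. assert (/ INR (S (S n)) <= / INR (S n)); [|lra].
        apply Rinv_le_contravar; [apply lt_0_INR; lia|]. apply le_INR. lia.
      + intros n. pose proof (inv_INR_pos n).
        rewrite (pred_ext (fun x => a + / INR (S n) <= x) (fun x => ~ x < a + / INR (S n)))
          by (intros; lra).
        rewrite meas_compl by apply borel_lt. specialize (H (a + / INR (S n))). lra.
    - intros x. split.
      + intros Hx. destruct (inv_INR_small (x - a)) as [n Hn]; [lra|]. exists n. lra.
      + intros [n Hn]. pose proof (inv_INR_pos n). lra. }
  rewrite (pred_ext (fun x => a < x) (fun x => ~ x <= a)) in E by (intros; lra).
  rewrite meas_compl in E by apply borel_le. lra.
Qed.

End Measure.

(** Dynkin's lemma for the pi-system of Borel down-sets. *)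
Inductive dynkin : (R -> Prop) -> Prop :=
  | dynkin_down C : borel C -> (forall x y, C x -> y <= x -> C y) -> dynkin C
  | dynkin_compl C : dynkin C -> dynkin (fun x => ~ C x)
  | dynkin_union (Cn : nat -> R -> Prop) : (forall n, dynkin (Cn n)) ->
      (forall n p x, n <> p -> Cn n x -> Cn p x -> False) ->
      dynkin (fun x => exists n, Cn n x).

Lemma dynkin_iff B C : dynkin B -> (forall x, B x <-> C x) -> dynkin C.
Proof. intros HB H. rewrite <- (pred_ext B C H). exact HB. Qed.

Lemma dynkin_or B C : dynkin B -> dynkin C -> (forall x, B x -> C x -> False) ->
  dynkin (fun x => B x \/ C x).
Proof.
  intros HB HC Hd.
  set (Bn := fun n : nat => match n with O => B | S O => C | _ => fun _ => False end).
  apply (dynkin_iff (fun x => exists n, Bn n x)).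
  - apply dynkin_union.
    + intros [|[|n]]; simpl; auto. apply dynkin_down; [apply borel_false|tauto].
    + intros [|[|n]] [|[|p]] x Hne; simpl; try easy; try tauto; eauto.
  - intros x. split.
    + intros [[|[|n]] Hx]; simpl in Hx; tauto.
    + intros [Hx|Hx]; [exists O|exists 1%nat]; exact Hx.
Qed.

(** For fixed [B], the sets whose intersection with [B] is in the class form a Dynkin class
    themselves: [B] minus [C] is the complement of the disjoint union of the complement of [B] and
    [B] meet [C]. Two applications give stability under intersection. *)
Lemma dynkin_and_gen (B : R -> Prop) : dynkin B ->
  (forall C, borel C -> (forall x y, C x -> y <= x -> C y) -> dynkin (fun x => B x /\ C x)) ->
  forall C, dynkin C -> dynkin (fun x => B x /\ C x).
Proof.
  intros HB Hgen C HC. induction HC as [C H1 H2|C HC IH|Cn HC IH Hd].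
  - auto.
  - apply (dynkin_iff (fun x => ~ (~ B x \/ (B x /\ C x)))).
    + apply dynkin_compl, dynkin_or; [apply dynkin_compl, HB|exact IH|tauto].
    + intros x. destruct (classic (B x)); tauto.
  - apply (dynkin_iff (fun x => exists n, B x /\ Cn n x)).
    + apply dynkin_union; [exact IH|]. intros n p x Hne [_ H1] [_ H2]. eauto.
    + firstorder.
Qed.

Lemma dynkin_and B C : dynkin B -> dynkin C -> dynkin (fun x => B x /\ C x).
Proof.
  intros HB HC. revert C HC. apply dynkin_and_gen; [exact HB|].
  intros C HC1 HC2.
  apply (dynkin_iff (fun x => C x /\ B x)); [|tauto].
  apply dynkin_and_gen; [apply dynkin_down; assumption| |exact HB].
  intros D HD1 HD2. apply dynkin_down; [apply borel_and; assumption|].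
  intros x y [H1 H2] Hy. eauto.
Qed.

Lemma borel_dynkin B : borel B -> dynkin B.
Proof.
  intros HB. induction HB as [a b|B HB IH|Bn HB IH].
  - apply (dynkin_iff (fun x => ~ x <= a /\ x < b)); [|intros; lra].
    apply dynkin_and; [apply dynkin_compl|]; apply dynkin_down;
      [apply borel_le|intros; lra|apply borel_lt|intros; lra].
  - apply dynkin_compl, IH.
  (* [P n] collects the sets before the [n]-th; subtracting it makes the union disjoint, as the
     Dynkin class demands. *)
  - set (P := fun n x => exists p, (p < n)%nat /\ Bn p x).
    assert (HP : forall n, dynkin (P n)).
    { induction n as [|n IHn].
      - apply (dynkin_iff (fun _ => False)).
        + apply dynkin_down; [apply borel_false|tauto].
        + intros x. split; [easy|]. intros [p [Hp _]]. lia.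
      - apply (dynkin_iff (fun x => ~ (~ P n x /\ ~ Bn n x))).
        + apply dynkin_compl, dynkin_and; apply dynkin_compl; auto.
        + intros x. split.
          * intros H. destruct (classic (Bn n x)) as [Hx|Hx]; [exists n; auto|].
            destruct (classic (P n x)) as [[p [Hp Hx']]|]; [exists p; auto|tauto].
          * intros [p [Hp Hx]] [H1 H2]. destruct (Nat.eq_dec p n) as [->|]; [tauto|].
            apply H1. exists p. split; [lia|exact Hx]. }
    apply (dynkin_iff (fun x => exists n, Bn n x /\ ~ P n x)).
    + apply dynkin_union.
      * intros n. apply dynkin_and; [auto|apply dynkin_compl, HP].
      * intros n p x Hne [H1 H2] [H3 H4].
        destruct (Nat.lt_total n p) as [Hl|[Hl|Hl]]; [|easy|].
        -- apply H4. exists n. auto.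
        -- apply H2. exists p. auto.
    + intros x. split; [intros [n [Hn _]]; eauto|].
      intros [n Hn]. induction n as [n IHn] using lt_wf_ind.
      destruct (classic (P n x)) as [[p [Hp Hx]]|Hx]; [eauto|]. exists n. auto.
Qed.

Lemma dynkin_borel B : dynkin B -> borel B.
Proof.
  intros H; induction H; [assumption|apply borel_compl; assumption|apply borel_union; assumption].
Qed.

(** Down-sets suffice, and their complements have nondecreasing indicators: these are the functions
    on which the Markov operator contracts. *)
Lemma fmeas_unique m1 m2 : is_fmeas_I m1 -> is_fmeas_I m2 -> m1 inI = m2 inI ->
  (forall C, borel C -> (forall x y, C x -> y <= x -> C y) -> m1 C = m2 C) ->
  forall B, borel B -> m1 B = m2 B.
Proof.
  intros H1 H2 HI HD B HB. apply borel_dynkin in HB.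
  induction HB as [C Hb Hd|C HC IH|Cn HC IH Hd].
  - auto.
  - apply dynkin_borel in HC. rewrite !meas_compl by assumption. lra.
  - assert (Hb : forall n, borel (Cn n)) by (intros; apply dynkin_borel; auto).
    pose proof (proj2 (proj2 (proj2 H1)) Cn Hb Hd) as S1.
    pose proof (proj2 (proj2 (proj2 H2)) Cn Hb Hd) as S2.
    apply (UL_sequence _ _ _ S1).
    replace (fun n => m1 (Cn n)) with (fun n => m2 (Cn n)); [exact S2|].
    apply functional_extensionality. intros n. symmetry. apply IH.
Qed.

(** * Simple functions *)

Definition indic (P : Prop) : R := if excluded_middle_informative P then 1 else 0.

Lemma indic_true (P : Prop) : P -> indic P = 1.
Proof. intros H. unfold indic. destruct excluded_middle_informative; tauto. Qed.

Lemma indic_false (P : Prop) : ~ P -> indic P = 0.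
Proof. intros H. unfold indic. destruct excluded_middle_informative; tauto. Qed.

Lemma indic_mono (P Q : Prop) : (P -> Q) -> indic P <= indic Q.
Proof. intros H. unfold indic. repeat destruct excluded_middle_informative; try lra. tauto. Qed.

(** The sets of a step function may overlap, so sums are concatenations and linearity is immediate;
    the price is that monotonicity of the integral needs a proof. *)
Definition sev (s : list (R * (R -> Prop))) (x : R) : R :=
  fold_right (fun '(c, B) r => c * indic (B x) + r) 0 s.
Definition sint (m : meas) (s : list (R * (R -> Prop))) : R :=
  fold_right (fun '(c, B) r => c * m B + r) 0 s.
Definition sborel (s : list (R * (R -> Prop))) : Prop := forall c B, In (c, B) s -> borel B.

Lemma sborel_cons c B s : sborel ((c, B) :: s) <-> borel B /\ sborel s.
Proof.
  unfold sborel. split.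
  - intros H. split; [apply (H c B); now left|]. intros c' B' H'. apply (H c' B'). now right.
  - intros [H1 H2] c' B' [H|H]; [inversion H; subst; exact H1|eauto].
Qed.

Lemma sborel_app s t : sborel s -> sborel t -> sborel (s ++ t).
Proof. intros Hs Ht c B H. apply in_app_or in H as [H|H]; eauto. Qed.

Lemma sev_app s t x : sev (s ++ t) x = sev s x + sev t x.
Proof. induction s as [|[c B] s IH]; simpl; [lra|]. rewrite IH. lra. Qed.

Lemma sint_app m s t : sint m (s ++ t) = sint m s + sint m t.
Proof. induction s as [|[c B] s IH]; simpl; [lra|]. rewrite IH. lra. Qed.

(** Induction on the list with [E] and [M] varying: [E] is cut along the first set [B], and on the
    part inside [B] the remaining list is bounded by [M - c]. For the empty list and [M < 0] no
    point of [I] lies in [E]. *)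
Lemma sint_restrict_le m s E M : is_fmeas_I m -> sborel s -> borel E ->
  (forall x, inI x -> E x -> sev s x <= M) ->
  sint m (map (fun '(c, B) => (c, fun x => E x /\ B x)) s) <= M * m E.
Proof.
  intros Hm. revert E M. induction s as [|[c B] s IH]; intros E M Hs HE H; simpl in *.
  - destruct (Rle_lt_dec 0 M) as [HM|HM].
    + pose proof (meas_nonneg m Hm E HE). nra.
    + rewrite (meas_null m Hm E HE); [lra|]. intros x Hx HEx. specialize (H x Hx HEx). lra.
  - apply sborel_cons in Hs as [HB Hs].
    pose proof (IH (fun x => E x /\ B x) (M - c) Hs) as I1.
    pose proof (IH (fun x => E x /\ ~ B x) M Hs) as I2.
    assert (Hsplit : sint m (map (fun '(c, B) => (c, fun x => E x /\ B x)) s) =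
      sint m (map (fun '(c, B0) => (c, fun x => (E x /\ B x) /\ B0 x)) s) +
      sint m (map (fun '(c, B0) => (c, fun x => (E x /\ ~ B x) /\ B0 x)) s)).
    { clear - Hs HB HE Hm. induction s as [|[c' B'] s IH]; simpl; [lra|].
      apply sborel_cons in Hs as [HB' Hs]. rewrite IH by assumption.
      rewrite (meas_split m Hm (fun x => E x /\ B' x) B); [|apply borel_and; assumption|assumption].
      rewrite (pred_ext (fun x => (E x /\ B' x) /\ B x) (fun x => (E x /\ B x) /\ B' x))
        by (intros; tauto).
      rewrite (pred_ext (fun x => (E x /\ B' x) /\ ~ B x) (fun x => (E x /\ ~ B x) /\ B' x))
        by (intros; tauto). lra. }
    rewrite Hsplit, (meas_split m Hm E B HE HB).
    assert (J1 := I1 (borel_and _ _ HE HB)). assert (J2 := I2 (borel_diff _ _ HE HB)).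
    clear I1 I2 IH.
    assert (K1 : forall x, inI x -> E x /\ B x -> sev s x <= M - c).
    { intros x Hx [HEx HBx]. specialize (H x Hx HEx). rewrite indic_true in H by exact HBx. lra. }
    assert (K2 : forall x, inI x -> E x /\ ~ B x -> sev s x <= M).
    { intros x Hx [HEx HBx]. specialize (H x Hx HEx). rewrite indic_false in H by exact HBx. lra. }
    specialize (J1 K1). specialize (J2 K2). lra.
Qed.

Lemma sint_le m s E M : is_fmeas_I m -> sborel s -> borel E -> m (fun x => ~ E x) = 0 ->
  (forall x, inI x -> E x -> sev s x <= M) -> sint m s <= M * m inI.
Proof.
  intros Hm Hs HE H0 H. pose proof (sint_restrict_le m s E M Hm Hs HE H) as H1.
  replace (m inI) with (m E).
  2: { pose proof (meas_compl m Hm E HE). lra. }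
  replace (sint m s) with (sint m (map (fun '(c, B) => (c, fun x => E x /\ B x)) s)); [exact H1|].
  clear H1 H. induction s as [|[c B] s IH]; simpl; [reflexivity|].
  apply sborel_cons in Hs as [HB Hs]. rewrite IH by assumption.
  rewrite (meas_split m Hm B E HB HE).
  rewrite (pred_ext (fun x => B x /\ E x) (fun x => E x /\ B x)) by (intros; tauto).
  assert (m (fun x => B x /\ ~ E x) <= m (fun x => ~ E x)).
  { apply meas_mono; [exact Hm|apply borel_diff; assumption|apply borel_compl, HE|tauto]. }
  pose proof (meas_nonneg m Hm _ (borel_diff _ _ HB HE)).
  replace (m (fun x => B x /\ ~ E x)) with 0 by lra. lra.
Qed.

Definition sneg (s : list (R * (R -> Prop))) := map (fun '(c, B) => (- c, B)) s.

Lemma sev_neg s x : sev (sneg s) x = - sev s x.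
Proof. induction s as [|[c B] s IH]; simpl; [lra|]. rewrite IH. lra. Qed.

Lemma sint_neg m s : sint m (sneg s) = - sint m s.
Proof. induction s as [|[c B] s IH]; simpl; [lra|]. rewrite IH. lra. Qed.

Lemma sborel_neg s : sborel s -> sborel (sneg s).
Proof.
  intros H c B Hin. apply in_map_iff in Hin as [[c' B'] [E Hin]]. inversion E; subst. eauto.
Qed.

Lemma sint_ge m s E M : is_fmeas_I m -> sborel s -> borel E -> m (fun x => ~ E x) = 0 ->
  (forall x, inI x -> E x -> M <= sev s x) -> M * m inI <= sint m s.
Proof.
  intros Hm Hs HE H0 H.
  pose proof (sint_le m (sneg s) E (- M) Hm (sborel_neg s Hs) HE H0) as H1.
  rewrite sint_neg in H1.
  assert (forall x, inI x -> E x -> sev (sneg s) x <= - M).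
  { intros x Hx HEx. rewrite sev_neg. specialize (H x Hx HEx). lra. }
  specialize (H1 H2). lra.
Qed.

Lemma sint_mono m s t : is_fmeas_I m -> sborel s -> sborel t ->
  (forall x, inI x -> sev s x <= sev t x) -> sint m s <= sint m t.
Proof.
  intros Hm Hs Ht H.
  pose proof (sint_le m (s ++ sneg t) (fun _ => True) 0 Hm) as E.
  rewrite sint_app, sint_neg in E.
  assert (sint m s + - sint m t <= 0 * m inI); [|lra]. apply E.
  - apply sborel_app; [exact Hs|apply sborel_neg, Ht].
  - apply borel_true.
  - apply meas_null; [exact Hm|apply borel_compl, borel_true|tauto].
  - intros x Hx _. rewrite sev_app, sev_neg. specialize (H x Hx). lra.
Qed.

Lemma sev_map_scal a f s x :
  sev (map (fun '(c, B) => (c * a, fun y => B (f y))) s) x = a * sev s (f x).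
Proof. induction s as [|[c B] s IH]; simpl; [lra|]. rewrite IH. lra. Qed.

(** * The Markov operator *)

Definition markov N (Pi : nat -> nat -> R) (F : nat -> R -> R) (g : nat -> R -> R) k x : R :=
  rsum (fun j => Pi k j * g j (F k x)) N.

Fixpoint catn {X : Type} (f : nat -> list X) (n : nat) : list X :=
  match n with O => [] | S m => catn f m ++ f m end.

Lemma in_catn {X} (f : nat -> list X) n x :
  In x (catn f n) -> exists j, (j < n)%nat /\ In x (f j).
Proof.
  induction n as [|n IH]; simpl; [tauto|]. intros H. apply in_app_or in H as [H|H].
  - destruct (IH H) as [j [Hj Hx]]. exists j. auto.
  - exists n. auto.
Qed.

(** The Markov operator on step functions: sets become preimages and coefficients are weighted by
    transition probabilities. *)
Definition spull N (Pi : nat -> nat -> R) (F : nat -> R -> R)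
  (s : nat -> list (R * (R -> Prop))) (k : nat) :=
  catn (fun j => map (fun '(c, B) => (c * Pi k j, fun x => B (F k x))) (s j)) N.

Lemma sev_spull N Pi F s k x :
  sev (spull N Pi F s k) x = markov N Pi F (fun j => sev (s j)) k x.
Proof.
  unfold spull, markov. induction N as [|n IH]; simpl; [reflexivity|].
  rewrite sev_app, IH, sev_map_scal. reflexivity.
Qed.

Lemma sint_catn m f n : sint m (catn f n) = rsum (fun j => sint m (f j)) n.
Proof. induction n as [|n IH]; simpl; [reflexivity|]. rewrite sint_app, IH. reflexivity. Qed.

Definition ssint N (mu : nat -> meas) s : R := rsum (fun k => sint (mu k) (s k)) N.

Lemma in_S_continuity N F F' k : in_S N F F' -> (k < N)%nat -> continuity (F k).
Proof.
  intros H Hk x. apply derivable_continuous_pt. exists (F' k x). apply (H k Hk).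
Qed.

Lemma sborel_spull N Pi F F' s : in_S N F F' -> (forall k, (k < N)%nat -> sborel (s k)) ->
  forall k, (k < N)%nat -> sborel (spull N Pi F s k).
Proof.
  intros HF Hs k Hk c B Hin. apply in_catn in Hin as [j [Hj Hin]].
  apply in_map_iff in Hin as [[c' B'] [E Hin]]. inversion E; subst.
  apply borel_preimage; [eapply in_S_continuity; eauto|]. exact (Hs j Hj _ _ Hin).
Qed.

Section Stationary.

Context (N : nat) (Pi : nat -> nat -> R) (F F' : nat -> R -> R) (mu : nat -> meas).
Context (HN : (1 <= N)%nat) (HF : in_S N F F') (Hmu : stationary N Pi F mu).

Lemma stationary_fmeas k : (k < N)%nat -> is_fmeas_I (mu k).
Proof using Hmu. apply Hmu. Qed.

Lemma stationary_total : rsum (fun k => mu k inI) N = 1.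
Proof using Hmu HN. rewrite <- (sum_f_R0_rsum _ _ HN). apply Hmu. Qed.

Lemma stationary_eq j B : (j < N)%nat -> borel B ->
  mu j B = rsum (fun i => Pi i j * mu i (fun x => B (F i x))) N.
Proof using Hmu HN. intros Hj HB. rewrite <- (sum_f_R0_rsum _ _ HN). apply Hmu; assumption. Qed.

Lemma ssint_spull s : (forall k, (k < N)%nat -> sborel (s k)) ->
  ssint N mu (spull N Pi F s) = ssint N mu s.
Proof using Hmu HN.
  intros Hs. unfold ssint, spull.
  rewrite (rsum_ext _ (fun k => rsum (fun j => sint (mu k)
    (map (fun '(c, B) => (c * Pi k j, fun x => B (F k x))) (s j))) N))
    by (intros; apply sint_catn).
  rewrite rsum_swap. apply rsum_ext. intros j Hj. specialize (Hs j Hj).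
  induction (s j) as [|[c B] l IH]; simpl; [apply rsum_zero|].
  apply sborel_cons in Hs as [HB Hs].
  rewrite rsum_plus, (IH Hs), (stationary_eq j B Hj HB), <- rsum_scal. f_equal.
  apply rsum_ext. intros. lra.
Qed.

Lemma ssint_iter s n : (forall k, (k < N)%nat -> sborel (s k)) ->
  (forall k, (k < N)%nat -> sborel (Nat.iter n (spull N Pi F) s k)) /\
  ssint N mu (Nat.iter n (spull N Pi F) s) = ssint N mu s.
Proof using Hmu HF HN.
  intros Hs. induction n as [|n [IH1 IH2]]; simpl; [auto|]. split.
  - eapply sborel_spull; eauto.
  - rewrite ssint_spull; assumption.
Qed.

End Stationary.

Lemma sev_iter N Pi F s n :
  (fun j => sev (Nat.iter n (spull N Pi F) s j)) =
  Nat.iter n (markov N Pi F) (fun j => sev (s j)).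
Proof.
  induction n as [|n IH]; simpl; [reflexivity|]. rewrite <- IH.
  do 2 (apply functional_extensionality; intro). apply sev_spull.
Qed.

(** * Paths and potentials in finite digraphs *)

Fixpoint epath (E : nat -> nat -> Prop) (w : list nat) : Prop :=
  match w with
  | a :: ((b :: _) as t) => E a b /\ epath E t
  | _ => True
  end.

(** An edge weighs what its source weighs, so the last letter does not count. On a tight word with
    weights [ln (F' i (A i))] this is the logarithm of the derivative of the composition. *)
Fixpoint weight (a : nat -> R) (w : list nat) : R :=
  match w with
  | x :: ((_ :: _) as t) => a x + weight a t
  | _ => 0
  end.

Definition simple_cycle (E : nat -> nat -> Prop) (r : list nat) : Prop :=
  epath E r /\ (2 <= length r)%nat /\ NoDup (removelast r) /\ last r 0%nat = hd 0%nat r.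

Lemma epath_app E l1 x l2 : epath E (l1 ++ x :: l2) <-> epath E (l1 ++ [x]) /\ epath E (x :: l2).
Proof.
  induction l1 as [|a l1 IH]; [simpl; tauto|].
  destruct l1 as [|b l1]; [simpl in *; tauto|].
  change (epath E ((a :: b :: l1) ++ x :: l2)) with (E a b /\ epath E ((b :: l1) ++ x :: l2)).
  change (epath E ((a :: b :: l1) ++ [x])) with (E a b /\ epath E ((b :: l1) ++ [x])). tauto.
Qed.

Lemma weight_app a l1 x l2 : weight a (l1 ++ x :: l2) = weight a (l1 ++ [x]) + weight a (x :: l2).
Proof.
  induction l1 as [|y l1 IH]; [simpl; destruct l2; lra|].
  destruct l1 as [|b l1]; [simpl in *; destruct l2; lra|].
  change (weight a ((y :: b :: l1) ++ x :: l2)) with (a y + weight a ((b :: l1) ++ x :: l2)).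
  change (weight a ((y :: b :: l1) ++ [x])) with (a y + weight a ((b :: l1) ++ [x])). lra.
Qed.

Lemma last_app_cons {X} (l1 : list X) x l2 d : last (l1 ++ x :: l2) d = last (x :: l2) d.
Proof.
  induction l1 as [|y l1 IH]; [reflexivity|]. rewrite <- IH. destruct l1; reflexivity.
Qed.

Lemma epath_snoc E w x : w <> [] -> epath E w -> E (last w 0%nat) x -> epath E (w ++ [x]).
Proof.
  intros Hw. destruct (exists_last Hw) as [l [y ->]]. rewrite last_last, <- app_assoc. simpl.
  intros H1 H2. apply epath_app. simpl. tauto.
Qed.

Lemma weight_snoc a w x : w <> [] -> weight a (w ++ [x]) = weight a w + a (last w 0%nat).
Proof.
  intros Hw. destruct (exists_last Hw) as [l [y ->]]. rewrite last_last, <- app_assoc.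
  change ([y] ++ [x]) with (y :: [x]). rewrite weight_app. simpl. lra.
Qed.

Lemma weight_shift a d w : weight (fun i => a i - d) w = weight a w - d * INR (length w - 1).
Proof.
  induction w as [|x w IH]; [simpl; lra|].
  destruct w as [|y w]; [simpl; lra|].
  change (weight (fun i => a i - d) (x :: y :: w))
    with (a x - d + weight (fun i => a i - d) (y :: w)).
  change (weight a (x :: y :: w)) with (a x + weight a (y :: w)).
  rewrite IH. replace (length (x :: y :: w) - 1)%nat with (S (length (y :: w) - 1)) by (simpl; lia).
  rewrite S_INR. lra.
Qed.

Lemma weight_opp a w : weight (fun i => - a i) w = - weight a w.
Proof.
  induction w as [|x w IH]; [simpl; lra|]. destruct w as [|y w]; [simpl; lra|].
  change (- a x + weight (fun i => - a i) (y :: w) = - (a x + weight a (y :: w))).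
  rewrite IH. lra.
Qed.

Lemma epath_mono (E E' : nat -> nat -> Prop) w :
  (forall i j, E i j -> E' i j) -> epath E w -> epath E' w.
Proof.
  intros H. induction w as [|x w IH]; [easy|]. destruct w as [|y w]; [easy|].
  intros [H1 H2]. split; auto.
Qed.

Lemma epath_below N E w a : (forall i j, E i j -> (i < N)%nat /\ (j < N)%nat) ->
  (2 <= length w)%nat -> epath E w -> In a w -> (a < N)%nat.
Proof.
  intros HE. induction w as [|x w IH]; [easy|]. destruct w as [|y w]; [simpl; lia|].
  intros _ [H1 H2] [<-|Hin]; [apply (HE _ _ H1)|].
  destruct w as [|z w]; [|apply IH; simpl; auto; lia].
  destruct Hin as [<-|[]]. apply (HE _ _ H1).
Qed.

Lemma NoDup_snoc {X} (l : list X) x : NoDup l -> ~ In x l -> NoDup (l ++ [x]).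
Proof.
  intros H Hx. apply NoDup_app; [exact H|constructor; [easy|constructor]|].
  intros y Hy [<-|[]]. contradiction.
Qed.

Lemma close_cycle E l1 j l2 : epath E (l1 ++ j :: l2) -> NoDup (l1 ++ j :: l2) ->
  E (last (l1 ++ j :: l2) 0%nat) j -> simple_cycle E ((j :: l2) ++ [j]).
Proof.
  intros HP HN HE. rewrite last_app_cons in HE.
  split; [|split; [|split]].
  - apply epath_snoc; [easy| |exact HE]. apply (epath_app E l1 j l2), HP.
  - rewrite length_app. simpl. lia.
  - rewrite removelast_last. apply NoDup_app_remove_l in HN. exact HN.
  - rewrite last_last. reflexivity.
Qed.

Lemma simple_cycle_length N E r : (forall i j, E i j -> (i < N)%nat /\ (j < N)%nat) ->
  simple_cycle E r -> (length r <= S N)%nat /\ forall a, In a r -> (a < N)%nat.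
Proof.
  intros HE [H1 [H2 [H3 H4]]].
  assert (Ha : forall a, In a r -> (a < N)%nat).
  { intros a Hin. eapply epath_below; eauto. }
  split; [|exact Ha].
  assert (Hr : r <> []) by (intros ->; simpl in H2; lia).
  pose proof (app_removelast_last 0%nat Hr) as Er.
  rewrite Er, length_app. simpl.
  enough (length (removelast r) <= N)%nat by lia.
  apply NoDup_below_length; [exact H3|]. intros a Hin. apply Ha. rewrite Er. apply in_or_app. auto.
Qed.

(* Shortest-path potentials for the weights lowered by a small d: lengths of cycles stay nonnegative,
   so a path through j can be cut at j. *)
Lemma potential_exists N E (a : nat -> R) :
  (forall i j, E i j -> (i < N)%nat /\ (j < N)%nat) ->
  (forall r, simple_cycle E r -> 0 < weight a r) ->
  exists h : nat -> R, forall i j, E i j -> h j < h i + a i.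
Proof.
  intros HE Hcyc.
  assert (Hd : exists d, 0 < d /\
    forall r, simple_cycle E r -> 0 <= weight (fun i => a i - d) r).
  { destruct (classic (exists r, simple_cycle E r)) as [[r0 Hr0]|Hno].
    - destruct (finite_argmin (words N (S N)) (simple_cycle E) (weight a)) as [r [_ [Hr Hmin]]].
      { exists r0. split; [|exact Hr0].
        destruct (simple_cycle_length N E r0 HE Hr0). apply in_words; assumption. }
      specialize (Hcyc r Hr). pose proof (pos_INR N) as HNpos.
      (* A simple cycle has at most [N] edges, so lowering every weight by this amount costs less
         than the least cycle weight. *)
      exists (weight a r / (INR N + 1)). split; [apply Rdiv_lt_0_compat; lra|].
      intros r' Hr'. rewrite weight_shift.
      destruct (simple_cycle_length N E r' HE Hr') as [Hl Hb].
      assert (Hle : weight a r <= weight a r') by (apply Hmin; [apply in_words|]; assumption).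
      assert (HlR : INR (length r' - 1) <= INR N) by (apply le_INR; lia).
      assert (weight a r / (INR N + 1) * INR (length r' - 1) <= weight a r); [|lra].
      assert (0 < weight a r / (INR N + 1)) by (apply Rdiv_lt_0_compat; lra).
      assert (weight a r / (INR N + 1) * (INR N + 1) = weight a r) by (field; lra). nra.
    - exists 1. split; [lra|]. intros r Hr. exfalso. eauto. }
  destruct Hd as [d [Hd0 Hd]]. clear Hcyc. set (a' := fun i => a i - d) in *.
  (* The potential of [j] is the least lowered weight of a simple path ending at [j] from any start;
     the one-letter path shows that there is one. Lowering by [d > 0] makes the final inequality
     strict. *)
  set (Q := fun j w => epath E w /\ NoDup w /\ w <> [] /\ last w 0%nat = j /\
                       forall b, In b w -> (b < N)%nat).
  assert (HQ : forall j w, Q j w -> In w (words N N)).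
  { intros j w [_ [H [_ [_ Hb]]]]. apply in_words; [apply NoDup_below_length|]; assumption. }
  assert (Hopt : forall j, (j < N)%nat -> exists w, Q j w /\
     forall w', Q j w' -> weight a' w <= weight a' w').
  { intros j Hj. destruct (finite_argmin (words N N) (Q j) (weight a')) as [w [_ [Hw Hmin]]].
    - exists [j]. assert (HQj : Q j [j]).
      { repeat split; simpl; auto; try easy.
        - constructor; [easy|constructor].
        - intros b [<-|[]]. exact Hj. }
      eauto.
    - exists w. split; [exact Hw|]. intros w' Hw'. apply Hmin; eauto. }
  destruct (finite_choice ([] : list nat) N _ Hopt) as [P HP].
  exists (fun j => weight a' (P j)). intros i j Hij.
  destruct (HE i j Hij) as [Hi Hj].
  destruct (HP i Hi) as [[H1 [H2 [H3 [H4 H5]]]] _]. destruct (HP j Hj) as [_ Hmin].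
  assert (Hgoal : weight a' (P j) <= weight a' (P i) + a' i); [|unfold a' in Hgoal at 3; lra].
  replace (a' i) with (a' (last (P i) 0%nat)) by (rewrite H4; reflexivity).
  rewrite <- weight_snoc with (x := j) by exact H3.
  destruct (in_dec Nat.eq_dec j (P i)) as [Hin|Hin].
  - apply in_split in Hin as [l1 [l2 El]]. rewrite El in *.
    assert (Hc : simple_cycle E ((j :: l2) ++ [j])).
    { apply (close_cycle E l1 j l2); [exact H1|exact H2|]. rewrite H4. exact Hij. }
    apply Hd in Hc. rewrite <- app_assoc. simpl app. rewrite weight_app.
    simpl app in Hc.
    assert (weight a' (P j) <= weight a' (l1 ++ [j])); [|lra].
    apply Hmin. split; [|split; [|split; [|split]]].
    + apply (epath_app E l1 j l2), H1.
    + change (j :: l2) with ([j] ++ l2) in H2. rewrite app_assoc in H2.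
      apply NoDup_app_remove_r in H2. exact H2.
    + destruct l1; discriminate.
    + apply last_last.
    + intros b Hb. apply H5. apply in_app_or in Hb. apply in_or_app. simpl in *. tauto.
  - apply Hmin. split; [|split; [|split; [|split]]].
    + apply epath_snoc; [exact H3|exact H1|]. rewrite H4. exact Hij.
    + apply NoDup_snoc; assumption.
    + destruct (P i); discriminate.
    + apply last_last.
    + intros b Hb. apply in_app_or in Hb as [Hb|[<-|[]]]; auto.
Qed.

Inductive conn (E : nat -> nat -> Prop) (i : nat) : nat -> Prop :=
  | conn_refl : conn E i i
  | conn_step j k : conn E i j -> E j k -> conn E i k.

Lemma conn_trans E i j k : conn E i j -> conn E j k -> conn E i k.
Proof. intros H1 H2. induction H2; [exact H1|]. econstructor; eauto. Qed.

Lemma conn_simple_path E i j : conn E i j ->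
  exists w, epath E w /\ NoDup w /\ w <> [] /\ hd 0%nat w = i /\ last w 0%nat = j.
Proof.
  induction 1 as [|j k _ [w [H1 [H2 [H3 [H4 H5]]]]] Hjk].
  - exists [i]. repeat split; try easy. constructor; [easy|constructor].
  - destruct (in_dec Nat.eq_dec k w) as [Hin|Hin].
    + apply in_split in Hin as [l1 [l2 El]]. subst w. exists (l1 ++ [k]).
      split; [apply (epath_app E l1 k l2), H1|]. split; [|split; [|split]].
      * change (k :: l2) with ([k] ++ l2) in H2. rewrite app_assoc in H2.
        apply NoDup_app_remove_r in H2. exact H2.
      * destruct l1; discriminate.
      * destruct l1; exact H4.
      * apply last_last.
    + exists (w ++ [k]). split; [apply epath_snoc; [exact H3|exact H1|rewrite H5; exact Hjk]|].
      split; [apply NoDup_snoc; assumption|]. split; [destruct w; discriminate|].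
      split; [destruct w; [easy|exact H4]|apply last_last].
Qed.

Lemma epath_conn E w : w <> [] -> epath E w -> conn E (hd 0%nat w) (last w 0%nat).
Proof.
  induction w as [|x w IH]; [easy|]. destruct w as [|y w]; intros _ H; [constructor|].
  destruct H as [H1 H2]. apply (conn_trans E _ y).
  - econstructor; [constructor|exact H1].
  - apply IH; [discriminate|exact H2].
Qed.

(** Prepending predecessors to [k] either meets a letter already used, which closes a simple cycle
    whose base point starts the remaining path to [k], or produces simple words of every length,
    which [N] letters do not allow. *)
Lemma trace_back N E : (forall i j, E i j -> (i < N)%nat /\ (j < N)%nat) ->
  (forall j, (j < N)%nat -> exists i, E i j) -> forall k, (k < N)%nat ->
  exists r w, simple_cycle E r /\ epath E w /\ NoDup w /\ w <> [] /\
    hd 0%nat w = hd 0%nat r /\ last w 0%nat = k.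
Proof.
  intros HE Hpred k Hk. apply NNPP. intros Hno.
  assert (Hlong : forall n, exists w, length w = S n /\ epath E w /\ NoDup w /\
    last w 0%nat = k /\ forall a, In a w -> (a < N)%nat).
  { induction n as [|n [w [Hl [Hp [Hd [Hlast Ha]]]]]].
    - exists [k]. repeat split; try easy; [constructor; [easy|constructor]|].
      intros a [<-|[]]. exact Hk.
    - destruct w as [|x w]; [discriminate|].
      destruct (Hpred x) as [y Hyx]; [apply Ha; now left|].
      destruct (in_dec Nat.eq_dec y (x :: w)) as [Hin|Hin].
      + exfalso. apply Hno. apply in_split in Hin as [l1 [l2 El]].
        exists ((y :: l1) ++ [y]), (y :: l2). rewrite El in *.
        split; [split; [|split; [|split]]|].
        * assert (Hp1 : epath E (l1 ++ [y])) by (apply (epath_app E l1 y l2), Hp).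
          destruct l1 as [|z l1].
          -- simpl in El. inversion El; subst. simpl. auto.
          -- simpl in El. inversion El; subst. split; assumption.
        * rewrite length_app. simpl. lia.
        * rewrite removelast_last. apply NoDup_remove in Hd as [Hd1 Hd2].
          constructor; [intros H; apply Hd2, in_or_app; auto|].
          apply NoDup_app_remove_r in Hd1. exact Hd1.
        * rewrite last_last. reflexivity.
        * rewrite last_app_cons in Hlast.
          repeat split; try easy.
          -- apply (epath_app E l1 y l2), Hp.
          -- apply NoDup_app_remove_l in Hd. exact Hd.
      + exists (y :: x :: w). repeat split; try easy.
        * simpl in *. lia.
        * constructor; assumption.
        * intros a [<-|H]; [apply (HE _ _ Hyx)|auto]. }
  destruct (Hlong N) as [w [Hl [_ [Hd [_ Ha]]]]].
  pose proof (NoDup_below_length N w Hd Ha). lia.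
Qed.

(** * The random dynamical system *)

Record system (N : nat) (Pi : nat -> nat -> R) (F F' : nat -> R -> R) : Prop := {
  sys_N : (1 <= N)%nat;
  sys_stoch : stochastic N Pi;
  sys_prim : primitive_mat N Pi;
  sys_S : in_S N F F';
  sys_G1 : G1 N Pi F;
  sys_G2 : G2 N Pi F;
  sys_G3 : G3 N Pi F }.

Definition edge N (Pi : nat -> nat -> R) i j : Prop := (i < N)%nat /\ (j < N)%nat /\ Pi i j > 0.

Lemma adm_epath Pi w : adm Pi w <-> epath (fun i j => Pi i j > 0) w.
Proof.
  induction w as [|a w IH]; [easy|]. destruct w as [|b w]; [easy|].
  change (adm Pi (a :: b :: w)) with (Pi a b > 0 /\ adm Pi (b :: w)). rewrite IH. easy.
Qed.

Lemma word_ok_epath N Pi w : word_ok N Pi w -> epath (edge N Pi) w.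
Proof.
  intros [_ [Ha Hw]]. apply adm_epath in Hw. induction w as [|a w IH]; [easy|].
  destruct w as [|b w]; [easy|]. destruct Hw as [H1 H2]. split.
  - repeat split; [apply Ha; simpl; tauto|apply Ha; simpl; tauto|exact H1].
  - apply IH; [|exact H2]. intros c Hc. apply Ha. now right.
Qed.

Lemma epath_word_ok N Pi w : w <> [] -> (last w 0%nat < N)%nat -> epath (edge N Pi) w ->
  word_ok N Pi w.
Proof.
  intros Hw Hl Hp. split; [exact Hw|]. split.
  - intros a Hin. destruct w as [|x [|y w]]; [easy| |].
    + destruct Hin as [<-|[]]. exact Hl.
    + apply (epath_below N (edge N Pi) (x :: y :: w)); auto; [unfold edge; tauto|simpl; lia].
  - apply adm_epath. revert Hp. apply epath_mono. unfold edge; tauto.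
Qed.

Fixpoint wderiv (F F' : nat -> R -> R) (w : list nat) (x : R) : R :=
  match w with
  | a :: ((_ :: _) as t) => F' a x * wderiv F F' t (F a x)
  | _ => 1
  end.

Lemma wmap_derivable N F F' w x : in_S N F F' -> (forall a, In a w -> (a < N)%nat) ->
  derivable_pt_lim (wmap F w) x (wderiv F F' w x).
Proof.
  intros HF. revert x. induction w as [|a w IH]; intros x Ha; [apply derivable_pt_lim_id|].
  destruct w as [|b w]; [apply derivable_pt_lim_id|].
  change (wderiv F F' (a :: b :: w) x) with (F' a x * wderiv F F' (b :: w) (F a x)).
  rewrite Rmult_comm.
  apply (derivable_pt_lim_comp (F a) (wmap F (b :: w))).
  - apply (HF a). apply Ha. now left.
  - apply IH. intros c Hc. apply Ha. now right.
Qed.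

(** * Linear estimates near a point and masses under rescaling *)

(** The source moves at scale [c] and the target at scale [m], because the two ends of an edge will
    carry different potentials. *)
Lemma evsmall_deriv_gt f x l c m : derivable_pt_lim f x l -> 0 < c -> m < c * l ->
  evsmall (fun s => f x + m * s < f (x + c * s)).
Proof.
  intros H Hc Hm. destruct (H ((c * l - m) / c)) as [d Hd]; [apply Rdiv_lt_0_compat; lra|].
  exists (d / c). split; [apply Rdiv_lt_0_compat; [apply cond_pos|lra]|].
  intros s [Hs1 Hs2]. assert (Hcs : c * s < d).
  { apply (Rmult_lt_compat_l c) in Hs2; [|lra].
    replace (c * (d / c)) with (pos d) in Hs2 by (field; lra). lra. }
  assert (Hpos : 0 < c * s) by nra.
  specialize (Hd (c * s)). rewrite Rabs_pos_eq in Hd by lra.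
  specialize (Hd ltac:(lra) Hcs). apply Rabs_def2 in Hd as [_ Hd].
  apply (Rmult_lt_compat_l (c * s)) in Hd; [|lra].
  replace (c * s * - ((c * l - m) / c)) with (m * s - c * s * l) in Hd by (field; lra).
  replace (c * s * ((f (x + c * s) - f x) / (c * s) - l))
    with (f (x + c * s) - f x - c * s * l) in Hd by (field; nra). lra.
Qed.

Lemma evsmall_deriv_lt f x l c m : derivable_pt_lim f x l -> 0 < c -> c * l < m ->
  evsmall (fun s => f x - m * s < f (x - c * s)).
Proof.
  intros H Hc Hm.
  assert (Hd : derivable_pt_lim (fun y => f (- y)) (- x) (- l)).
  { replace (- l) with (l * -1) by lra.
    apply (derivable_pt_lim_comp (fun y => - y) f).
    - replace (-1) with (- (1)) by lra.
      apply (derivable_pt_lim_opp (fun y => y)). apply derivable_pt_lim_id.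
    - rewrite Ropp_involutive. exact H. }
  generalize (evsmall_deriv_gt _ _ _ c (- m) Hd Hc ltac:(lra)).
  apply evsmall_mono. intros s Hs. rewrite Ropp_involutive in Hs.
  replace (- (- x + c * s)) with (x - c * s) in Hs by lra. lra.
Qed.

Lemma evsmall_linear_lt a b m : a < b -> evsmall (fun s => a + m * s < b).
Proof.
  intros H. destruct (Rle_lt_dec m 0) as [Hm|Hm].
  - exists 1. split; [lra|]. intros. nra.
  - exists ((b - a) / m). split; [apply Rdiv_lt_0_compat; lra|]. intros s [Hs1 Hs2].
    apply (Rmult_lt_compat_l m) in Hs2; [|lra].
    replace (m * ((b - a) / m)) with (b - a) in Hs2 by (field; lra). lra.
Qed.

(** Dividing the argument by [1 + k] does not decrease [g], so its value at [s0 / 2] survives along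
    a geometric sequence tending to 0. With [g s] the mass of neighbourhoods of size [s], the limit
    is an atom. *)
Lemma scaling_lower_bound (g : R -> R) k s0 : 0 < k -> 0 < s0 ->
  (forall s t, s <= t -> g s <= g t) -> (forall s, 0 < s < s0 -> g ((1 + k) * s) <= g s) ->
  forall s, 0 < s -> g (s0 / 2) <= g s.
Proof.
  intros Hk Hs0 Hmono Hsc s Hs.
  assert (Hn : forall n, g (s0 / 2) <= g (s0 / 2 * / (1 + k) ^ n)).
  { induction n as [|n IH]; [simpl; rewrite Rinv_1, Rmult_1_r; lra|].
    assert (Hp : 0 < (1 + k) ^ n) by (apply pow_lt; lra).
    assert (Hi : 0 < / ((1 + k) ^ S n)) by (apply Rinv_0_lt_compat, pow_lt; lra).
    assert (Hi1 : / ((1 + k) ^ S n) <= 1).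
    { rewrite <- Rinv_1. apply Rinv_le_contravar; [lra|]. apply pow_R1_Rle. lra. }
    eapply Rle_trans; [exact IH|].
    replace (s0 / 2 * / (1 + k) ^ n) with ((1 + k) * (s0 / 2 * / (1 + k) ^ S n))
      by (simpl; field; lra).
    apply Hsc.
    pose proof (Rmult_le_compat_l (s0 / 2) _ _ ltac:(lra) Hi1).
    pose proof (Rmult_lt_0_compat (s0 / 2) _ ltac:(lra) Hi). lra. }
  destruct (Pow_x_infinity (1 + k)) with (b := s0 / s) as [n Hpow];
    [rewrite Rabs_pos_eq; lra|].
  specialize (Hpow n (le_n n)).
  assert (Hp : 0 < (1 + k) ^ n) by (apply pow_lt; lra).
  rewrite Rabs_pos_eq in Hpow by lra.
  eapply Rle_trans; [apply (Hn n)|]. apply Hmono.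
  assert (Hs' : s0 <= s * (1 + k) ^ n).
  { apply Rge_le, (Rmult_le_compat_l s) in Hpow; [|lra].
    replace (s * (s0 / s)) with s0 in Hpow by (field; lra). exact Hpow. }
  apply (Rmult_le_reg_r ((1 + k) ^ n)); [exact Hp|].
  rewrite Rmult_assoc, Rinv_l by lra. lra.
Qed.

Section System.

Context (N : nat) (Pi : nat -> nat -> R) (F F' : nat -> R -> R) (HS : system N Pi F F').

Lemma Pi_nonneg i j : (i < N)%nat -> (j < N)%nat -> 0 <= Pi i j.
Proof using HS. apply (sys_stoch _ _ _ _ HS). Qed.

Lemma Pi_row i : (i < N)%nat -> rsum (fun j => Pi i j) N = 1.
Proof using HS.
  intros Hi. rewrite <- (sum_f_R0_rsum _ _ (sys_N _ _ _ _ HS)).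
  apply (sys_stoch _ _ _ _ HS), Hi.
Qed.

Lemma Pi_edge i j : (i < N)%nat -> (j < N)%nat -> Pi i j = 0 \/ edge N Pi i j.
Proof using HS.
  intros Hi Hj. pose proof (Pi_nonneg i j Hi Hj).
  destruct (Req_dec (Pi i j) 0); [auto|right]. repeat split; auto; lra.
Qed.

Lemma irreducible i j : (i < N)%nat -> (j < N)%nat -> conn (edge N Pi) i j.
Proof using HS.
  intros Hi Hj. destruct (sys_prim _ _ _ _ HS) as [m Hm].
  destruct (Hm i j Hi Hj) as [w [Hw [_ [<- <-]]]].
  apply epath_conn; [apply Hw|apply word_ok_epath, Hw].
Qed.

Lemma edge_pred j : (j < N)%nat -> exists i, edge N Pi i j.
Proof using HS.
  intros Hj.
  assert (Hs : exists s, edge N Pi j s).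
  { apply NNPP. intros Hno. pose proof (Pi_row j Hj) as H.
    rewrite (rsum_ext _ (fun _ => 0)), rsum_zero in H; [lra|].
    intros k Hk. destruct (Pi_edge j k Hj Hk); [assumption|]. exfalso; eauto. }
  destruct Hs as [s Hs]. pose proof (irreducible s j (proj1 (proj2 Hs)) Hj) as Hc.
  (* If the path from [s] to [j] is empty, then [s] is [j] and the edge leaving [j] is a loop. *)
  destruct Hc; eauto.
Qed.

Lemma F_range i x : (i < N)%nat -> inI x -> 0 < F i x < 1.
Proof using HS. intros Hi. apply (sys_S _ _ _ _ HS i Hi). Qed.

Lemma F_inI i x : (i < N)%nat -> inI x -> inI (F i x).
Proof using HS. intros Hi Hx. pose proof (F_range i x Hi Hx). unfold inI. lra. Qed.

Lemma F_lt i x y : (i < N)%nat -> inI x -> inI y -> x < y -> F i x < F i y.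
Proof using HS. intros Hi. apply (sys_S _ _ _ _ HS i Hi). Qed.

Lemma F_le i x y : (i < N)%nat -> inI x -> inI y -> x <= y -> F i x <= F i y.
Proof using HS.
  intros Hi Hx Hy [H|<-]; [|lra]. left. apply F_lt; assumption.
Qed.

Lemma F_deriv i x : (i < N)%nat -> derivable_pt_lim (F i) x (F' i x).
Proof using HS. intros Hi. apply (sys_S _ _ _ _ HS i Hi). Qed.

Lemma F_deriv_pos i x : (i < N)%nat -> inI x -> 0 < F' i x.
Proof using HS. intros Hi. apply (sys_S _ _ _ _ HS i Hi). Qed.

Lemma F_cont i : (i < N)%nat -> continuity (F i).
Proof using HS. eapply in_S_continuity, (sys_S _ _ _ _ HS). Qed.

Context (mu : nat -> meas) (Hmu : stationary N Pi F mu).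

Let fm k (Hk : (k < N)%nat) := stationary_fmeas N Pi F mu Hmu k Hk.

Lemma stationary_edge_le i j B : edge N Pi i j -> borel B ->
  Pi i j * mu i (fun x => B (F i x)) <= mu j B.
Proof using HS Hmu.
  intros [Hi [Hj HP]] HB. rewrite (stationary_eq _ _ _ _ (sys_N _ _ _ _ HS) Hmu j B Hj HB).
  apply (rsum_term_le (fun i => Pi i j * mu i (fun x => B (F i x)))); [|exact Hi].
  intros k Hk. apply Rmult_le_pos; [apply Pi_nonneg; assumption|].
  apply meas_nonneg; [auto|]. apply borel_preimage; [apply F_cont|]; assumption.
Qed.

Lemma stationary_mass_pos k : (k < N)%nat -> 0 < mu k inI.
Proof using HS Hmu.
  intros Hk.
  assert (H0 : exists i, (i < N)%nat /\ 0 < mu i inI).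
  { apply NNPP. intros Hno.
    pose proof (stationary_total _ _ _ _ (sys_N _ _ _ _ HS) Hmu) as H.
    assert (rsum (fun k => mu k inI) N <= rsum (fun _ => 0) N); [|rewrite rsum_zero in *; lra].
    apply rsum_le. intros i Hi. apply Rnot_lt_le. intros Hlt. eauto. }
  destruct H0 as [i [Hi H0]]. pose proof (irreducible i k Hi Hk) as Hc.
  clear Hk. induction Hc as [|j k Hc IH He]; [exact H0|].
  pose proof (stationary_edge_le j k inI He borel_inI) as H1.
  rewrite <- (meas_ext (mu j) (fm j (proj1 He)) inI (fun x => inI (F j x))) in H1.
  - destruct He as [_ [_ HP]]. nra.
  - apply borel_inI.
  - intros x Hx. pose proof (F_inI j x (proj1 He) Hx). tauto.
  - apply borel_preimage; [apply F_cont, He|apply borel_inI].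
Qed.

(** * The lower end of the support *)

(** The minimum of the support expressed by masses of half-lines, which increasing maps and
    stationarity transport directly. *)
Definition lower_edge (A : nat -> R) : Prop := forall k, (k < N)%nat ->
  inI (A k) /\ mu k (fun x => x < A k) = 0 /\ forall e, 0 < e -> 0 < mu k (fun x => x < A k + e).

Lemma lower_edge_exists : exists A, lower_edge A.
Proof using HS Hmu.
  apply (finite_choice 0 N (fun k a => inI a /\ mu k (fun x => x < a) = 0 /\
    forall e, 0 < e -> 0 < mu k (fun x => x < a + e))).
  intros k Hk. pose proof (fm k Hk) as Hm. pose proof (stationary_mass_pos k Hk) as Hp.
  set (Z := fun a => mu k (fun x => x < a) = 0).
  assert (H0 : Z 0).
  { apply meas_null; [exact Hm|apply borel_lt|]. unfold inI. intros; lra. }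
  assert (H1 : forall a, 1 < a -> mu k (fun x => x < a) = mu k inI).
  { intros a Ha. symmetry. apply meas_ext; [exact Hm|apply borel_inI| |apply borel_lt].
    unfold inI. intros; lra. }
  assert (Hub : forall a, Z a -> a <= 1).
  { intros a Ha. apply Rnot_lt_le. intros Hlt. unfold Z in Ha. rewrite H1 in Ha by exact Hlt. lra. }
  destruct (completeness Z) as [a [Hua Hla]]; [exists 1; exact Hub|exists 0; exact H0|].
  exists a. split; [split; [apply Hua, H0|apply Hla; exact Hub]|]. split.
  - apply Rle_antisym; [|apply meas_nonneg; [exact Hm|apply borel_lt]].
    apply meas_lt_left; [exact Hm|]. intros b Hb.
    assert (Hex : exists c, Z c /\ b < c).
    { apply NNPP. intros Hno. assert (a <= b); [|lra]. apply Hla. intros c Hc.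
      apply Rnot_lt_le. intros Hlt. eauto. }
    destruct Hex as [c [Hc Hbc]]. unfold Z in Hc. rewrite <- Hc.
    apply meas_mono; [exact Hm|apply borel_lt|apply borel_lt|intros; lra].
  - intros e He. pose proof (meas_nonneg _ Hm _ (borel_lt (a + e))) as H.
    destruct (Req_dec (mu k (fun x => x < a + e)) 0) as [Hz|Hz]; [|lra].
    specialize (Hua _ Hz). lra.
Qed.

Section LowerEdge.

Context (A : nat -> R) (HA : lower_edge A).

Let A_in k (Hk : (k < N)%nat) : inI (A k) := proj1 (HA k Hk).
Let A_null k (Hk : (k < N)%nat) : mu k (fun x => x < A k) = 0 := proj1 (proj2 (HA k Hk)).
Let A_pos k (Hk : (k < N)%nat) e : 0 < e -> 0 < mu k (fun x => x < A k + e) :=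
  proj2 (proj2 (HA k Hk)) e.

Lemma lower_edge_supp k : (k < N)%nat -> is_min (supp (mu k)) (A k).
Proof using HS Hmu HA.
  intros Hk. pose proof (fm k Hk) as Hm. split.
  - intros e He. pose proof (A_pos k Hk e He) as H.
    rewrite (meas_split _ Hm _ (fun x => x <= A k - e) (borel_lt _) (borel_le _)) in H.
    assert (E : mu k (fun x => x < A k + e /\ x <= A k - e) <= mu k (fun x => x < A k)).
    { apply meas_mono; [exact Hm| |apply borel_lt|intros; lra].
      apply borel_and; [apply borel_lt|apply borel_le]. }
    rewrite A_null in E by exact Hk.
    rewrite (pred_ext (fun x => x < A k + e /\ ~ x <= A k - e)
                      (fun y => A k - e < y < A k + e)) in H by (intros; lra). lra.
  - intros y Hy. apply Rnot_lt_le. intros Hlt. specialize (Hy (A k - y) ltac:(lra)).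
    assert (E : mu k (fun z => y - (A k - y) < z < y + (A k - y)) <= mu k (fun x => x < A k)).
    { apply meas_mono; [exact Hm|apply borel_interval|apply borel_lt|intros; lra]. }
    rewrite A_null in E by exact Hk. lra.
Qed.

Lemma lower_edge_le i j : edge N Pi i j -> A j <= F i (A i).
Proof using HS Hmu HA.
  intros He. pose proof He as [Hi [Hj HP]]. apply Rnot_lt_le. intros Hlt.
  destruct (F_cont i Hi (A i) (A j - F i (A i))) as [d [Hd Hc]]; [lra|].
  pose proof (stationary_edge_le i j (fun x => x < A j) He (borel_lt _)) as H1.
  rewrite (A_null j Hj) in H1. pose proof (A_pos i Hi d Hd) as H2.
  assert (mu i (fun x => x < A i + d) <= mu i (fun x => F i x < A j)); [|nra].
  apply meas_mono; [auto|apply borel_lt|apply (borel_preimage (F i) (fun y => y < A j));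
    [apply F_cont; exact Hi|apply borel_lt]|].
  intros x Hx Hlt'. destruct (Rle_lt_dec x (A i)) as [Hle|Hgt].
  - pose proof (F_le i x (A i) Hi Hx (A_in i Hi) Hle). lra.
  - specialize (Hc x). simpl in Hc. unfold Rdist in Hc.
    assert (Hb : Rabs (x - A i) < d) by (apply Rabs_def1; lra).
    assert (Hne : A i <> x) by lra.
    specialize (Hc (conj (conj I Hne) Hb)). apply Rabs_def2 in Hc. lra.
Qed.

Definition tight i j : Prop := edge N Pi i j /\ F i (A i) = A j.

Lemma tight_edge i j : tight i j -> edge N Pi i j.
Proof using. intros H; apply H. Qed.

Lemma tight_below i j : tight i j -> (i < N)%nat /\ (j < N)%nat.
Proof using. unfold tight, edge. tauto. Qed.

Lemma not_tight_lt i j : edge N Pi i j -> ~ tight i j -> A j < F i (A i).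
Proof using HS Hmu HA.
  intros He Ht. pose proof (lower_edge_le i j He) as [H|H]; [exact H|].
  exfalso. apply Ht. split; auto.
Qed.

Lemma stationary_below_null i c : (i < N)%nat -> c <= F i (A i) ->
  mu i (fun x => F i x < c) = 0.
Proof using HS Hmu HA.
  intros Hi Hc.
  assert (Hb : borel (fun x => F i x < c)).
  { apply (borel_preimage (F i) (fun y => y < c)); [apply F_cont, Hi|apply borel_lt]. }
  apply Rle_antisym; [|apply meas_nonneg; auto].
  rewrite <- (A_null i Hi). apply meas_mono; [auto|exact Hb|apply borel_lt|].
  intros x Hx Hlt. apply Rnot_le_lt. intros Hle.
  pose proof (F_le i (A i) x Hi (A_in i Hi) Hx Hle). lra.
Qed.

(** If every incoming edge landed strictly above [A j], a short interval starting at [A j] would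
    receive no mass. *)
Lemma tight_pred j : (j < N)%nat -> exists i, tight i j.
Proof using HS Hmu HA.
  intros Hj. apply NNPP. intros Hno.
  assert (Hev : evsmall (fun e => forall i, (i < N)%nat -> edge N Pi i j -> A j + 1 * e < F i (A i))).
  { apply evsmall_fin. intros i Hi. apply evsmall_imp. intros He. apply evsmall_linear_lt.
    apply not_tight_lt; [exact He|]. eauto. }
  destruct (evsmall_ex _ Hev) as [e [He H]]. pose proof (A_pos j Hj e He) as Hp.
  rewrite (stationary_eq _ _ _ _ (sys_N _ _ _ _ HS) Hmu j _ Hj (borel_lt _)) in Hp.
  rewrite (rsum_ext _ (fun _ => 0)), rsum_zero in Hp; [lra|].
  intros i Hi. destruct (Pi_edge i j Hi Hj) as [->|Hij]; [lra|].
  rewrite stationary_below_null; [lra|exact Hi|]. specialize (H i Hi Hij). lra.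
Qed.

Lemma lower_edge_inside k : (k < N)%nat -> 0 < A k < 1.
Proof using HS Hmu HA.
  intros Hk. destruct (tight_pred k Hk) as [i [[Hi _] <-]]. apply F_range; auto.
Qed.

(* Mass of the atoms can only be lost along non-tight edges; by stationarity none is lost, so an atom
   would make all edges tight. *)
Lemma lower_edge_no_atom k : (k < N)%nat -> mu k (fun x => x <= A k) = 0.
Proof using HS Hmu HA.
  set (a := fun k => mu k (fun x => x <= A k)).
  assert (Ha : forall k, (k < N)%nat -> 0 <= a k).
  { intros j Hj. apply meas_nonneg; [auto|apply borel_le]. }
  assert (Hb : forall i j, (i < N)%nat -> borel (fun x => F i x <= A j)).
  { intros i j Hi. apply (borel_preimage (F i) (fun y => y <= A j)); [apply F_cont, Hi|apply borel_le]. }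
  assert (Hle : forall j, (j < N)%nat ->
    a j <= rsum (fun i => Pi i j * indic (tight i j) * a i) N).
  { intros j Hj. unfold a at 1.
    rewrite (stationary_eq _ _ _ _ (sys_N _ _ _ _ HS) Hmu j _ Hj (borel_le _)).
    apply rsum_le. intros i Hi. destruct (Pi_edge i j Hi Hj) as [->|Hij]; [lra|].
    rewrite Rmult_assoc. apply Rmult_le_compat_l; [apply Pi_nonneg; assumption|].
    destruct (classic (tight i j)) as [Ht|Ht].
    - rewrite indic_true by exact Ht. rewrite Rmult_1_l.
      apply meas_mono; [auto|apply Hb, Hi|apply borel_le|].
      intros x Hx Hxle. apply Rnot_lt_le. intros Hlt.
      pose proof (F_lt i (A i) x Hi (A_in i Hi) Hx Hlt). destruct Ht as [_ Ht]. lra.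
    - rewrite indic_false by exact Ht. rewrite Rmult_0_l.
      pose proof (not_tight_lt i j Hij Ht) as Hlt.
      rewrite <- (stationary_below_null i (F i (A i)) Hi (Rle_refl _)).
      apply meas_mono; [auto|apply Hb, Hi| |intros; lra].
      apply (borel_preimage (F i) (fun y => y < F i (A i))); [apply F_cont, Hi|apply borel_lt]. }
  assert (Hterm : forall i j, (i < N)%nat -> (j < N)%nat -> Pi i j * indic (tight i j) <= Pi i j).
  { intros i j Hi Hj. pose proof (Pi_nonneg i j Hi Hj).
    pose proof (indic_mono (tight i j) True (fun _ => I)). rewrite (indic_true True I) in H0. nra. }
  assert (Hrow : forall i, (i < N)%nat -> 0 < a i -> forall j, edge N Pi i j -> tight i j).
  { intros i Hi Hpos j Hij. apply NNPP. intros Ht.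
    assert (E1 : rsum a N <= rsum (fun j => rsum (fun i => Pi i j * indic (tight i j) * a i) N) N)
      by (apply rsum_le; auto).
    rewrite rsum_swap in E1.
    assert (E2 : rsum (fun i => rsum (fun j => Pi i j * indic (tight i j) * a i) N) N < rsum a N);
      [|lra].
    assert (E3 : forall i, rsum (fun j => Pi i j * indic (tight i j) * a i) N =
                           a i * rsum (fun j => Pi i j * indic (tight i j)) N).
    { intros i'. rewrite <- rsum_scal. apply rsum_ext. intros; lra. }
    apply (rsum_lt _ _ N i); [|exact Hi|].
    - intros i' Hi'. rewrite E3.
      assert (rsum (fun j => Pi i' j * indic (tight i' j)) N <= 1); [|pose proof (Ha i' Hi'); nra].
      rewrite <- (Pi_row i' Hi'). apply rsum_le. auto.
    - rewrite E3. assert (rsum (fun j => Pi i j * indic (tight i j)) N < 1); [|nra].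
      rewrite <- (Pi_row i Hi). apply (rsum_lt _ _ N j); [auto|apply Hij|].
      rewrite indic_false by exact Ht. destruct Hij as [_ [_ HP]]. lra. }
  intros Hk. apply Rle_antisym; [|apply Ha, Hk]. apply Rnot_lt_le. intros Hpos.
  assert (Hall : forall j, (j < N)%nat -> 0 < a j).
  { intros j Hj. pose proof (irreducible k j Hk Hj) as Hc. clear Hj.
    induction Hc as [|i j Hc IH Hij]; [exact Hpos|].
    pose proof (Hrow i (proj1 Hij) IH j Hij) as [_ Ht].
    pose proof (stationary_edge_le i j (fun x => x <= A j) Hij (borel_le _)) as H1.
    assert (a i <= mu i (fun x => F i x <= A j)).
    { apply meas_mono; [apply fm, Hij|apply borel_le|apply Hb, Hij|].
      intros x Hx Hxle. rewrite <- Ht. apply F_le; auto; [apply Hij|apply A_in, Hij]. }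
    change (mu j (fun x => x <= A j)) with (a j) in H1. destruct Hij as [_ [_ HP]]. nra. }
  apply (sys_G3 _ _ _ _ HS). exists A. split; [exact A_in|].
  intros i j Hi Hj HP. apply (Hrow i Hi (Hall i Hi) j). repeat split; assumption.
Qed.

Let lnA i := ln (F' i (A i)).

Lemma tight_wmap w : w <> [] -> epath tight w -> wmap F w (A (hd 0%nat w)) = A (last w 0%nat).
Proof using.
  induction w as [|x w IH]; [easy|]. intros _ H. destruct w as [|y w]; [reflexivity|].
  destruct H as [[_ H1] H2].
  change (wmap F (y :: w) (F x (A x)) = A (last (y :: w) 0%nat)). rewrite H1. apply IH; easy.
Qed.

Lemma tight_wderiv w : w <> [] -> epath tight w ->
  wderiv F F' w (A (hd 0%nat w)) = exp (weight lnA w).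
Proof using HS HA.
  induction w as [|x w IH]; [easy|]. intros _ H.
  destruct w as [|y w]; [simpl; rewrite exp_0; reflexivity|].
  destruct H as [[He H1] H2].
  change (F' x (A x) * wderiv F F' (y :: w) (F x (A x)) = exp (lnA x + weight lnA (y :: w))).
  rewrite H1, exp_plus. unfold lnA at 1.
  rewrite exp_ln by (apply F_deriv_pos; [apply He|apply A_in, He]).
  f_equal. apply IH; easy.
Qed.

(** (G1) enters here: a cycle of weight 0 would have derivative 1 at its fixed point. *)
Lemma tight_cycle_return r : simple_cycle tight r ->
  simple_return N Pi r /\ fixed_pt F r (A (hd 0%nat r)) /\ (hd 0%nat r < N)%nat /\
  derivable_pt_lim (wmap F r) (A (hd 0%nat r)) (exp (weight lnA r)) /\ weight lnA r <> 0.
Proof using HS HA.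
  intros [H1 [H2 [H3 H4]]].
  assert (Hr : r <> []) by (intros ->; simpl in H2; lia).
  assert (Hh : (hd 0%nat r < N)%nat).
  { destruct r as [|x [|y r]]; simpl in H2; try lia. destruct H1 as [H1 _]. apply H1. }
  assert (Hok : word_ok N Pi r).
  { apply epath_word_ok; [exact Hr|rewrite H4; exact Hh|].
    revert H1. apply epath_mono. apply tight_edge. }
  assert (Hret : simple_return N Pi r) by (repeat split; try easy; apply Hok).
  assert (Hfix : fixed_pt F r (A (hd 0%nat r))).
  { split; [apply A_in, Hh|]. rewrite tight_wmap by assumption. rewrite H4. reflexivity. }
  assert (Hd : derivable_pt_lim (wmap F r) (A (hd 0%nat r)) (exp (weight lnA r))).
  { rewrite <- tight_wderiv by assumption. eapply wmap_derivable; [apply (sys_S _ _ _ _ HS)|].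
    apply Hok. }
  repeat (split; [assumption|]).
  intros E. rewrite E, exp_0 in Hd. exact (sys_G1 _ _ _ _ HS _ _ Hret Hfix Hd).
Qed.

Lemma tight_cycle_attracting r : simple_cycle tight r -> weight lnA r < 0 ->
  attracting N Pi F r (A (hd 0%nat r)).
Proof using HS HA.
  intros Hr Hw. destruct (tight_cycle_return r Hr) as [H1 [H2 [_ [H3 _]]]].
  split; [exact H1|]. split; [exact H2|]. exists (exp (weight lnA r)). split; [exact H3|].
  pose proof (exp_pos (weight lnA r)). rewrite Rabs_pos_eq by lra.
  rewrite <- exp_0. apply exp_increasing, Hw.
Qed.

Lemma tight_cycle_repelling r : simple_cycle tight r -> 0 < weight lnA r ->
  repelling N Pi F r (A (hd 0%nat r)).
Proof using HS HA.
  intros Hr Hw. destruct (tight_cycle_return r Hr) as [H1 [H2 [_ [H3 _]]]].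
  split; [exact H1|]. split; [exact H2|]. exists (exp (weight lnA r)). split; [exact H3|].
  pose proof (exp_pos (weight lnA r)). rewrite Rabs_pos_eq by lra.
  rewrite <- exp_0. apply exp_increasing, Hw.
Qed.

Lemma tight_path_transition w : w <> [] -> NoDup w -> (last w 0%nat < N)%nat -> epath tight w ->
  simple_transition N Pi w.
Proof using.
  intros Hw Hd Hl Hp. split; [|exact Hd]. apply epath_word_ok; [exact Hw|exact Hl|].
  revert Hp. apply epath_mono, tight_edge.
Qed.

(* All tight cycles upstream of a repelling tight cycle are repelling by (G2); rescaling by potentials,
   every tight edge there expands, so the stationary mass near the ends cannot decay and an atom appears. *)
Lemma tight_cycle_weight_neg r : simple_cycle tight r -> weight lnA r < 0.
Proof using HS Hmu HA.
  intros Hr. destruct (tight_cycle_return r Hr) as [_ [_ [Hc [_ Hne]]]].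
  apply Rnot_le_lt. intros Hle. assert (Hpos : 0 < weight lnA r) by lra. clear Hne Hle.
  pose proof (tight_cycle_repelling r Hr Hpos) as Hrep.
  (* [V] is closed under tight predecessors, so all mass arriving close to the lower ends in [V]
     comes from close to lower ends in [V]. *)
  set (c := hd 0%nat r) in *. set (V := fun j => conn tight j c).
  set (E := fun i j => tight i j /\ V j).
  assert (HEV : forall i j, E i j -> V i).
  { intros i j [H1 H2]. apply (conn_trans tight i j c); [|exact H2].
    econstructor; [constructor|exact H1]. }
  assert (HEb : forall i j, E i j -> (i < N)%nat /\ (j < N)%nat)
    by (intros i j [H _]; apply tight_below, H).
  destruct (potential_exists N E lnA HEb) as [h Hh].
  { intros r' Hr'.
    assert (Hr't : simple_cycle tight r').
    { destruct Hr' as [H1 H2]. split; [|exact H2]. revert H1. apply epath_mono. intros i j H; apply H. }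
    destruct (tight_cycle_return r' Hr't) as [_ [_ [Hd [_ Hne]]]].
    apply Rnot_le_lt. intros Hle.
    pose proof (tight_cycle_attracting r' Hr't ltac:(lra)) as Hatt.
    assert (HV : V (hd 0%nat r')).
    { destruct Hr' as [H1 [H2 _]]. destruct r' as [|x [|y r']]; simpl in H2; try lia.
      destruct H1 as [H1 _]. apply (HEV _ _ H1). }
    destruct (conn_simple_path _ _ _ HV) as [w [H1 [H2 [H3 [H4 H5]]]]].
    refine (proj1 (sys_G2 _ _ _ _ HS r' r w _ _ _ H4 H5 _) (conj Hatt Hrep)).
    - apply tight_path_transition; try assumption. rewrite H5. exact Hc.
    - rewrite <- H4, tight_wmap by assumption. rewrite H5. reflexivity. }
  (* The neighbourhood of [A k] is measured in units of [q k]; in these units every edge of [E]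
     expands, by a common factor above [1 + k] since there are finitely many edges. *)
  set (q := fun k => exp (h k)).
  assert (Hq : forall k, 0 < q k) by (intros; apply exp_pos).
  assert (Hexp : forall i j, E i j -> q j < q i * F' i (A i)).
  { intros i j Hij. specialize (Hh i j Hij). destruct (HEb i j Hij) as [Hi _].
    assert (Hd : 0 < F' i (A i)) by (apply F_deriv_pos; auto).
    rewrite <- (exp_ln _ Hd). unfold q. rewrite <- exp_plus. apply exp_increasing, Hh. }
  assert (Hk : evsmall (fun k => forall i, (i < N)%nat -> forall j, (j < N)%nat -> E i j ->
     q j + q j * k < q i * F' i (A i))).
  { apply evsmall_fin. intros i Hi. apply evsmall_fin. intros j Hj. apply evsmall_imp.
    intros Hij. apply evsmall_linear_lt, Hexp, Hij. }
  destruct (evsmall_ex _ Hk) as [k [Hk0 HkE]]. clear Hk Hexp.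
  assert (Hs : evsmall (fun s => forall i, (i < N)%nat -> forall j, (j < N)%nat ->
     (E i j -> F i (A i) + (q j * (1 + k)) * s < F i (A i + q i * s)) /\
     (edge N Pi i j /\ ~ tight i j -> A j + (q j * (1 + k)) * s < F i (A i)))).
  { apply evsmall_fin. intros i Hi. apply evsmall_fin. intros j Hj. apply evsmall_and.
    - apply evsmall_imp. intros Hij. apply (evsmall_deriv_gt _ _ (F' i (A i))).
      + apply F_deriv, Hi.
      + apply Hq.
      + specialize (HkE i Hi j Hj Hij). lra.
    - apply evsmall_imp. intros [H1 H2]. apply evsmall_linear_lt, not_tight_lt; assumption. }
  destruct Hs as [s0 [Hs0 Hs]].
  set (Phi := fun s => rsum (fun k => indic (V k) * mu k (fun x => x < A k + q k * s)) N).
  assert (Hind : forall P, 0 <= indic P <= 1).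
  { intros P. unfold indic. destruct excluded_middle_informative; lra. }
  assert (Hmono : forall s t, s <= t -> Phi s <= Phi t).
  { intros s t Hst. apply rsum_le. intros i Hi. apply Rmult_le_compat_l; [apply Hind|].
    apply meas_mono; [auto|apply borel_lt|apply borel_lt|]. intros x _ Hx.
    pose proof (Hq i). nra. }
  (* Points within [(1 + k) * s] of [A j] come along tight edges from points within [s], by
     expansion, and along other edges from nowhere. Summing over [j], each source is counted with
     weight at most its row sum 1. *)
  assert (Hsc : forall s, 0 < s < s0 -> Phi ((1 + k) * s) <= Phi s).
  { intros s Hss. specialize (Hs s Hss). unfold Phi.
    assert (E1 : forall j, (j < N)%nat ->
      indic (V j) * mu j (fun x => x < A j + q j * ((1 + k) * s)) <=
      rsum (fun i => Pi i j * (indic (V i) * mu i (fun x => x < A i + q i * s))) N).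
    { intros j Hj.
      assert (Hnn : forall i, (i < N)%nat ->
        0 <= Pi i j * (indic (V i) * mu i (fun x => x < A i + q i * s))).
      { intros i Hi. apply Rmult_le_pos; [apply Pi_nonneg; assumption|].
        apply Rmult_le_pos; [apply Hind|apply meas_nonneg; [auto|apply borel_lt]]. }
      destruct (classic (V j)) as [HV|HV].
      2: { rewrite indic_false by exact HV. rewrite Rmult_0_l. apply rsum_nonneg, Hnn. }
      rewrite indic_true, Rmult_1_l by exact HV.
      rewrite (stationary_eq _ _ _ _ (sys_N _ _ _ _ HS) Hmu j _ Hj (borel_lt _)).
      apply rsum_le. intros i Hi. destruct (Pi_edge i j Hi Hj) as [->|Hij]; [lra|].
      destruct (classic (tight i j)) as [Ht|Ht].
      - assert (HE : E i j) by (split; assumption). apply Rmult_le_compat_l.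
        + apply Pi_nonneg; assumption.
        + rewrite indic_true, Rmult_1_l by (apply (HEV i j HE)).
          apply meas_mono; [auto| |apply borel_lt|].
          * apply (borel_preimage (F i) (fun y => y < A j + q j * ((1 + k) * s)));
              [apply F_cont, Hi|apply borel_lt].
          * intros x Hx Hlt. apply Rnot_le_lt. intros Hle.
            destruct (Hs i Hi j Hj) as [H1 _]. specialize (H1 HE).
            assert (Hin : inI (A i + q i * s)).
            { pose proof (A_in i Hi). pose proof (Hq i). unfold inI in *. nra. }
            pose proof (F_le i _ x Hi Hin Hx Hle). destruct Ht as [_ Ht]. lra.
      - rewrite stationary_below_null; [rewrite Rmult_0_r; apply Hnn, Hi|exact Hi|].
        destruct (Hs i Hi j Hj) as [_ H2]. specialize (H2 (conj Hij Ht)). lra. }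
    eapply Rle_trans; [apply rsum_le, E1|]. rewrite rsum_swap. apply rsum_le.
    intros i Hi.
    rewrite (rsum_ext _ (fun j => (indic (V i) * mu i (fun x => x < A i + q i * s)) * Pi i j))
      by (intros; lra).
    rewrite rsum_scal, Pi_row by exact Hi. lra. }
  pose proof (scaling_lower_bound Phi k s0 Hk0 Hs0 Hmono Hsc) as Hlow.
  set (v := Phi (s0 / 2)) in *.
  assert (Hv : 0 < v).
  { apply Rlt_le_trans with (indic (V c) * mu c (fun x => x < A c + q c * (s0 / 2))).
    - rewrite indic_true, Rmult_1_l by constructor. apply A_pos; [exact Hc|].
      pose proof (Hq c). nra.
    - apply (rsum_term_le (fun k => indic (V k) * mu k (fun x => x < A k + q k * (s0 / 2)))); [|exact Hc].
      intros i Hi. apply Rmult_le_pos; [apply Hind|apply meas_nonneg; [auto|apply borel_lt]]. }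
  pose proof (pos_INR N) as HNp.
  (* Without atoms each neighbourhood eventually has mass at most [v / (N + 1)], and [N] of these
     stay below [v]. *)
  assert (Hev : evsmall (fun s => forall i, (i < N)%nat ->
    mu i (fun x => x < A i + q i * s) <= v / (INR N + 1))).
  { apply evsmall_fin. intros i Hi.
    assert (Hb : exists b, A i < b /\ mu i (fun x => x < b) < v / (INR N + 1)).
    { apply NNPP. intros Hno.
      assert (v / (INR N + 1) <= mu i (fun x => x <= A i)).
      { apply meas_le_right; [auto|]. intros b Hb. apply Rnot_lt_le. intros Hlt. eauto. }
      rewrite lower_edge_no_atom in H by exact Hi.
      assert (0 < v / (INR N + 1)) by (apply Rdiv_lt_0_compat; lra). lra. }
    destruct Hb as [b [Hb1 Hb2]]. generalize (evsmall_linear_lt (A i) b (q i) Hb1).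
    apply evsmall_mono. intros s Hsb. apply Rle_trans with (mu i (fun x => x < b)); [|lra].
    apply meas_mono; [auto|apply borel_lt|apply borel_lt|intros; lra]. }
  destruct (evsmall_ex _ Hev) as [s [Hs1 Hs2]]. specialize (Hlow s Hs1).
  assert (Phi s <= rsum (fun _ => v / (INR N + 1)) N).
  { apply rsum_le. intros i Hi. specialize (Hs2 i Hi). pose proof (Hind (V i)).
    pose proof (meas_nonneg _ (fm i Hi) _ (borel_lt (A i + q i * s))). nra. }
  rewrite rsum_const in H.
  assert (INR N * (v / (INR N + 1)) = v - v / (INR N + 1)) by (field; lra).
  assert (0 < v / (INR N + 1)) by (apply Rdiv_lt_0_compat; lra). lra.
Qed.

Lemma lower_edge_attracting k : (k < N)%nat -> exists r a w, attracting N Pi F r a /\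
  simple_transition N Pi w /\ hd 0%nat w = hd 0%nat r /\ last w 0%nat = k /\ wmap F w a = A k.
Proof using HS Hmu HA.
  intros Hk.
  destruct (trace_back N tight tight_below tight_pred k Hk) as [r [w [H1 [H2 [H3 [H4 [H5 H6]]]]]]].
  exists r, (A (hd 0%nat r)), w. split.
  - apply tight_cycle_attracting, tight_cycle_weight_neg; exact H1.
  - split; [apply tight_path_transition; try assumption; rewrite H6; exact Hk|].
    repeat split; try assumption. rewrite <- H5, tight_wmap, H6 by assumption. reflexivity.
Qed.

(** All tight cycles have negative weight, so the opposite weights admit potentials, and in the
    resulting scales every tight edge contracts. The parameter [t] is left free so that several
    domains can be shrunk together. *)
Lemma lower_edge_trapping : exists q : nat -> R, (forall k, 0 < q k) /\
  evsmall (fun t => (forall k, (k < N)%nat -> 0 < A k - q k * t) /\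
    forall i j, edge N Pi i j -> A j - q j * t < F i (A i - q i * t)).
Proof using HS Hmu HA.
  destruct (potential_exists N tight (fun i => - lnA i) tight_below) as [h Hh].
  { intros r Hr. rewrite weight_opp. pose proof (tight_cycle_weight_neg r Hr). lra. }
  exists (fun k => exp (- h k)). split; [intros; apply exp_pos|]. apply evsmall_and.
  - apply (evsmall_fin N (fun k t => 0 < A k - exp (- h k) * t)). intros k Hk.
    generalize (evsmall_linear_lt 0 (A k) (exp (- h k)) (proj1 (lower_edge_inside k Hk))).
    apply evsmall_mono. intros; lra.
  - assert (H : evsmall (fun t => forall i, (i < N)%nat -> forall j, (j < N)%nat -> edge N Pi i j ->
      A j - exp (- h j) * t < F i (A i - exp (- h i) * t))).
    { apply evsmall_fin. intros i Hi. apply evsmall_fin. intros j Hj. apply evsmall_imp.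
      intros Hij. pose proof (exp_pos (- h i)) as Hpi. destruct (classic (tight i j)) as [Ht|Ht].
      - rewrite <- (proj2 Ht).
        apply (evsmall_deriv_lt _ _ (F' i (A i))); [apply F_deriv, Hi|exact Hpi|].
        assert (Hd : 0 < F' i (A i)) by (apply F_deriv_pos; auto).
        rewrite <- (exp_ln _ Hd), <- exp_plus. apply exp_increasing.
        specialize (Hh i j Ht). unfold lnA in Hh. lra.
      (* The slope is just some number above [exp (- h i) * F' i (A i)]: on a non-tight edge the gap
         between [A j] and [F i (A i)] absorbs any linear term. *)
      - generalize (evsmall_and _ _
          (evsmall_deriv_lt (F i) (A i) _ _ (exp (- h i) * F' i (A i) + 1) (F_deriv i (A i) Hi) Hpi
             ltac:(lra))
          (evsmall_linear_lt (A j) (F i (A i)) (exp (- h i) * F' i (A i) + 1 - exp (- h j))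
             (not_tight_lt i j Hij Ht))).
        apply evsmall_mono. intros t [H1 H2]. lra. }
    revert H. apply evsmall_mono. intros t H i j Hij. apply H; [apply Hij|apply Hij|exact Hij].
Qed.

End LowerEdge.

End System.

(** * Reflection of the interval *)

Definition reflect_map (F : nat -> R -> R) : nat -> R -> R := fun k x => 1 - F k (1 - x).
Definition reflect_deriv (F' : nat -> R -> R) : nat -> R -> R := fun k x => F' k (1 - x).
Definition reflect_meas (mu : nat -> meas) : nat -> meas := fun k B => mu k (fun x => B (1 - x)).

Lemma reflect_reflect F : reflect_map (reflect_map F) = F.
Proof.
  do 2 (apply functional_extensionality; intro). unfold reflect_map.
  replace (1 - (1 - x0)) with x0 by lra. lra.
Qed.

Lemma inI_reflect x : inI x -> inI (1 - x).
Proof. unfold inI. lra. Qed.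

Lemma derivable_reflect f x l :
  derivable_pt_lim f (1 - x) l -> derivable_pt_lim (fun y => 1 - f (1 - y)) x l.
Proof.
  intros H.
  assert (H1 : derivable_pt_lim (fun y => 1 - y) x (-1)).
  { replace (-1) with (0 - 1) by lra.
    apply (derivable_pt_lim_minus (fun _ => 1) (fun y => y));
      [apply derivable_pt_lim_const|apply derivable_pt_lim_id]. }
  replace l with (0 - l * -1) by lra.
  apply (derivable_pt_lim_minus (fun _ => 1) (fun y => f (1 - y))); [apply derivable_pt_lim_const|].
  apply (derivable_pt_lim_comp (fun y => 1 - y) f); assumption.
Qed.

Lemma wmap_reflect F w x : wmap (reflect_map F) w x = 1 - wmap F w (1 - x).
Proof.
  revert x. induction w as [|a w IH]; intros x; [simpl; lra|].
  destruct w as [|b w]; [simpl; lra|].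
  change (wmap (reflect_map F) (b :: w) (reflect_map F a x) = 1 - wmap F (b :: w) (F a (1 - x))).
  rewrite IH. unfold reflect_map. do 2 f_equal. lra.
Qed.

Lemma wmap_derivable_reflect F w x l : derivable_pt_lim (wmap F w) (1 - x) l ->
  derivable_pt_lim (wmap (reflect_map F) w) x l.
Proof.
  intros H. apply derivable_reflect in H.
  replace (wmap (reflect_map F) w) with (fun y => 1 - wmap F w (1 - y)); [exact H|].
  apply functional_extensionality. intros y. symmetry. apply wmap_reflect.
Qed.

Lemma wmap_derivable_unreflect F w x l : derivable_pt_lim (wmap (reflect_map F) w) x l ->
  derivable_pt_lim (wmap F w) (1 - x) l.
Proof.
  intros H. rewrite <- (reflect_reflect F). apply wmap_derivable_reflect.
  replace (1 - (1 - x)) with x by lra. exact H.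
Qed.

Lemma fixed_pt_unreflect F r q : fixed_pt (reflect_map F) r q -> fixed_pt F r (1 - q).
Proof.
  intros [H1 H2]. split; [apply inI_reflect, H1|]. rewrite wmap_reflect in H2. lra.
Qed.

Lemma attracting_unreflect N Pi F r q :
  attracting N Pi (reflect_map F) r q -> attracting N Pi F r (1 - q).
Proof.
  intros [H1 [H2 [d [H3 H4]]]]. split; [exact H1|]. split; [apply fixed_pt_unreflect, H2|].
  exists d. split; [apply wmap_derivable_unreflect, H3|exact H4].
Qed.

Lemma repelling_unreflect N Pi F r q :
  repelling N Pi (reflect_map F) r q -> repelling N Pi F r (1 - q).
Proof.
  intros [H1 [H2 [d [H3 H4]]]]. split; [exact H1|]. split; [apply fixed_pt_unreflect, H2|].
  exists d. split; [apply wmap_derivable_unreflect, H3|exact H4].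
Qed.

Lemma system_reflect N Pi F F' : system N Pi F F' ->
  system N Pi (reflect_map F) (reflect_deriv F').
Proof.
  intros [H1 H2 H3 H4 H5 H6 H7]. constructor; try assumption.
  - intros k Hk. destruct (H4 k Hk) as [D1 [D2 [D3 [D4 D5]]]]. unfold reflect_map, reflect_deriv.
    split; [|split; [|split; [|split]]].
    + intros x. apply derivable_reflect, D1.
    + apply (continuity_comp (fun x => 1 - x)); [|exact D2].
      apply derivable_continuous. reg.
    + intros x Hx. apply D3, inI_reflect, Hx.
    + intros x y Hx Hy Hxy.
      pose proof (D4 (1 - y) (1 - x) (inI_reflect y Hy) (inI_reflect x Hx) ltac:(lra)). lra.
    + intros x Hx. specialize (D5 (1 - x) (inI_reflect x Hx)). lra.
  - intros r q Hr Hq Hd.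
    exact (H5 r (1 - q) Hr (fixed_pt_unreflect _ _ _ Hq) (wmap_derivable_unreflect _ _ _ _ Hd)).
  - intros r1 r2 w q1 q2 Hw Hh Hl E. rewrite wmap_reflect in E.
    destruct (H6 r1 r2 w (1 - q1) (1 - q2) Hw Hh Hl) as [E1 E2]; [lra|].
    split; intros [Ha Hb]; [apply E1|apply E2];
      split; (apply attracting_unreflect || apply repelling_unreflect); assumption.
  - intros [a [Ha1 Ha2]]. apply H7. exists (fun i => 1 - a i). split.
    + intros i Hi. apply inI_reflect, Ha1, Hi.
    + intros i j Hi Hj HP. rewrite <- (Ha2 i j Hi Hj HP). unfold reflect_map. lra.
Qed.

Lemma borel_reflect B : borel B -> borel (fun x => B (1 - x)).
Proof. apply borel_preimage. apply derivable_continuous. reg. Qed.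

Lemma fmeas_reflect m : is_fmeas_I m -> is_fmeas_I (fun B => m (fun x => B (1 - x))).
Proof.
  intros [H1 [H2 [H3 H4]]]. split; [|split; [|split]].
  - intros B C HB H. apply H1; [apply borel_reflect, HB|intros; apply H].
  - intros B HB. apply H2, borel_reflect, HB.
  - intros B HB. rewrite H3 by (apply borel_reflect, HB). apply H1.
    + apply borel_and; [apply borel_reflect, HB|apply borel_inI].
    + intros x. unfold inI. intuition lra.
  - intros Bn HB Hd. apply (H4 (fun n x => Bn n (1 - x))).
    + intros n. apply borel_reflect, HB.
    + intros n p x. apply Hd.
Qed.

Lemma reflect_inI (m : meas) : m (fun x => inI (1 - x)) = m inI.
Proof. f_equal. apply pred_ext. intros x. unfold inI. lra. Qed.

Lemma stationary_reflect N Pi F mu : stationary N Pi F mu ->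
  stationary N Pi (reflect_map F) (reflect_meas mu).
Proof.
  intros [[H1 H2] H3]. split; [split|].
  - intros k Hk. apply fmeas_reflect, H1, Hk.
  - rewrite <- H2. f_equal. apply functional_extensionality. intros k. apply reflect_inI.
  - intros j B Hj HB. unfold reflect_meas at 1. rewrite (H3 j _ Hj (borel_reflect B HB)).
    f_equal. apply functional_extensionality. intros i. unfold reflect_meas. do 2 f_equal.
    apply functional_extensionality. intros x. unfold reflect_map. do 2 f_equal. f_equal. lra.
Qed.

(** * The hull of the support of a stationary measure *)

(** The interface between support ends and the rest of the proof. [qA] and [qB] are the scales at
    which the hull may be enlarged to a trapping domain. *)
Record hull N Pi (F : nat -> R -> R) (mu : nat -> meas) (A B qA qB : nat -> R) : Prop := {
  hull_A_min : forall k, (k < N)%nat -> is_min (supp (mu k)) (A k);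
  hull_B_max : forall k, (k < N)%nat -> is_max (supp (mu k)) (B k);
  hull_A_null : forall k, (k < N)%nat -> mu k (fun x => x < A k) = 0;
  hull_B_null : forall k, (k < N)%nat -> mu k (fun x => B k < x) = 0;
  hull_in : forall k, (k < N)%nat -> 0 < A k /\ A k < B k /\ B k < 1;
  hull_A_edge : forall i j, edge N Pi i j -> A j <= F i (A i);
  hull_B_edge : forall i j, edge N Pi i j -> F i (B i) <= B j;
  hull_A_att : forall k, (k < N)%nat -> exists r a w, attracting N Pi F r a /\
    simple_transition N Pi w /\ hd 0%nat w = hd 0%nat r /\ last w 0%nat = k /\ wmap F w a = A k;
  hull_B_att : forall k, (k < N)%nat -> exists r a w, attracting N Pi F r a /\
    simple_transition N Pi w /\ hd 0%nat w = hd 0%nat r /\ last w 0%nat = k /\ wmap F w a = B k;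
  hull_q : forall k, 0 < qA k /\ 0 < qB k;
  hull_trap : evsmall (fun t =>
    (forall k, (k < N)%nat -> 0 < A k - qA k * t /\ B k + qB k * t < 1) /\
    forall i j, edge N Pi i j -> A j - qA j * t < F i (A i - qA i * t) /\
                                 F i (B i + qB i * t) < B j + qB j * t) }.

Lemma supp_reflect mu k x : supp (reflect_meas mu k) x -> supp (mu k) (1 - x).
Proof.
  intros H e He. specialize (H e He). unfold reflect_meas in H.
  rewrite (pred_ext (fun y => 1 - x - e < y < 1 - x + e) (fun y => x - e < 1 - y < x + e))
    by (intros; lra). exact H.
Qed.

Lemma hull_exists N Pi F F' mu : system N Pi F F' -> stationary N Pi F mu ->
  exists A B qA qB, hull N Pi F mu A B qA qB.
Proof.
  intros HS Hmu. pose proof (system_reflect _ _ _ _ HS) as HS'.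
  pose proof (stationary_reflect _ _ _ _ Hmu) as Hmu'.
  destruct (lower_edge_exists _ _ _ _ HS mu Hmu) as [A HA].
  destruct (lower_edge_exists _ _ _ _ HS' _ Hmu') as [A' HA'].
  destruct (lower_edge_trapping _ _ _ _ HS mu Hmu A HA) as [qA [HqA HtA]].
  destruct (lower_edge_trapping _ _ _ _ HS' _ Hmu' A' HA') as [qB [HqB HtB]].
  assert (HmaxB : forall k, (k < N)%nat -> is_max (supp (mu k)) (1 - A' k)).
  { intros k Hk. destruct (lower_edge_supp _ _ _ _ HS' _ Hmu' A' HA' k Hk) as [H1 H2].
    split; [apply supp_reflect; auto|]. intros y Hy.
    assert (A' k <= 1 - y); [|lra]. apply H2. intros e He. specialize (Hy e He).
    unfold reflect_meas.
    rewrite (pred_ext (fun x => 1 - y - e < 1 - x < 1 - y + e) (fun x => y - e < x < y + e))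
      by (intros; lra). exact Hy. }
  exists A, (fun k => 1 - A' k), qA, qB.
  constructor.
  - apply (lower_edge_supp _ _ _ _ HS mu Hmu A HA).
  - exact HmaxB.
  - intros k Hk. apply (HA k Hk).
  - intros k Hk. destruct (HA' k Hk) as [_ [H _]]. unfold reflect_meas in H. rewrite <- H.
    f_equal. apply pred_ext. intros; lra.
  - intros k Hk.
    pose proof (lower_edge_inside _ _ _ _ HS mu Hmu A HA k Hk).
    pose proof (lower_edge_inside _ _ _ _ HS' _ Hmu' A' HA' k Hk).
    assert (A k <= 1 - A' k).
    { apply (HmaxB k Hk). apply (lower_edge_supp _ _ _ _ HS mu Hmu A HA k Hk). }
    (* A hull reduced to one point would put the whole positive mass of the fibre in an atom at
       [A k]. *)
    enough (A k <> 1 - A' k) by lra. intros E.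
    pose proof (lower_edge_no_atom _ _ _ _ HS mu Hmu A HA k Hk) as N1.
    pose proof (stationary_mass_pos _ _ _ _ HS mu Hmu k Hk) as Hp.
    pose proof (stationary_fmeas _ _ _ _ Hmu k Hk) as Hm.
    pose proof (meas_compl _ Hm _ (borel_le (A k))) as Hc.
    destruct (HA' k Hk) as [_ [N2 _]]. unfold reflect_meas in N2.
    rewrite (pred_ext (fun x => 1 - x < A' k) (fun x => ~ x <= A k)) in N2 by (intros; lra). lra.
  - apply (lower_edge_le _ _ _ _ HS mu Hmu A HA).
  - intros i j Hij. pose proof (lower_edge_le _ _ _ _ HS' _ Hmu' A' HA' i j Hij) as H.
    unfold reflect_map in H. lra.
  - apply (lower_edge_attracting _ _ _ _ HS mu Hmu A HA).
  - intros k Hk.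
    destruct (lower_edge_attracting _ _ _ _ HS' _ Hmu' A' HA' k Hk)
      as [r [a [w [H1 [H2 [H3 [H4 H5]]]]]]].
    exists r, (1 - a), w. split; [apply attracting_unreflect, H1|].
    repeat split; try assumption; try apply H2. rewrite wmap_reflect in H5. lra.
  - intros k. auto.
  - generalize (evsmall_and _ _ HtA HtB). apply evsmall_mono.
    intros t [[H1 H2] [H3 H4]]. split.
    + intros k Hk. specialize (H1 k Hk). specialize (H3 k Hk). lra.
    + intros i j Hij. specialize (H2 i j Hij). specialize (H4 i j Hij).
      unfold reflect_map in H4.
      replace (1 - (A' i - qB i * t)) with (1 - A' i + qB i * t) in H4 by lra. lra.
Qed.

(** * Ergodic measures and crossing trajectories *)

Lemma infinite_sum_scal c u l : infinite_sum u l -> infinite_sum (fun n => c * u n) (c * l).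
Proof.
  intros H. apply (Un_cv_ext (fun n => c * sum_f_R0 u n)).
  - intros n. rewrite scal_sum. apply sum_eq. intros. lra.
  - apply (CV_mult (fun _ => c)); [|exact H]. intros e He. exists O. intros. unfold Rdist.
    rewrite Rminus_diag, Rabs_R0. exact He.
Qed.

Lemma fmeas_restrict m c E : is_fmeas_I m -> borel E -> 0 <= c ->
  is_fmeas_I (fun C => c * m (fun x => C x /\ E x)).
Proof.
  intros [H1 [H2 [H3 H4]]] HE Hc. split; [|split; [|split]].
  - intros B C HB H. f_equal. apply H1; [apply borel_and; assumption|].
    intros x. rewrite H. tauto.
  - intros B HB. apply Rmult_le_pos; [exact Hc|]. apply H2, borel_and; assumption.
  - intros B HB. f_equal. rewrite H3 by (apply borel_and; assumption).
    f_equal. apply pred_ext. tauto.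
  - intros Bn HB Hd. apply infinite_sum_scal.
    rewrite (pred_ext (fun x => (exists n, Bn n x) /\ E x) (fun x => exists n, Bn n x /\ E x))
      by firstorder.
    apply (H4 (fun n x => Bn n x /\ E x)).
    + intros n. apply borel_and; auto.
    + intros n p x Hne [Ha _] [Hb _]. eauto.
Qed.

(** Stationarity makes a forward invariant set agree with its preimage along each edge up to a null
    set. The normalised restrictions to the set and to its complement are then both stationary;
    extremality would identify them, although the first gives the set mass 1 and the second mass
    0. *)
Lemma ergodic_invariant_trivial N Pi F F' mu (E : nat -> R -> Prop) :
  system N Pi F F' -> ergodic N Pi F mu -> (forall k, (k < N)%nat -> borel (E k)) ->
  (forall i j x, edge N Pi i j -> inI x -> E i x -> E j (F i x)) ->
  rsum (fun k => mu k (E k)) N = 0 \/ rsum (fun k => mu k (E k)) N = 1.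
Proof.
  intros HS [Hmu Hext] HE Hinv. apply NNPP. intros Hno.
  pose proof (sys_N _ _ _ _ HS) as HN.
  assert (fm : forall k, (k < N)%nat -> is_fmeas_I (mu k))
    by (intros; eapply stationary_fmeas; eauto).
  assert (HEF : forall i j, (i < N)%nat -> (j < N)%nat -> borel (fun x => E j (F i x))).
  { intros i j Hi Hj. apply borel_preimage; [eapply F_cont; eauto|auto]. }
  set (th := rsum (fun k => mu k (E k)) N) in *.
  pose proof (stationary_total _ _ _ _ HN Hmu) as Htot.
  assert (Hth : 0 < th < 1).
  { assert (0 <= th) by (apply rsum_nonneg; intros; apply meas_nonneg; auto).
    assert (th <= 1); [|lra].
    rewrite <- Htot. apply rsum_le. intros k Hk. apply meas_le_total; auto. }
  assert (Hle : forall i j, (i < N)%nat -> (j < N)%nat ->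
    0 <= Pi i j * (mu i (fun x => E j (F i x)) - mu i (E i))).
  { intros i j Hi Hj. destruct (Pi_edge _ _ _ _ HS i j Hi Hj) as [->|Hij]; [lra|].
    apply Rmult_le_pos; [eapply Pi_nonneg; eauto|].
    assert (mu i (E i) <= mu i (fun x => E j (F i x))); [|lra].
    apply meas_mono; auto. }
  (* The nonnegative terms of [Hle] add up to [th - th = 0] by stationarity, hence all vanish. *)
  assert (Hdiff : forall i j, edge N Pi i j -> mu i (fun x => E j (F i x)) = mu i (E i)).
  { intros i j Hij. pose proof Hij as [Hi [Hj HP]].
    assert (Hz : Pi i j * (mu i (fun x => E j (F i x)) - mu i (E i)) = 0); [|nra].
    apply (rsum_zero_term (fun j => Pi i j * (mu i (fun x => E j (F i x)) - mu i (E i))) N); auto.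
    apply Req_le.
    apply (rsum_zero_term
      (fun i => rsum (fun j => Pi i j * (mu i (fun x => E j (F i x)) - mu i (E i))) N) N); auto.
    - intros; apply rsum_nonneg; auto.
    - apply Req_le.
      rewrite (rsum_ext _ (fun i => rsum (fun j => Pi i j * mu i (fun x => E j (F i x))) N
                                    - mu i (E i))).
      + rewrite rsum_minus, rsum_swap.
        rewrite (rsum_ext _ (fun j => mu j (E j))); [fold th; lra|].
        intros k Hk. symmetry. apply (stationary_eq N Pi F mu HN Hmu k (E k) Hk). auto.
      + intros k Hk. rewrite (rsum_ext _ (fun j => Pi k j * mu k (fun x => E j (F k x))
          - mu k (E k) * Pi k j)) by (intros; lra).
        rewrite rsum_minus, rsum_scal.
        pose proof (Pi_row _ _ _ _ HS k Hk : rsum (Pi k) N = 1) as ->. lra. }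
  assert (Hpart : forall i j C, edge N Pi i j -> borel C ->
    mu i (fun x => C (F i x) /\ E j (F i x)) = mu i (fun x => C (F i x) /\ E i x) /\
    mu i (fun x => C (F i x) /\ ~ E j (F i x)) = mu i (fun x => C (F i x) /\ ~ E i x)).
  { intros i j C Hij HC. pose proof Hij as [Hi [Hj HP]].
    assert (HCF : borel (fun x => C (F i x))).
    { apply borel_preimage; [eapply F_cont; eauto|exact HC]. }
    assert (Hm := fm i Hi). assert (HEi := HE i Hi). assert (HEFi := HEF i j Hi Hj).
    assert (Hb1 : borel (fun x => E j (F i x) /\ E i x)) by (apply borel_and; assumption).
    assert (Hn : mu i (fun x => E j (F i x) /\ ~ E i x) = 0).
    { pose proof (meas_split _ Hm _ _ HEFi HEi) as Hsp.
      rewrite (Hdiff i j Hij) in Hsp.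
      rewrite (meas_ext _ Hm (fun x => E j (F i x) /\ E i x) (E i)) in Hsp; [lra| | |]; auto.
      intros x Hx. specialize (Hinv i j x Hij Hx). tauto. }
    assert (Hd : mu i (fun x => C (F i x) /\ E j (F i x)) = mu i (fun x => C (F i x) /\ E i x)).
    { rewrite (meas_split _ Hm _ _ (borel_and _ _ HCF HEFi) HEi).
      assert (Hz : mu i (fun x => (C (F i x) /\ E j (F i x)) /\ ~ E i x) <= 0).
      { rewrite <- Hn. apply meas_mono; [exact Hm| |apply borel_diff; assumption|tauto].
        apply borel_diff; [apply borel_and; assumption|assumption]. }
      pose proof (meas_nonneg _ Hm _ (borel_diff _ _ (borel_and _ _ HCF HEFi) HEi)) as Hz'.
      rewrite (meas_ext _ Hm (fun x => (C (F i x) /\ E j (F i x)) /\ E i x)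
                             (fun x => C (F i x) /\ E i x)); [lra| | |].
      - repeat apply borel_and; assumption.
      - intros x Hx. specialize (Hinv i j x Hij Hx). tauto.
      - apply borel_and; assumption. }
    split; [exact Hd|].
    pose proof (meas_split _ Hm _ _ HCF HEFi). pose proof (meas_split _ Hm _ _ HCF HEi). lra. }
  set (nu1 := fun (k : nat) (C : R -> Prop) => / th * mu k (fun x => C x /\ E k x)).
  set (nu2 := fun (k : nat) (C : R -> Prop) => / (1 - th) * mu k (fun x => C x /\ ~ E k x)).
  assert (Hi1 : 0 < / th) by (apply Rinv_0_lt_compat; lra).
  assert (Hi2 : 0 < / (1 - th)) by (apply Rinv_0_lt_compat; lra).
  assert (HinE : forall k, (k < N)%nat -> mu k (fun x => inI x /\ E k x) = mu k (E k)).
  { intros k Hk. apply meas_ext; auto; [apply borel_and; [apply borel_inI|auto]|tauto]. }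
  assert (HinE' : forall k, (k < N)%nat -> mu k (fun x => inI x /\ ~ E k x) = mu k inI - mu k (E k)).
  { intros k Hk. rewrite <- (HinE k Hk).
    pose proof (meas_split _ (fm k Hk) _ _ borel_inI (HE k Hk)). lra. }
  assert (St1 : stationary N Pi F nu1).
  { split; [split|].
    - intros k Hk. apply fmeas_restrict; auto. lra.
    - rewrite sum_f_R0_rsum by exact HN. unfold nu1.
      rewrite rsum_scal, (rsum_ext _ (fun k => mu k (E k))) by exact HinE. fold th. field. lra.
    - intros j C Hj HC. rewrite sum_f_R0_rsum by exact HN. unfold nu1.
      rewrite (stationary_eq _ _ _ _ HN Hmu j _ Hj (borel_and _ _ HC (HE j Hj))), <- rsum_scal.
      apply rsum_ext. intros i Hi. destruct (Pi_edge _ _ _ _ HS i j Hi Hj) as [->|Hij]; [lra|].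
      rewrite (proj1 (Hpart i j C Hij HC)). lra. }
  assert (St2 : stationary N Pi F nu2).
  { split; [split|].
    - intros k Hk. apply fmeas_restrict; [auto|apply borel_compl; auto|lra].
    - rewrite sum_f_R0_rsum by exact HN. unfold nu2.
      rewrite rsum_scal, (rsum_ext _ (fun k => mu k inI - mu k (E k))) by exact HinE'.
      rewrite rsum_minus, Htot. fold th. field. lra.
    - intros j C Hj HC. rewrite sum_f_R0_rsum by exact HN. unfold nu2.
      rewrite (stationary_eq _ _ _ _ HN Hmu j _ Hj (borel_diff _ _ HC (HE j Hj))), <- rsum_scal.
      apply rsum_ext. intros i Hi. destruct (Pi_edge _ _ _ _ HS i j Hi Hj) as [->|Hij]; [lra|].
      rewrite (proj2 (Hpart i j C Hij HC)). lra. }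
  assert (Heq : meq N nu1 nu2).
  { apply (Hext nu1 nu2 th St1 St2 Hth). intros k C Hk HC. unfold nu1, nu2.
    rewrite (meas_split _ (fm k Hk) _ _ HC (HE k Hk)). field. lra. }
  assert (rsum (fun k => nu1 k (E k)) N = rsum (fun k => nu2 k (E k)) N)
    by (apply rsum_ext; intros; apply Heq; auto).
  unfold nu1, nu2 in H. rewrite !rsum_scal in H.
  rewrite (rsum_ext (fun k => mu k (fun x => E k x /\ E k x)) (fun k => mu k (E k))) in H.
  2: { intros k Hk. f_equal. apply pred_ext. tauto. }
  rewrite (rsum_ext (fun k => mu k (fun x => E k x /\ ~ E k x)) (fun _ => 0)), rsum_zero in H.
  2: { intros k Hk. apply meas_null; [auto|apply borel_diff; auto|tauto]. }
  fold th in H. rewrite Rinv_l in H by lra. lra.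
Qed.

(** The number of steps is recorded because losses at the two ends can be combined only under the
    same power of the Markov operator. *)
Inductive reach N Pi (F : nat -> R -> R) (X : nat -> R) : nat -> nat -> R -> Prop :=
  | reach_start k : (k < N)%nat -> reach N Pi F X 0 k (X k)
  | reach_step n i j x : reach N Pi F X n i x -> edge N Pi i j -> reach N Pi F X (S n) j (F i x).

Section Crossing.

Context (N : nat) (Pi : nat -> nat -> R) (F F' : nat -> R -> R) (HS : system N Pi F F').
Context (mu : nat -> meas).
Context (A B qA qB : nat -> R) (HH : hull N Pi F mu A B qA qB).

Lemma hull_inI k x : (k < N)%nat -> A k <= x <= B k -> inI x.
Proof using HH. intros Hk Hx. pose proof (hull_in _ _ _ _ _ _ _ _ HH k Hk). unfold inI. lra. Qed.

Lemma hull_invariant i j x : edge N Pi i j -> A i <= x <= B i -> A j <= F i x <= B j.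
Proof using HS HH.
  intros He Hx. pose proof He as [Hi _]. pose proof (hull_in _ _ _ _ _ _ _ _ HH i Hi).
  pose proof (hull_A_edge _ _ _ _ _ _ _ _ HH i j He).
  pose proof (hull_B_edge _ _ _ _ _ _ _ _ HH i j He).
  pose proof (F_le _ _ _ _ HS i (A i) x Hi). pose proof (F_le _ _ _ _ HS i x (B i) Hi).
  unfold inI in *. lra.
Qed.

Lemma reach_hull X n j x : (forall k, (k < N)%nat -> A k <= X k <= B k) ->
  reach N Pi F X n j x -> (j < N)%nat /\ A j <= x <= B j.
Proof using HS HH.
  intros HX H. induction H as [k Hk|n i j x H [IH1 IH2] He]; [auto|].
  split; [apply He|apply hull_invariant; assumption].
Qed.

Let HAX : forall k, (k < N)%nat -> A k <= A k <= B k.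
Proof. intros k Hk. pose proof (hull_in _ _ _ _ _ _ _ _ HH k Hk). lra. Qed.
Let HBX : forall k, (k < N)%nat -> A k <= B k <= B k.
Proof. intros k Hk. pose proof (hull_in _ _ _ _ _ _ _ _ HH k Hk). lra. Qed.

(* Prefixing a path moves its image of the lower end up and of the upper end down. *)
Lemma reach_A_extend n j x : reach N Pi F A n j x ->
  forall p, exists x', x <= x' /\ reach N Pi F A (n + p) j x'.
Proof using HS HH.
  intros H.
  assert (Hone : forall n j x, reach N Pi F A n j x ->
    exists x', x <= x' /\ reach N Pi F A (S n) j x').
  { clear n j x H. intros n j x H. induction H as [k Hk|n i j x H [x' [Hx IH]] He].
    - destruct (edge_pred _ _ _ _ HS k Hk) as [i Hi]. exists (F i (A i)).
      split; [apply (hull_A_edge _ _ _ _ _ _ _ _ HH i k Hi)|].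
      apply (reach_step _ _ _ _ 0 i); [constructor; apply Hi|exact Hi].
    - exists (F i x'). split; [|econstructor; eauto].
      destruct (reach_hull A _ _ _ HAX H) as [Hi H1].
      destruct (reach_hull A _ _ _ HAX IH) as [_ H2].
      apply (F_le _ _ _ _ HS); [exact Hi| | |exact Hx]; eapply hull_inI; eauto. }
  induction p as [|p [x' [Hx IH]]].
  - exists x. split; [lra|]. rewrite Nat.add_0_r. exact H.
  - destruct (Hone _ _ _ IH) as [x'' [Hx' H']]. exists x''. split; [lra|].
    rewrite Nat.add_succ_r. exact H'.
Qed.

Lemma reach_B_extend n j x : reach N Pi F B n j x ->
  forall p, exists x', x' <= x /\ reach N Pi F B (n + p) j x'.
Proof using HS HH.
  intros H.
  assert (Hone : forall n j x, reach N Pi F B n j x ->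
    exists x', x' <= x /\ reach N Pi F B (S n) j x').
  { clear n j x H. intros n j x H. induction H as [k Hk|n i j x H [x' [Hx IH]] He].
    - destruct (edge_pred _ _ _ _ HS k Hk) as [i Hi]. exists (F i (B i)).
      split; [apply (hull_B_edge _ _ _ _ _ _ _ _ HH i k Hi)|].
      apply (reach_step _ _ _ _ 0 i); [constructor; apply Hi|exact Hi].
    - exists (F i x'). split; [|econstructor; eauto].
      destruct (reach_hull B _ _ _ HBX H) as [Hi H1].
      destruct (reach_hull B _ _ _ HBX IH) as [_ H2].
      apply (F_le _ _ _ _ HS); [exact Hi| | |exact Hx]; eapply hull_inI; eauto. }
  induction p as [|p [x' [Hx IH]]].
  - exists x. split; [lra|]. rewrite Nat.add_0_r. exact H.
  - destruct (Hone _ _ _ IH) as [x'' [Hx' H']]. exists x''. split; [lra|].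
    rewrite Nat.add_succ_r. exact H'.
Qed.

Lemma reach_path X w n x : w <> [] -> epath (edge N Pi) w -> reach N Pi F X n (hd 0%nat w) x ->
  reach N Pi F X (n + (length w - 1)) (last w 0%nat) (wmap F w x).
Proof using.
  revert n x. induction w as [|a w IH]; [easy|]. intros n x _ Hp Hr.
  destruct w as [|b w]; [simpl; rewrite Nat.add_0_r; exact Hr|].
  destruct Hp as [H1 H2].
  replace (n + (length (a :: b :: w) - 1))%nat with (S n + (length (b :: w) - 1))%nat by (simpl; lia).
  apply (IH (S n) (F a x)); [easy|exact H2|]. econstructor; eauto.
Qed.

(* If all images of the lower end stay below all images of the upper end, the points below the images
   of the lower end form an invariant set of measure strictly between 0 and 1. *)
Lemma ergodic_crossing : ergodic N Pi F mu -> exists n n' j x y,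
  reach N Pi F A n j x /\ reach N Pi F B n' j y /\ y <= x.
Proof using HS HH.
  intros Herg. pose proof (proj1 Herg) as Hst. apply NNPP. intros Hno.
  pose proof (sys_N _ _ _ _ HS) as HN.
  assert (Hlt : forall n n' j x y, reach N Pi F A n j x -> reach N Pi F B n' j y -> x < y).
  { intros n n' j x y H1 H2. apply Rnot_le_lt. intros Hle. apply Hno. eauto 10. }
  assert (Hlub : forall k, (k < N)%nat -> exists s, is_lub (fun x => exists n, reach N Pi F A n k x) s).
  { intros k Hk.
    destruct (completeness (fun x => exists n, reach N Pi F A n k x)) as [s Hs].
    - exists (B k). intros x [n Hx]. apply (reach_hull A _ _ _ HAX Hx).
    - exists (A k), O. constructor. exact Hk.
    - eauto. }
  (* [a k] separates: it bounds all images of lower ends from above and, absent a crossing, all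
     images of upper ends from below. *)
  destruct (finite_choice 0 N _ Hlub) as [a Ha]. clear Hlub.
  assert (HaA : forall n k x, reach N Pi F A n k x -> x <= a k).
  { intros n k x Hx. destruct (reach_hull A _ _ _ HAX Hx) as [Hk _].
    apply (proj1 (Ha k Hk)). eauto. }
  assert (HaB : forall n k y, reach N Pi F B n k y -> a k <= y).
  { intros n k y Hy. destruct (reach_hull B _ _ _ HBX Hy) as [Hk _].
    apply (proj2 (Ha k Hk)). intros x [n' Hx]. left. eauto. }
  assert (Hab : forall k, (k < N)%nat -> A k <= a k <= B k).
  { intros k Hk. split; [eapply HaA|eapply HaB]; constructor; exact Hk. }
  assert (Hainv : forall i j, edge N Pi i j -> F i (a i) <= a j).
  { intros i j Hij. pose proof Hij as [Hi _]. apply Rnot_lt_le. intros Hgt.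
    destruct (F_cont _ _ _ _ HS i Hi (a i) (F i (a i) - a j)) as [d [Hd Hc]]; [lra|].
    assert (Hex : exists n x, reach N Pi F A n i x /\ a i - d < x).
    { apply NNPP. intros Hn. assert (a i <= a i - d); [|lra].
      apply (proj2 (Ha i Hi)). intros x [n Hx]. apply Rnot_lt_le. intros Hl. eauto. }
    destruct Hex as [n [x [Hx Hxd]]]. pose proof (HaA _ _ _ Hx) as Hxa.
    pose proof (HaA _ _ _ (reach_step _ _ _ _ _ _ _ _ Hx Hij)) as Hfx.
    destruct (Req_dec (a i) x) as [E|Hne]; [rewrite <- E in Hfx; lra|].
    specialize (Hc x). simpl in Hc. unfold Rdist in Hc.
    assert (Hb : Rabs (x - a i) < d) by (apply Rabs_def1; lra).
    specialize (Hc (conj (conj I Hne) Hb)). apply Rabs_def2 in Hc. lra. }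
  destruct (ergodic_invariant_trivial N Pi F F' mu (fun k x => x <= a k) HS Herg) as [H0|H1].
  - intros. apply borel_le.
  - intros i j x Hij Hx Hle. pose proof Hij as [Hi _].
    apply Rle_trans with (F i (a i)); [|auto].
    apply (F_le _ _ _ _ HS); auto. eapply hull_inI; eauto.
  (* Null case: no mass lies between [A j] and [a j], so images of lower ends cannot rise above the
     lower ends, and [A] solves the system excluded by (G3). *)
  - apply (sys_G3 _ _ _ _ HS). exists A. split.
    { intros i Hi. apply (hull_inI i); auto. }
    intros i j Hi Hj HP. assert (Hij : edge N Pi i j) by (repeat split; assumption).
    apply Rle_antisym; [|apply (hull_A_edge _ _ _ _ _ _ _ _ HH i j Hij)].
    apply Rnot_lt_le. intros Hgt.
    assert (Hr : F i (A i) <= a j).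
    { apply (HaA 1%nat). apply (reach_step _ _ _ _ 0 i); [constructor; exact Hi|exact Hij]. }
    destruct (hull_A_min _ _ _ _ _ _ _ _ HH j Hj) as [Hs _].
    specialize (Hs (a j - A j) ltac:(lra)).
    pose proof (stationary_fmeas _ _ _ _ Hst) as fm.
    assert (Hz : mu j (fun x => x <= a j) = 0).
    { apply (rsum_zero_term (fun k => mu k (fun x => x <= a k)) N); [|lra|exact Hj].
      intros k Hk. apply meas_nonneg; [auto|apply borel_le]. }
    assert (mu j (fun y => A j - (a j - A j) < y < A j + (a j - A j)) <= mu j (fun x => x <= a j)).
    { apply meas_mono; [auto|apply borel_interval|apply borel_le|intros; lra]. }
    lra.
  (* Full case: [B] lies below [a], hence below every image of an upper end, and [B] solves the
     system excluded by (G3). *)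
  - pose proof (stationary_fmeas _ _ _ _ Hst) as fm.
    pose proof (stationary_total _ _ _ _ HN Hst) as Htot.
    assert (Hz : forall k, (k < N)%nat -> mu k (fun x => ~ x <= a k) = 0).
    { intros k Hk. apply (rsum_zero_term (fun k => mu k (fun x => ~ x <= a k)) N); [| |exact Hk].
      - intros i Hi. apply meas_nonneg; [auto|apply borel_compl, borel_le].
      - rewrite (rsum_ext _ (fun k => mu k inI - mu k (fun x => x <= a k))).
        + rewrite rsum_minus. lra.
        + intros i Hi. apply meas_compl; [auto|apply borel_le]. }
    assert (HBa : forall k, (k < N)%nat -> B k <= a k).
    { intros k Hk. apply Rnot_lt_le. intros Hl.
      destruct (hull_B_max _ _ _ _ _ _ _ _ HH k Hk) as [Hs _].
      specialize (Hs (B k - a k) ltac:(lra)).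
      assert (mu k (fun y => B k - (B k - a k) < y < B k + (B k - a k)) <= mu k (fun x => ~ x <= a k)).
      { apply meas_mono; [auto|apply borel_interval|apply borel_compl, borel_le|intros; lra]. }
      rewrite Hz in H by exact Hk. lra. }
    apply (sys_G3 _ _ _ _ HS). exists B. split.
    { intros i Hi. apply (hull_inI i); auto. }
    intros i j Hi Hj HP. assert (Hij : edge N Pi i j) by (repeat split; assumption).
    apply Rle_antisym; [apply (hull_B_edge _ _ _ _ _ _ _ _ HH i j Hij)|].
    apply Rle_trans with (a j); [auto|]. apply (HaB 1%nat).
    apply (reach_step _ _ _ _ 0 i); [constructor; exact Hi|exact Hij].
Qed.

(* Appending paths of one common length, available by primitivity. *)
Lemma ergodic_crossing_everywhere : ergodic N Pi F mu -> exists l, forall j, (j < N)%nat ->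
  exists x y, reach N Pi F A l j x /\ reach N Pi F B l j y /\ y <= x.
Proof using HS HH.
  intros Herg. destruct (ergodic_crossing Herg) as [n [n' [i [x [y [Hx [Hy Hyx]]]]]]].
  (* Each word is prolonged by the length of the other; prolongation on the left only widens the
     crossing. *)
  destruct (reach_A_extend _ _ _ Hx n') as [x' [Hx1 Hx2]].
  destruct (reach_B_extend _ _ _ Hy n) as [y' [Hy1 Hy2]]. rewrite (Nat.add_comm n' n) in Hy2.
  destruct (reach_hull A _ _ _ HAX Hx2) as [Hi _].
  destruct (sys_prim _ _ _ _ HS) as [m Hm].
  exists (n + n' + m)%nat. intros j Hj. destruct (Hm i j Hi Hj) as [w [Hw [Hl [H1 H2]]]].
  exists (wmap F w x'), (wmap F w y').
  replace m with (length w - 1)%nat by lia. rewrite <- H2.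
  pose proof (word_ok_epath _ _ _ Hw) as Hp.
  split; [|split].
  - apply reach_path; [apply Hw|exact Hp|rewrite H1; exact Hx2].
  - apply reach_path; [apply Hw|exact Hp|rewrite H1; exact Hy2].
  - assert (Hle : y' <= x') by lra.
    destruct (reach_hull A _ _ _ HAX Hx2) as [_ Hx3]. destruct (reach_hull B _ _ _ HBX Hy2) as [_ Hy3].
    pose proof (hull_inI i x' Hi Hx3) as Ix.
    pose proof (hull_inI i y' Hi Hy3) as Iy.
    clear - HS Hp Ix Iy Hle. revert x' y' Ix Iy Hle.
    induction w as [|a w IH]; [easy|]. destruct w as [|b w]; [easy|].
    intros x y Ix Iy Hle. destruct Hp as [[Ha _] Hp].
    apply (IH Hp (F a x) (F a y)); [eapply F_inI; eauto|eapply F_inI; eauto|].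
    eapply F_le; eauto.
Qed.

End Crossing.

(** * Contraction of monotone functions by the Markov operator *)

Definition incr N (g : nat -> R -> R) : Prop :=
  forall k x y, (k < N)%nat -> inI x -> inI y -> x <= y -> g k x <= g k y.

(** With [p] the fibre masses and [A], [B] the hull ends, a mean oscillation; for the coordinate
    function it is the mean length of the hull. *)
Definition spread N (p A B : nat -> R) (g : nat -> R -> R) : R :=
  rsum (fun k => p k * (g k (B k) - g k (A k))) N.

Lemma stationary_mass_eq N Pi F F' mu j : system N Pi F F' -> stationary N Pi F mu ->
  (j < N)%nat -> mu j inI = rsum (fun i => Pi i j * mu i inI) N.
Proof.
  intros HS Hmu Hj.
  rewrite (stationary_eq _ _ _ _ (sys_N _ _ _ _ HS) Hmu j _ Hj borel_inI).
  apply rsum_ext. intros i Hi. f_equal. symmetry.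
  apply meas_ext; [eapply stationary_fmeas; eauto|apply borel_inI| |].
  - intros x Hx. pose proof (F_inI _ _ _ _ HS i x Hi Hx). tauto.
  - apply borel_preimage; [eapply F_cont; eauto|apply borel_inI].
Qed.

(** Perron-Frobenius by the least ratio [t] of [p] to [q]: [p - t q] is nonnegative, invariant and
    zero at some state, and zeros propagate backwards along edges to all states. *)
Lemma stationary_vector_unique N Pi F F' (p q : nat -> R) : system N Pi F F' ->
  (forall j, (j < N)%nat -> p j = rsum (fun i => Pi i j * p i) N) ->
  (forall j, (j < N)%nat -> q j = rsum (fun i => Pi i j * q i) N) ->
  (forall j, (j < N)%nat -> 0 < q j) -> rsum p N = 1 -> rsum q N = 1 ->
  forall k, (k < N)%nat -> p k = q k.
Proof.
  intros HS Hp Hq Hpos Sp Sq.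
  destruct (index_argmin N (fun _ => True) (fun k => p k / q k)) as [i0 [Hi0 [_ Hmin]]].
  { exists O. split; [apply (sys_N _ _ _ _ HS)|exact I]. }
  set (t := p i0 / q i0) in *. set (v := fun k => p k - t * q k).
  assert (Hv : forall k, (k < N)%nat -> 0 <= v k).
  { intros k Hk. specialize (Hmin k Hk I). specialize (Hpos k Hk). unfold v.
    assert (p k = p k / q k * q k) by (field; lra). nra. }
  assert (Hv0 : v i0 = 0).
  { unfold v, t. specialize (Hpos i0 Hi0). field. lra. }
  assert (Hveq : forall j, (j < N)%nat -> v j = rsum (fun i => Pi i j * v i) N).
  { intros j Hj. unfold v. rewrite (Hp j Hj), (Hq j Hj), <- rsum_scal, <- rsum_minus.
    apply rsum_ext. intros. lra. }
  assert (Hall : forall k, (k < N)%nat -> v k = 0).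
  { intros k Hk. pose proof (irreducible _ _ _ _ HS k i0 Hk Hi0) as Hc.
    clear Hi0 Hmin. clearbody v t. induction Hc as [|j m Hc IH Hjm]; [exact Hv0|].
    apply IH. destruct Hjm as [Hj [Hm HP]].
    assert (Pi j m * v j <= v m).
    { rewrite (Hveq m Hm). apply (rsum_term_le (fun i => Pi i m * v i)); [|exact Hj].
      intros i Hi. apply Rmult_le_pos; [eapply Pi_nonneg; eauto|auto]. }
    specialize (Hv j Hj). nra. }
  assert (Ht : t = 1).
  { rewrite <- Sp, (rsum_ext p (fun k => t * q k)), rsum_scal, Sq; [lra|].
    intros k Hk. specialize (Hall k Hk). unfold v in Hall. lra. }
  intros k Hk. specialize (Hall k Hk). unfold v in Hall. rewrite Ht in Hall. lra.
Qed.

Section Contraction.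

Context (N : nat) (Pi : nat -> nat -> R) (F F' : nat -> R -> R) (HS : system N Pi F F').

Lemma markov_incr g : incr N g -> incr N (markov N Pi F g).
Proof using HS.
  intros Hg k x y Hk Hx Hy Hxy. apply rsum_le. intros j Hj.
  apply Rmult_le_compat_l; [eapply Pi_nonneg; eauto|].
  apply Hg; [exact Hj|eapply F_inI; eauto|eapply F_inI; eauto|eapply F_le; eauto].
Qed.

Lemma markov_iter_incr g n : incr N g -> incr N (Nat.iter n (markov N Pi F) g).
Proof using HS. intros Hg. induction n; simpl; [exact Hg|apply markov_incr; assumption]. Qed.

Context (p : nat -> R) (Hp_pos : forall k, (k < N)%nat -> 0 < p k).
Context (Hp_st : forall j, (j < N)%nat -> p j = rsum (fun i => Pi i j * p i) N).

(* [s] is [1] for the upper end and [-1] for the lower one; [above s j u v] says that u lies beyond v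
   in the direction [s]. *)
Let above (s : R) j u v := forall g, incr N g -> 0 <= s * (g j u - g j v).

(** By stationarity of [p], averaging over images of the ends moves the mean value towards the
    inside of the hull and never outwards. The single trajectory ending at [x] has a positive
    weight, and this weight bounds the loss from below, uniformly in [g]. *)
Lemma reach_gain s X : (forall i j, edge N Pi i j -> above s j (X j) (F i (X i))) ->
  forall n j x, reach N Pi F X n j x -> above s j (X j) x /\
  exists q, 0 < q /\ forall g, incr N g ->
    s * rsum (fun k => p k * Nat.iter n (markov N Pi F) g k (X k)) N <=
    s * rsum (fun k => p k * g k (X k)) N - q * (s * (g j (X j) - g j x)).
Proof using HS Hp_pos Hp_st.
  intros HX n j x H. induction H as [k Hk|n i j x H [IHa [q [Hq IH]]] Hij].
  - split; [intros g _; lra|]. exists 1. split; [lra|]. intros g _. simpl. lra.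
  - pose proof Hij as [Hi [Hj HP]].
    assert (Hstep : above s j (F i (X i)) (F i x)).
    { intros g Hg. apply (IHa (fun _ y => g j (F i y))). intros k y z Hk Hy Hz Hyz.
      apply Hg; [exact Hj|eapply F_inI; eauto|eapply F_inI; eauto|eapply F_le; eauto]. }
    split.
    { intros g Hg. pose proof (Hstep g Hg). pose proof (HX i j Hij g Hg). lra. }
    pose proof (Hp_pos i Hi) as Hpi.
    (* The loss from [X j] to [F i x] splits at [F i (X i)]: the first piece is lost when the
       operator is applied once to [g] ([E2]), the second is the induction hypothesis for the image
       of [g] under the operator ([E1]). *)
    exists (Rmin (q * Pi i j) (p i * Pi i j)).
    split; [apply Rmin_pos; apply Rmult_lt_0_compat; lra|].
    intros g Hg. rewrite Nat.iter_succ_r.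
    specialize (IH _ (markov_incr g Hg)).
    assert (E1 : Pi i j * (s * (g j (F i (X i)) - g j (F i x))) <=
                 s * (markov N Pi F g i (X i) - markov N Pi F g i x)).
    { unfold markov. rewrite <- rsum_minus, <- rsum_scal.
      rewrite (rsum_ext _ (fun j => Pi i j * (s * (g j (F i (X i)) - g j (F i x)))))
        by (intros; lra).
      apply (rsum_term_le (fun j => Pi i j * (s * (g j (F i (X i)) - g j (F i x))))); [|exact Hj].
      intros m Hm. destruct (Pi_edge _ _ _ _ HS i m Hi Hm) as [->|Him]; [lra|].
      apply Rmult_le_pos; [eapply Pi_nonneg; eauto|].
      apply (IHa (fun _ y => g m (F i y))). intros k y z Hk Hy Hz Hyz.
      apply Hg; [exact Hm|eapply F_inI; eauto|eapply F_inI; eauto|eapply F_le; eauto]. }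
    assert (E2 : p i * Pi i j * (s * (g j (X j) - g j (F i (X i)))) <=
      s * (rsum (fun k => p k * g k (X k)) N - rsum (fun k => p k * markov N Pi F g k (X k)) N)).
    { set (d := fun k m => p k * Pi k m * (s * (g m (X m) - g m (F k (X k))))).
      assert (Hd : forall k m, (k < N)%nat -> (m < N)%nat -> 0 <= d k m).
      { intros k m Hk Hm. unfold d.
        destruct (Pi_edge _ _ _ _ HS k m Hk Hm) as [->|Hkm]; [lra|].
        apply Rmult_le_pos; [|apply HX; assumption].
        apply Rmult_le_pos; [|eapply Pi_nonneg; eauto]. left. auto. }
      rewrite (rsum_ext (fun k => p k * g k (X k))
        (fun m => rsum (fun k => p k * Pi k m * g m (X m)) N)).
      2: { intros m Hm. rewrite (Hp_st m Hm) at 1. rewrite Rmult_comm, <- rsum_scal.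
           apply rsum_ext. intros; lra. }
      rewrite rsum_swap, <- rsum_minus, <- rsum_scal.
      rewrite (rsum_ext _ (fun k => rsum (d k) N)).
      - apply Rle_trans with (rsum (d i) N); [apply (rsum_term_le (d i)); auto|].
        apply (rsum_term_le (fun k => rsum (d k) N)); [|exact Hi].
        intros k Hk. apply rsum_nonneg; auto.
      - intros k Hk. unfold markov. rewrite <- rsum_scal, <- rsum_minus, <- rsum_scal.
        apply rsum_ext. intros m Hm. unfold d. lra. }
    set (u := s * (g j (X j) - g j (F i (X i)))) in *.
    set (w := s * (g j (F i (X i)) - g j (F i x))) in *.
    replace (s * (g j (X j) - g j (F i x))) with (u + w) by (unfold u, w; lra).
    assert (Hu : 0 <= u) by (apply HX; assumption). assert (Hw : 0 <= w) by (apply Hstep, Hg).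
    pose proof (Rmin_l (q * Pi i j) (p i * Pi i j)) as M1.
    pose proof (Rmin_r (q * Pi i j) (p i * Pi i j)) as M2.
    set (M := Rmin (q * Pi i j) (p i * Pi i j)) in *.
    assert (M * w <= q * Pi i j * w) by (apply Rmult_le_compat_r; assumption).
    assert (M * u <= p i * Pi i j * u) by (apply Rmult_le_compat_r; assumption).
    apply (Rmult_le_compat_l q) in E1; [|lra]. lra.
Qed.

End Contraction.

Section Mixing.

Context (N : nat) (Pi : nat -> nat -> R) (F F' : nat -> R -> R) (HS : system N Pi F F').
Context (mu : nat -> meas) (Herg : ergodic N Pi F mu).
Context (A B qA qB : nat -> R) (HH : hull N Pi F mu A B qA qB).

Let p := fun k => mu k inI.
Let T := markov N Pi F.
Let Hst : stationary N Pi F mu := proj1 Herg.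

Let Hp_pos k (Hk : (k < N)%nat) : 0 < p k := stationary_mass_pos _ _ _ _ HS mu Hst k Hk.
Let Hp_st j (Hj : (j < N)%nat) : p j = rsum (fun i => Pi i j * p i) N :=
  stationary_mass_eq _ _ _ _ mu j HS Hst Hj.
Let Hp_sum : rsum p N = 1 := stationary_total _ _ _ _ (sys_N _ _ _ _ HS) Hst.

Let HAx : forall i j, edge N Pi i j -> forall g, incr N g ->
  0 <= -1 * (g j (A j) - g j (F i (A i))).
Proof.
  intros i j Hij g Hg. pose proof Hij as [Hi [Hj _]].
  pose proof (hull_in _ _ _ _ _ _ _ _ HH i Hi). pose proof (hull_in _ _ _ _ _ _ _ _ HH j Hj).
  pose proof (hull_A_edge _ _ _ _ _ _ _ _ HH i j Hij) as Hle.
  assert (Hx : inI (A j)) by (unfold inI; lra).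
  assert (Hy : inI (F i (A i))) by (eapply F_inI; eauto; unfold inI; lra).
  pose proof (Hg j _ _ Hj Hx Hy Hle). lra.
Qed.

Let HBx : forall i j, edge N Pi i j -> forall g, incr N g ->
  0 <= 1 * (g j (B j) - g j (F i (B i))).
Proof.
  intros i j Hij g Hg. pose proof Hij as [Hi [Hj _]].
  pose proof (hull_in _ _ _ _ _ _ _ _ HH i Hi). pose proof (hull_in _ _ _ _ _ _ _ _ HH j Hj).
  pose proof (hull_B_edge _ _ _ _ _ _ _ _ HH i j Hij) as Hle.
  assert (Hx : inI (B j)) by (unfold inI; lra).
  assert (Hy : inI (F i (B i))) by (eapply F_inI; eauto; unfold inI; lra).
  pose proof (Hg j _ _ Hj Hy Hx Hle). lra.
Qed.

Lemma spread_nonneg g : incr N g -> 0 <= spread N p A B g.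
Proof using HS Herg HH.
  intros Hg. apply rsum_nonneg. intros k Hk. specialize (Hp_pos k Hk).
  pose proof (hull_in _ _ _ _ _ _ _ _ HH k Hk).
  apply Rmult_le_pos; [lra|]. assert (g k (A k) <= g k (B k)); [|lra].
  apply Hg; [exact Hk| | |]; unfold inI; lra.
Qed.

Lemma spread_split g : spread N p A B g =
  rsum (fun k => p k * g k (B k)) N - rsum (fun k => p k * g k (A k)) N.
Proof using. unfold spread. rewrite <- rsum_minus. apply rsum_ext. intros; lra. Qed.

Lemma spread_markov_le g : incr N g -> spread N p A B (T g) <= spread N p A B g.
Proof using HS Herg HH.
  (* Any trajectory of one step serves; only the sign of its loss is used. *)
  intros Hg. destruct (edge_pred _ _ _ _ HS 0%nat (sys_N _ _ _ _ HS)) as [i Hi].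
  pose proof Hi as [Hi' _].
  pose proof (reach_step N Pi F A 0 i _ _ (reach_start _ _ _ _ _ Hi') Hi) as RA.
  pose proof (reach_step N Pi F B 0 i _ _ (reach_start _ _ _ _ _ Hi') Hi) as RB.
  destruct (reach_gain _ _ _ _ HS p Hp_pos Hp_st (-1) A HAx _ _ _ RA) as [a1 [q1 [Hq1 G1]]].
  destruct (reach_gain _ _ _ _ HS p Hp_pos Hp_st 1 B HBx _ _ _ RB) as [a2 [q2 [Hq2 G2]]].
  specialize (a1 g Hg). specialize (a2 g Hg). specialize (G1 g Hg). specialize (G2 g Hg).
  simpl in G1, G2. rewrite !spread_split. unfold T.
  assert (0 <= q1 * (-1 * (g 0%nat (A 0%nat) - g 0%nat (F i (A i))))) by (apply Rmult_le_pos; lra).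
  assert (0 <= q2 * (1 * (g 0%nat (B 0%nat) - g 0%nat (F i (B i))))) by (apply Rmult_le_pos; lra).
  lra.
Qed.

(** In each fibre [j] there are [y <= x] with [x] reached from a lower end and [y] from an upper
    end, so the losses [g x - g (A j)] and [g (B j) - g y] together cover the oscillation of [g]
    over the hull of [j]. *)
Lemma spread_contraction : exists l rho, (1 <= l)%nat /\ 0 < rho < 1 /\
  forall g, incr N g -> spread N p A B (Nat.iter l T g) <= rho * spread N p A B g.
Proof using HS Herg HH.
  destruct (ergodic_crossing_everywhere _ _ _ _ HS mu A B qA qB HH Herg) as [l Hl].
  pose proof (sys_N _ _ _ _ HS) as HN.
  assert (Hl1 : (1 <= l)%nat).
  { destruct l as [|l]; [|lia]. exfalso. destruct (Hl 0%nat HN) as [x [y [Hx [Hy Hyx]]]].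
    inversion Hx; inversion Hy; subst.
    pose proof (hull_in _ _ _ _ _ _ _ _ HH 0%nat HN). lra. }
  assert (Hev : evsmall (fun q => forall j, (j < N)%nat -> forall g, incr N g ->
    spread N p A B (Nat.iter l T g) <= spread N p A B g - q * (g j (B j) - g j (A j)))).
  { apply (evsmall_fin N (fun j q => forall g, incr N g ->
      spread N p A B (Nat.iter l T g) <= spread N p A B g - q * (g j (B j) - g j (A j)))).
    intros j Hj. destruct (Hl j Hj) as [x [y [Hx [Hy Hyx]]]].
    destruct (reach_gain _ _ _ _ HS p Hp_pos Hp_st (-1) A HAx _ _ _ Hx) as [a1 [q1 [Hq1 G1]]].
    destruct (reach_gain _ _ _ _ HS p Hp_pos Hp_st 1 B HBx _ _ _ Hy) as [a2 [q2 [Hq2 G2]]].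
    exists (Rmin q1 q2). split; [apply Rmin_pos; assumption|]. intros q Hq g Hg.
    specialize (a1 g Hg). specialize (a2 g Hg). specialize (G1 g Hg). specialize (G2 g Hg).
    fold T in G1, G2. rewrite !spread_split.
    assert (HIx : inI x /\ inI y).
    { pose proof (hull_in _ _ _ _ _ _ _ _ HH j Hj).
      destruct (reach_hull _ _ _ _ HS mu A B qA qB HH A _ _ _ (fun k Hk => conj (Rle_refl _)
        (Rlt_le _ _ (proj1 (proj2 (hull_in _ _ _ _ _ _ _ _ HH k Hk))))) Hx) as [_ H1].
      destruct (reach_hull _ _ _ _ HS mu A B qA qB HH B _ _ _ (fun k Hk => conj
        (Rlt_le _ _ (proj1 (proj2 (hull_in _ _ _ _ _ _ _ _ HH k Hk)))) (Rle_refl _)) Hy) as [_ H2].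
      unfold inI. lra. }
    pose proof (Hg j y x Hj (proj2 HIx) (proj1 HIx) Hyx) as Hyx'.
    pose proof (Rmin_l q1 q2). pose proof (Rmin_r q1 q2).
    set (u := -1 * (g j (A j) - g j x)) in *. set (v := 1 * (g j (B j) - g j y)) in *.
    assert (q * u <= q1 * u) by (apply Rmult_le_compat_r; lra).
    assert (q * v <= q2 * v) by (apply Rmult_le_compat_r; lra).
    assert (q * (g j (B j) - g j (A j)) <= q * (u + v)); [|lra].
    apply Rmult_le_compat_l; [lra|]. unfold u, v. lra. }
  assert (HNp : 1 <= INR N) by (apply (le_INR 1); exact HN).
  destruct (evsmall_ex _ (evsmall_and _ _ Hev (evsmall_linear_lt 0 1 1 Rlt_0_1)))
    as [q [Hq0 [Hq Hq1]]].
  (* The mean of the [N] inequalities, one per fibre, combined with [p k <= 1]. *)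
  exists l, (1 - q / INR N). split; [exact Hl1|].
  assert (Hqn : 0 < q / INR N) by (apply Rdiv_lt_0_compat; lra).
  assert (HqN : q / INR N * INR N = q) by (field; lra).
  assert (q / INR N <= q).
  { rewrite <- HqN at 2. rewrite <- (Rmult_1_r (q / INR N)) at 1.
    apply Rmult_le_compat_l; lra. }
  split; [lra|]. intros g Hg.
  assert (Hsum : INR N * spread N p A B (Nat.iter l T g) <=
    INR N * spread N p A B g - q * rsum (fun j => g j (B j) - g j (A j)) N).
  { rewrite <- !rsum_const, <- rsum_scal, <- rsum_minus. apply rsum_le. intros j Hj. auto. }
  assert (Hosc : spread N p A B g <= rsum (fun j => g j (B j) - g j (A j)) N).
  { apply rsum_le. intros k Hk. pose proof (hull_in _ _ _ _ _ _ _ _ HH k Hk).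
    assert (g k (A k) <= g k (B k)) by (apply Hg; unfold inI; auto; lra).
    rewrite <- (Rmult_1_l (g k (B k) - g k (A k))) at 2. apply Rmult_le_compat_r; [lra|].
    rewrite <- Hp_sum. apply rsum_term_le; [|exact Hk]. intros i Hi. left. auto. }
  apply (Rmult_le_reg_l (INR N)); [lra|].
  replace (INR N * ((1 - q / INR N) * spread N p A B g))
    with (INR N * spread N p A B g - q * spread N p A B g) by (field; lra).
  apply (Rmult_le_compat_l q) in Hosc; lra.
Qed.

Lemma spread_iter_antitone g n m : incr N g ->
  spread N p A B (Nat.iter (n + m) T g) <= spread N p A B (Nat.iter m T g).
Proof using HS Herg HH.
  intros Hg. induction n as [|n IH]; [apply Rle_refl|]. simpl.
  eapply Rle_trans; [|exact IH]. apply spread_markov_le.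
  apply (markov_iter_incr _ _ _ _ HS), Hg.
Qed.

Lemma spread_iter_pow l rho : 0 <= rho ->
  (forall g, incr N g -> spread N p A B (Nat.iter l T g) <= rho * spread N p A B g) ->
  forall m g, incr N g -> spread N p A B (Nat.iter (m * l) T g) <= rho ^ m * spread N p A B g.
Proof using HS.
  intros Hr Hl m g Hg. induction m as [|m IH]; [simpl; lra|].
  replace (S m * l)%nat with (l + m * l)%nat by lia. rewrite Nat.iter_add.
  eapply Rle_trans; [apply Hl; apply (markov_iter_incr _ _ _ _ HS), Hg|].
  simpl. rewrite Rmult_assoc. apply Rmult_le_compat_l; assumption.
Qed.

Lemma spread_iter_small g e : incr N g -> 0 < e ->
  exists n0, forall n, (n0 <= n)%nat -> spread N p A B (Nat.iter n T g) <= e.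
Proof using HS Herg HH.
  intros Hg He. destruct spread_contraction as [l [rho [_ [Hr Hl]]]].
  pose proof (spread_nonneg g Hg) as Hn.
  destruct (pow_lt_1_zero rho) with (y := e / (spread N p A B g + 1)) as [m Hm].
  - rewrite Rabs_pos_eq; lra.
  - apply Rdiv_lt_0_compat; lra.
  - exists (m * l)%nat. intros n Hnl. specialize (Hm m (le_n m)).
    assert (Hpow : 0 < rho ^ m) by (apply pow_lt; lra).
    rewrite Rabs_pos_eq in Hm by lra.
    replace n with ((n - m * l) + m * l)%nat by lia.
    eapply Rle_trans; [apply spread_iter_antitone, Hg|].
    eapply Rle_trans; [apply (spread_iter_pow l rho); [lra|exact Hl|exact Hg]|].
    assert (rho ^ m * (spread N p A B g + 1) < e); [|rewrite Rmult_plus_distr_l in *; lra].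
    apply (Rmult_lt_compat_r (spread N p A B g + 1)) in Hm; [|lra].
    replace (e / (spread N p A B g + 1) * (spread N p A B g + 1)) with e in Hm by (field; lra).
    exact Hm.
Qed.

Let hull_borel k : borel (fun x => A k <= x <= B k).
Proof. apply borel_and; [apply borel_ge|apply borel_le]. Qed.

Lemma hull_full k : (k < N)%nat -> mu k (fun x => ~ (A k <= x <= B k)) = 0.
Proof using Herg HH.
  intros Hk. pose proof (stationary_fmeas _ _ _ _ Hst k Hk) as Hm.
  pose proof (hull_A_null _ _ _ _ _ _ _ _ HH k Hk) as HA0.
  pose proof (hull_B_null _ _ _ _ _ _ _ _ HH k Hk) as HB0.
  rewrite (pred_ext (fun x => ~ (A k <= x <= B k)) (fun x => x < A k \/ B k < x)).
  - rewrite (meas_or _ Hm (fun x => x < A k) (fun x => B k < x) (borel_lt _) (borel_gt _)); [lra|].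
    intros x. pose proof (hull_in _ _ _ _ _ _ _ _ HH k Hk). lra.
  - intros x. split; [|lra]. intros H.
    destruct (Rlt_le_dec x (A k)); [auto|right]. apply Rnot_le_lt. intros Hle. apply H. lra.
Qed.

(** The integral is invariant under the operator, and both it and the sample at the points [x k] lie
    between the values at the two hull ends. A vanishing spread therefore makes integrals readable
    from point values. *)
Lemma ssint_squeeze s x n : (forall k, (k < N)%nat -> sborel (s k)) ->
  incr N (fun j => sev (s j)) -> (forall k, (k < N)%nat -> A k <= x k <= B k) ->
  Rabs (ssint N mu s - rsum (fun k => p k * Nat.iter n T (fun j => sev (s j)) k (x k)) N)
    <= spread N p A B (Nat.iter n T (fun j => sev (s j))).
Proof using HS Herg HH.
  intros Hs Hg Hx. set (g := fun j => sev (s j)) in *.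
  destruct (ssint_iter _ _ _ _ mu (sys_N _ _ _ _ HS) (sys_S _ _ _ _ HS) Hst s n Hs) as [Hsn Eq].
  rewrite <- Eq.
  pose proof (sev_iter N Pi F s n) as Ev. fold T g in Ev.
  pose proof (markov_iter_incr _ _ _ _ HS g n Hg) as Hgn. fold T in Hgn.
  set (gn := Nat.iter n T g) in *. set (sn := Nat.iter n (spull N Pi F) s) in *.
  assert (Hev : forall k y, sev (sn k) y = gn k y) by (intros; rewrite <- Ev; reflexivity).
  assert (Hb : forall k, (k < N)%nat ->
    p k * gn k (A k) <= sint (mu k) (sn k) <= p k * gn k (B k) /\
    gn k (A k) <= gn k (x k) <= gn k (B k)).
  { intros k Hk. pose proof (stationary_fmeas _ _ _ _ Hst k Hk) as Hm.
    pose proof (hull_in _ _ _ _ _ _ _ _ HH k Hk) as Hin.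
    split; [rewrite !(Rmult_comm (p k)); split|split].
    - apply (sint_ge _ _ (fun y => A k <= y <= B k) _ Hm (Hsn k Hk) (hull_borel k) (hull_full k Hk)).
      intros y Hy HyI. rewrite Hev. apply Hgn; unfold inI; auto; lra.
    - apply (sint_le _ _ (fun y => A k <= y <= B k) _ Hm (Hsn k Hk) (hull_borel k) (hull_full k Hk)).
      intros y Hy HyI. rewrite Hev. apply Hgn; unfold inI; auto; lra.
    - specialize (Hx k Hk). apply Hgn; unfold inI; auto; lra.
    - specialize (Hx k Hk). apply Hgn; unfold inI; auto; lra. }
  unfold ssint. rewrite <- rsum_minus. unfold spread.
  apply Rabs_le. split.
  - assert (E : rsum (fun k => -1 * (p k * (gn k (B k) - gn k (A k)))) N <=
                rsum (fun k => sint (mu k) (sn k) - p k * gn k (x k)) N).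
    { apply rsum_le. intros k Hk. destruct (Hb k Hk) as [H1 H2]. pose proof (Hp_pos k Hk). nra. }
    rewrite rsum_scal in E. lra.
  - apply rsum_le. intros k Hk. destruct (Hb k Hk) as [H1 H2]. pose proof (Hp_pos k Hk). nra.
Qed.

End Mixing.

(** Invariance of the hulls carries the common point along edges to a common point in every fibre.
    Sampling there approximates the integrals of both measures, whose fibre masses agree by
    uniqueness of the stationary vector. *)
Lemma hulls_overlap_eq N Pi F F' mu nu A B qA qB A' B' qA' qB' k0 x0 : system N Pi F F' ->
  ergodic N Pi F mu -> ergodic N Pi F nu ->
  hull N Pi F mu A B qA qB -> hull N Pi F nu A' B' qA' qB' ->
  (k0 < N)%nat -> A k0 <= x0 <= B k0 -> A' k0 <= x0 <= B' k0 -> meq N mu nu.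
Proof.
  intros HS Hmu Hnu HH HH' Hk0 Hx0 Hx0'.
  pose proof (sys_N _ _ _ _ HS) as HN.
  assert (Hex : forall k, (k < N)%nat -> exists x, A k <= x <= B k /\ A' k <= x <= B' k).
  { intros k Hk. pose proof (irreducible _ _ _ _ HS k0 k Hk0 Hk) as Hc. clear Hk.
    induction Hc as [|i j Hc [x [H1 H2]] Hij]; [eauto|]. exists (F i x).
    split; [apply (hull_invariant _ _ _ _ HS mu A B qA qB HH)
           |apply (hull_invariant _ _ _ _ HS nu A' B' qA' qB' HH')]; assumption. }
  destruct (finite_choice 0 N _ Hex) as [x Hx].
  assert (Hpq : forall k, (k < N)%nat -> mu k inI = nu k inI).
  { apply (stationary_vector_unique N Pi F F'); auto.
    - intros j Hj. apply (stationary_mass_eq _ _ _ _ mu j HS (proj1 Hmu) Hj).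
    - intros j Hj. apply (stationary_mass_eq _ _ _ _ nu j HS (proj1 Hnu) Hj).
    - intros j Hj. apply (stationary_mass_pos _ _ _ _ HS nu (proj1 Hnu) j Hj).
    - apply (stationary_total _ _ _ _ HN (proj1 Hmu)).
    - apply (stationary_total _ _ _ _ HN (proj1 Hnu)). }
  intros k C Hk HC.
  pose proof (stationary_fmeas _ _ _ _ (proj1 Hmu) k Hk) as Fm.
  pose proof (stationary_fmeas _ _ _ _ (proj1 Hnu) k Hk) as Fn.
  revert C HC. apply (fmeas_unique (mu k) (nu k) Fm Fn (Hpq k Hk)). intros C HC Hdown.
  (* The complement of the down-set has a nondecreasing indicator; in the other fibres the function
     is zero. *)
  set (s := fun j => if Nat.eq_dec j k then [(1, fun y => ~ C y)] else []).
  assert (Hs : forall j, (j < N)%nat -> sborel (s j)).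
  { intros j _. unfold s. destruct Nat.eq_dec; [|easy].
    apply sborel_cons. split; [apply borel_compl, HC|easy]. }
  assert (Hg : incr N (fun j => sev (s j))).
  { intros j y z _ _ _ Hyz. unfold s. destruct Nat.eq_dec; simpl; [|lra].
    assert (indic (~ C y) <= indic (~ C z)); [|lra]. apply indic_mono. eauto. }
  assert (Hint : forall m : nat -> meas, ssint N m s = m k (fun y => ~ C y)).
  { intros m. unfold ssint.
    assert (E : forall n, (k < n)%nat -> rsum (fun j => sint (m j) (s j)) n = m k (fun y => ~ C y)).
    { assert (Z : forall n, (n <= k)%nat -> rsum (fun j => sint (m j) (s j)) n = 0).
      { intros n Hn. rewrite (rsum_ext _ (fun _ => 0)); [apply rsum_zero|].
        intros j Hj. unfold s. destruct Nat.eq_dec; [lia|reflexivity]. }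
      induction n as [|n IH]; [lia|]. intros Hkn. simpl.
      destruct (Nat.eq_dec n k) as [->|Hne].
      - rewrite Z by lia. unfold s. destruct Nat.eq_dec; [|easy]. simpl. lra.
      - rewrite IH by lia. unfold s. destruct Nat.eq_dec; [easy|]. simpl. lra. }
    apply E, Hk. }
  assert (Heq : mu k (fun y => ~ C y) = nu k (fun y => ~ C y)).
  { rewrite <- (Hint mu), <- (Hint nu). apply NNPP. intros Hne.
    set (e := Rabs (ssint N mu s - ssint N nu s)).
    assert (He : 0 < e) by (apply Rabs_pos_lt; lra).
    destruct (spread_iter_small _ _ _ _ HS mu Hmu A B qA qB HH _ (e / 3) Hg) as [n1 H1]; [lra|].
    destruct (spread_iter_small _ _ _ _ HS nu Hnu A' B' qA' qB' HH' _ (e / 3) Hg) as [n2 H2]; [lra|].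
    specialize (H1 (n1 + n2)%nat ltac:(lia)). specialize (H2 (n1 + n2)%nat ltac:(lia)).
    pose proof (ssint_squeeze _ _ _ _ HS mu Hmu A B qA qB HH s x (n1 + n2) Hs Hg
      (fun k Hk => proj1 (Hx k Hk))) as S1.
    pose proof (ssint_squeeze _ _ _ _ HS nu Hnu A' B' qA' qB' HH' s x (n1 + n2) Hs Hg
      (fun k Hk => proj2 (Hx k Hk))) as S2.
    rewrite (rsum_ext (fun k => nu k inI * _ k (x k))
      (fun k => mu k inI * Nat.iter (n1 + n2) (markov N Pi F) (fun j => sev (s j)) k (x k))) in S2
      by (intros j Hj; rewrite (Hpq j Hj); reflexivity).
    set (v := rsum _ N) in S1, S2.
    assert (e <= e / 3 + e / 3); [|lra].
    unfold e at 1. replace (ssint N mu s - ssint N nu s)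
      with ((ssint N mu s - v) + - (ssint N nu s - v)) by lra.
    eapply Rle_trans; [apply Rabs_triang|]. rewrite Rabs_Ropp.
    apply Rplus_le_compat; eapply Rle_trans; eassumption. }
  rewrite !meas_compl in Heq by assumption. rewrite (Hpq k Hk) in Heq. lra.
Qed.

(** * Integrals of continuous functions *)

Definition lows (P : list ((R -> Prop) * R * R)) := map (fun '(A, lo, _) => (lo : R, A)) P.
Definition highs (P : list ((R -> Prop) * R * R)) := map (fun '(A, _, hi) => (hi : R, A)) P.

Lemma lo_sum_sint m P : lo_sum m P = sint m (lows P).
Proof. induction P as [|[[A lo] hi] P IH]; simpl; [reflexivity|]. rewrite <- IH. reflexivity. Qed.

Lemma hi_sum_sint m P : hi_sum m P = sint m (highs P).
Proof. induction P as [|[[A lo] hi] P IH]; simpl; [reflexivity|]. rewrite <- IH. reflexivity. Qed.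

(** The first three clauses of [is_integral], separated so that sums over different partitions can
    be compared. *)
Definition partition_of (g : R -> R) (P : list ((R -> Prop) * R * R)) : Prop :=
  (forall A lo hi, In (A, lo, hi) P -> borel A /\ forall x, A x -> inI x -> lo <= g x <= hi) /\
  (forall x, inI x -> exists A lo hi, In (A, lo, hi) P /\ A x) /\
  (forall i j x, i <> j -> (i < length P)%nat -> (j < length P)%nat ->
     fst (fst (nth i P ((fun _ => False), 0, 0))) x ->
     fst (fst (nth j P ((fun _ => False), 0, 0))) x -> False).

Lemma sev_disjoint (P : list ((R -> Prop) * R * R)) x :
  (forall i j, i <> j -> (i < length P)%nat -> (j < length P)%nat ->
     fst (fst (nth i P ((fun _ => False), 0, 0))) x ->
     fst (fst (nth j P ((fun _ => False), 0, 0))) x -> False) ->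
  forall A lo hi, In (A, lo, hi) P -> A x -> sev (lows P) x = lo /\ sev (highs P) x = hi.
Proof.
  assert (Hno : forall P : list ((R -> Prop) * R * R),
    (forall A lo hi, In (A, lo, hi) P -> ~ A x) -> sev (lows P) x = 0 /\ sev (highs P) x = 0).
  { clear P. induction P as [|[[A lo] hi] P IH]; intros H; simpl; [lra|].
    destruct IH as [-> ->]; [intros; eapply H; right; eauto|].
    rewrite indic_false; [lra|]. apply (H A lo hi). now left. }
  induction P as [|[[A0 lo0] hi0] P IH]; intros Hd A lo hi Hin HA; [easy|].
  destruct Hin as [E|Hin].
  - inversion E; subst. simpl. rewrite indic_true by exact HA.
    destruct (Hno P) as [-> ->]; [|lra].
    intros A' lo' hi' Hin HA'. apply (In_nth _ _ ((fun _ => False), 0, 0)) in Hin as [j [Hj Ej]].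
    apply (Hd 0%nat (S j)); simpl; try lia; [exact HA|]. rewrite Ej. exact HA'.
  - destruct (IH (fun i j Hij Hi Hj => Hd (S i) (S j) (fun e => Hij (eq_add_S _ _ e))
      (proj1 (Nat.succ_lt_mono _ _) Hi) (proj1 (Nat.succ_lt_mono _ _) Hj)) A lo hi Hin HA) as [E1 E2].
    simpl. rewrite E1, E2. rewrite indic_false; [lra|]. intros HA0.
    apply (In_nth _ _ ((fun _ => False), 0, 0)) in Hin as [j [Hj Ej]].
    apply (Hd 0%nat (S j)); simpl; try lia; [exact HA0|]. rewrite Ej. exact HA.
Qed.

Lemma partition_sev g P x : partition_of g P -> inI x ->
  sev (lows P) x <= g x <= sev (highs P) x.
Proof.
  intros [H1 [H2 H3]] Hx. destruct (H2 x Hx) as [A [lo [hi [Hin HA]]]].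
  destruct (sev_disjoint P x (fun i j => H3 i j x) A lo hi Hin HA) as [-> ->].
  apply (H1 A lo hi Hin); assumption.
Qed.

Lemma partition_borel g P : partition_of g P -> sborel (lows P) /\ sborel (highs P).
Proof.
  intros [H _]. split; intros c B Hin; apply in_map_iff in Hin as [[[A lo] hi] [E Hin]];
    inversion E; subst; eapply H; eauto.
Qed.

Lemma nat_floor y : 0 <= y -> exists a : nat, INR a <= y < INR a + 1.
Proof.
  intros Hy. destruct (archimed_nat y) as [n Hn].
  induction n as [|n IH]; [simpl in Hn; lra|].
  destruct (Rlt_le_dec y (INR n)) as [H|H]; [auto|]. exists n. rewrite S_INR in Hn. lra.
Qed.

Lemma fine_partition g e : (forall x, inI x -> continuity_pt g x) -> 0 < e ->
  exists P, partition_of g P /\ forall x, inI x -> sev (highs P) x - sev (lows P) x = 2 * e.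
Proof.
  intros Hg He.
  destruct (@Heine_cor2 g 0 1 Hg (mkposreal e He)) as [[d Hd] Hcont]. simpl in Hcont.
  destruct (inv_INR_small d Hd) as [n Hn].
  set (h := / INR (S n)) in *. assert (Hh : 0 < h) by apply inv_INR_pos.
  assert (HSh : INR (S n) * h = 1) by (apply Rinv_r, not_0_INR; lia).
  set (cell := fun a : nat => ((fun x => INR a * h <= x < (INR a + 1) * h),
                               g (INR a * h) - e, g (INR a * h) + e)).
  (* Cells are half-open of length [1 / (n + 1)]; the additional last one is there for the point
     1. *)
  exists (map cell (seq 0 (S (S n)))).
  assert (Hin : forall A lo hi, In (A, lo, hi) (map cell (seq 0 (S (S n)))) ->
    exists a, (a <= S n)%nat /\ (A, lo, hi) = cell a).
  { intros A lo hi H. apply in_map_iff in H as [a [E H]]. apply in_seq in H.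
    exists a. split; [lia|auto]. }
  assert (Hpart : partition_of g (map cell (seq 0 (S (S n))))).
  { split; [|split].
    - intros A lo hi H. destruct (Hin _ _ _ H) as [a [Ha E]]. inversion E; subst. split.
      + apply borel_and; [apply borel_ge|apply borel_lt].
      + intros x Hx HI. assert (Hc : inI (INR a * h)).
        { pose proof (pos_INR a). apply le_INR in Ha. unfold inI. nra. }
        specialize (Hcont x (INR a * h) HI Hc). rewrite Rabs_pos_eq in Hcont by lra.
        specialize (Hcont ltac:(lra)). apply Rabs_def2 in Hcont. lra.
    - intros x Hx. destruct (nat_floor (x * INR (S n))) as [a [Ha1 Ha2]].
      { apply Rmult_le_pos; [apply Hx|apply pos_INR]. }
      assert (Ha : (a <= S n)%nat).
      { apply INR_le. pose proof (pos_INR (S n)). unfold inI in Hx. nra. }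
      exists (fun x => INR a * h <= x < (INR a + 1) * h), (g (INR a * h) - e), (g (INR a * h) + e).
      split.
      + apply in_map_iff. exists a. split; [reflexivity|]. apply in_seq. lia.
      + assert (E : x = x * INR (S n) * h) by (rewrite Rmult_assoc, HSh; lra).
        split; [rewrite E; apply Rmult_le_compat_r; lra|rewrite E; apply Rmult_lt_compat_r; lra].
    - intros i j x Hij Hi Hj Hxi Hxj. rewrite length_map, length_seq in Hi, Hj.
      assert (Hnth : forall i, (i < S (S n))%nat ->
        nth i (map cell (seq 0 (S (S n)))) ((fun _ => False), 0, 0) = cell i).
      { intros k Hk. rewrite (nth_indep _ _ (cell 0%nat)) by (rewrite length_map, length_seq; lia).
        rewrite map_nth, seq_nth by lia. reflexivity. }
      rewrite Hnth in Hxi, Hxj by assumption. unfold cell in Hxi, Hxj. simpl fst in Hxi, Hxj.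
      assert (Hlt : forall i j : nat, (i < j)%nat -> INR i * h <= x < (INR i + 1) * h ->
        INR j * h <= x < (INR j + 1) * h -> False).
      { clear - Hh. intros i j Hij H1 H2. apply le_INR in Hij. rewrite S_INR in Hij.
        apply (Rmult_le_compat_r h) in Hij; lra. }
      destruct (Nat.lt_total i j) as [|[|]]; eauto. }
  split; [exact Hpart|]. intros x Hx. destruct Hpart as [_ [H2 H3]].
  destruct (H2 x Hx) as [A [lo [hi [HinA HA]]]].
  destruct (sev_disjoint _ x (fun i j => H3 i j x) A lo hi HinA HA) as [-> ->].
  destruct (Hin _ _ _ HinA) as [a [_ E]]. inversion E; subst. lra.
Qed.

(** The second clause is what the exponent needs: upper bounds proved for step functions below [g]
    pass to the integral. *)
Lemma integral_exists m g : is_fmeas_I m -> (forall x, inI x -> continuity_pt g x) ->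
  exists L, is_integral m g L /\ forall e, 0 < e -> exists s, sborel s /\
    (forall x, inI x -> sev s x <= g x) /\ L - e <= sint m s.
Proof.
  intros Hm Hg.
  assert (Hle : forall P P', partition_of g P -> partition_of g P' -> lo_sum m P <= hi_sum m P').
  { intros P P' HP HP'. rewrite lo_sum_sint, hi_sum_sint.
    apply sint_mono; [exact Hm|apply (partition_borel g), HP|apply (partition_borel g), HP'|].
    intros x Hx. pose proof (partition_sev g P x HP Hx). pose proof (partition_sev g P' x HP' Hx).
    lra. }
  destruct (fine_partition g 1 Hg Rlt_0_1) as [P0 [HP0 _]].
  destruct (completeness (fun v => exists P, partition_of g P /\ v = lo_sum m P)) as [L [HL1 HL2]].
  - exists (hi_sum m P0). intros v [P [HP ->]]. auto.
  - exists (lo_sum m P0), P0. auto.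
  - assert (Happrox : forall e, 0 < e -> exists P, partition_of g P /\
      L - e <= lo_sum m P /\ hi_sum m P <= L + e).
    { intros e He. pose proof (meas_nonneg m Hm inI borel_inI) as HmI.
      destruct (fine_partition g (e / (2 * (m inI + 1))) Hg) as [P [HP Hd]].
      { apply Rdiv_lt_0_compat; lra. }
      exists P. split; [exact HP|].
      assert (Hgap : hi_sum m P - lo_sum m P <= e).
      { rewrite lo_sum_sint, hi_sum_sint. destruct (partition_borel g P HP) as [Hb1 Hb2].
        apply Rle_trans with (2 * (e / (2 * (m inI + 1))) * m inI).
        - replace (sint m (highs P) - sint m (lows P)) with (sint m (highs P ++ sneg (lows P)))
            by (rewrite sint_app, sint_neg; lra).
          apply (sint_le m _ (fun _ => True)); auto.
          + apply sborel_app; [exact Hb2|apply sborel_neg, Hb1].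
          + apply borel_true.
          + apply meas_null; [exact Hm|apply borel_compl, borel_true|tauto].
          + intros x Hx _. rewrite sev_app, sev_neg, <- (Hd x Hx). lra.
        - replace (2 * (e / (2 * (m inI + 1))) * m inI) with (e - e / (m inI + 1)) by (field; lra).
          assert (0 < e / (m inI + 1)) by (apply Rdiv_lt_0_compat; lra). lra. }
      assert (lo_sum m P <= L) by (apply HL1; eauto).
      assert (L <= hi_sum m P) by (apply HL2; intros v [P' [HP' ->]]; auto). lra. }
    exists L. split.
    + intros e He. destruct (Happrox e He) as [P [[H1 [H2 H3]] [H4 H5]]]. exists P. auto.
    + intros e He. destruct (Happrox e He) as [P [HP [H4 _]]]. exists (lows P).
      split; [apply (partition_borel g P HP)|]. split; [|rewrite <- lo_sum_sint; exact H4].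
      intros x Hx. apply (partition_sev g P x HP Hx).
Qed.

(** A Lipschitz bound may fail for a continuous function, but the offset [e] covers close points and
    the total oscillation covers points at distance at least [d]. The linear form can be summed
    along orbits. *)
Lemma affine_modulus g e : (forall x, inI x -> continuity_pt g x) -> 0 < e ->
  exists C, 0 <= C /\ forall x y, inI x -> inI y -> g x - g y <= e + C * Rabs (x - y).
Proof.
  intros Hg He.
  destruct (@Heine_cor2 g 0 1 Hg (mkposreal e He)) as [[d Hd] Hcont]. simpl in Hcont.
  destruct (continuity_ab_maj g 0 1 Rle_0_1 Hg) as [M [HM _]].
  destruct (continuity_ab_min g 0 1 Rle_0_1 Hg) as [m [Hm _]].
  assert (HW : 0 <= g M - g m).
  { pose proof (HM 0 ltac:(lra)). pose proof (Hm 0 ltac:(lra)). lra. }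
  assert (HC : 0 <= (g M - g m) / d).
  { apply Rmult_le_pos; [exact HW|]. left. apply Rinv_0_lt_compat, Hd. }
  exists ((g M - g m) / d). split; [exact HC|]. intros x y Hx Hy.
  pose proof (Rabs_pos (x - y)) as Hxy.
  destruct (Rlt_le_dec (Rabs (x - y)) d) as [Hlt|Hge].
  - specialize (Hcont x y Hx Hy Hlt). apply Rabs_def2 in Hcont.
    pose proof (Rmult_le_pos _ _ HC Hxy). lra.
  - pose proof (HM x Hx). pose proof (Hm y Hy).
    apply (Rmult_le_compat_l _ _ _ HC) in Hge.
    replace ((g M - g m) / d * d) with (g M - g m) in Hge by (field; lra). lra.
Qed.

(** * The Lyapunov exponent *)

(** The tangent of the concave logarithm at [c]; being affine in [u], it is averaged by
    linearity. *)
Lemma ln_tangent c u : 0 < c -> 0 < u -> ln u <= ln c + u / c - 1.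
Proof.
  intros Hc Hu. assert (Huc : 0 < u / c) by (apply Rdiv_lt_0_compat; assumption).
  replace u with (c * (u / c)) at 1 by (field; lra). rewrite ln_mult by assumption.
  assert (ln (u / c) <= u / c - 1); [|lra].
  pose proof (exp_ineq1_le (ln (u / c))) as H. rewrite exp_ln in H by exact Huc. lra.
Qed.

Section Lyapunov.

Context (N : nat) (Pi : nat -> nat -> R) (F F' : nat -> R -> R) (HS : system N Pi F F').

Let phi : nat -> R -> R := fun k x => ln (F' k x).
Let T := markov N Pi F.
(** The expected length, after [m] steps from fibre [k], of the image of the interval from [x] to
    [y]. *)
Let width m k x y := Nat.iter m T (fun _ z => z) k y - Nat.iter m T (fun _ z => z) k x.

Lemma phi_continuity k x : (k < N)%nat -> inI x -> continuity_pt (phi k) x.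
Proof using HS.
  intros Hk Hx. apply (continuity_pt_comp (F' k) ln).
  - apply (sys_S _ _ _ _ HS k Hk).
  - apply derivable_continuous_pt. exists (/ F' k x). apply derivable_pt_lim_ln.
    eapply F_deriv_pos; eauto.
Qed.

Lemma phi_modulus e : 0 < e -> exists C, 0 <= C /\ forall k x y, (k < N)%nat -> inI x -> inI y ->
  phi k x - phi k y <= e + C * Rabs (x - y).
Proof using HS.
  intros He.
  destruct (finite_choice 0 N (fun k C => 0 <= C /\ forall x y, inI x -> inI y ->
    phi k x - phi k y <= e + C * Rabs (x - y))) as [C HC].
  { intros k Hk. apply affine_modulus; [|exact He]. intros x. apply phi_continuity, Hk. }
  exists (rsum C N). split; [apply rsum_nonneg; apply HC|].
  intros k x y Hk Hx Hy. destruct (HC k Hk) as [_ H]. eapply Rle_trans; [apply (H x y Hx Hy)|].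
  apply Rplus_le_compat_l, Rmult_le_compat_r; [apply Rabs_pos|].
  apply rsum_term_le; [apply HC|exact Hk].
Qed.

(* One-step version, from the mean value theorem, of the comparison between the derivative at a point z
   and the contraction of an interval containing z. *)
Lemma log_derivative_le e C k x y z :
  (forall k x y, (k < N)%nat -> inI x -> inI y -> phi k x - phi k y <= e + C * Rabs (x - y)) ->
  0 <= C -> (k < N)%nat -> inI x -> inI y -> x < y -> x <= z <= y ->
  phi k z <= ln (F k y - F k x) - ln (y - x) + e + C * (y - x).
Proof using HS.
  intros Hmod HC Hk Hx Hy Hxy Hz.
  destruct (MVT_cor2 (F k) (F' k) x y Hxy) as [c [Ec Hc]].
  { intros c _. eapply F_deriv; eauto. }
  assert (Hci : inI c) by (unfold inI in *; lra). assert (Hzi : inI z) by (unfold inI in *; lra).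
  rewrite Ec, ln_mult; [|eapply F_deriv_pos; eauto|lra].
  specialize (Hmod k z c Hk Hzi Hci). unfold phi in *.
  assert (C * Rabs (z - c) <= C * (y - x)); [|lra].
  apply Rmult_le_compat_l; [exact HC|]. apply Rabs_le. lra.
Qed.

(** Along an orbit the differences of log-lengths telescope; the initial length leaves
    [- ln (y - x)], and the last log-length is replaced by its tangent bound at [c]. Induction
    conditions on the first step and averages over the next letter. *)
Lemma birkhoff_sum_le e C c : 0 < c -> 0 <= C ->
  (forall k x y, (k < N)%nat -> inI x -> inI y -> phi k x - phi k y <= e + C * Rabs (x - y)) ->
  forall n k x y z, (k < N)%nat -> inI x -> inI y -> x < y -> x <= z <= y ->
  rsum (fun m => Nat.iter m T phi k z) n <=
    ln c + width n k x y / c - 1 - ln (y - x) + INR n * e + C * rsum (fun m => width m k x y) n.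
Proof using HS.
  intros Hc HC Hmod n. induction n as [|n IH]; intros k x y z Hk Hx Hy Hxy Hz.
  - simpl. unfold width. simpl. pose proof (ln_tangent c (y - x) Hc ltac:(lra)). lra.
  - rewrite !rsum_head.
    assert (E1 : rsum (fun m => Nat.iter (S m) T phi k z) n =
      rsum (fun j => Pi k j * rsum (fun m => Nat.iter m T phi j (F k z)) n) N).
    { rewrite (rsum_ext _ (fun m => rsum (fun j => Pi k j * Nat.iter m T phi j (F k z)) N))
        by reflexivity.
      rewrite rsum_swap. apply rsum_ext. intros. apply rsum_scal. }
    assert (Ew : forall m, width (S m) k x y =
      rsum (fun j => Pi k j * width m j (F k x) (F k y)) N).
    { intros m. unfold width, T. simpl. unfold markov at 1 3. rewrite <- rsum_minus.
      apply rsum_ext. intros; lra. }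
    assert (E2 : rsum (fun m => width (S m) k x y) n =
      rsum (fun j => Pi k j * rsum (fun m => width m j (F k x) (F k y)) n) N).
    { rewrite (rsum_ext _ _ n (fun m _ => Ew m)), rsum_swap. apply rsum_ext.
      intros. apply rsum_scal. }
    pose proof (log_derivative_le e C k x y z Hmod HC Hk Hx Hy Hxy Hz) as H1.
    pose proof (F_inI _ _ _ _ HS k x Hk Hx) as Ix. pose proof (F_inI _ _ _ _ HS k y Hk Hy) as Iy.
    assert (Iz : inI z) by (unfold inI in *; lra).
    pose proof (F_lt _ _ _ _ HS k x y Hk Hx Hy Hxy) as Hlt.
    pose proof (F_le _ _ _ _ HS k x z Hk Hx Iz (proj1 Hz)) as Hz1.
    pose proof (F_le _ _ _ _ HS k z y Hk Iz Hy (proj2 Hz)) as Hz2.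
    set (K := ln c - 1 - ln (F k y - F k x) + INR n * e).
    assert (H2 : rsum (fun m => Nat.iter (S m) T phi k z) n <=
      K + width (S n) k x y / c + C * rsum (fun m => width (S m) k x y) n).
    { rewrite E1, E2, (Ew n). unfold Rdiv. rewrite (Rmult_comm _ (/ c)), <- !rsum_scal.
      replace K with (K * rsum (fun j => Pi k j) N) by (rewrite (Pi_row _ _ _ _ HS k Hk); lra).
      rewrite <- rsum_scal, <- !rsum_plus. apply rsum_le. intros j Hj.
      specialize (IH j (F k x) (F k y) (F k z) Hj Ix Iy Hlt (conj Hz1 Hz2)).
      apply (Rmult_le_compat_l (Pi k j)) in IH; [|eapply Pi_nonneg; eauto].
      eapply Rle_trans; [exact IH|]. unfold K, Rdiv. apply Req_le. ring. }
    rewrite S_INR. change (Nat.iter 0 T phi k z) with (phi k z).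
    replace (width 0 k x y) with (y - x) by reflexivity. unfold K in H2. lra.
Qed.

Lemma markov_mono g g' k x : (k < N)%nat -> inI x ->
  (forall j y, (j < N)%nat -> inI y -> g j y <= g' j y) -> T g k x <= T g' k x.
Proof using HS.
  intros Hk Hx H. apply rsum_le. intros j Hj. apply Rmult_le_compat_l; [eapply Pi_nonneg; eauto|].
  apply H; [exact Hj|eapply F_inI; eauto].
Qed.

Lemma markov_iter_mono g g' n : (forall j y, (j < N)%nat -> inI y -> g j y <= g' j y) ->
  forall k x, (k < N)%nat -> inI x -> Nat.iter n T g k x <= Nat.iter n T g' k x.
Proof using HS.
  intros H. induction n as [|n IH]; [exact H|]. intros k x Hk Hx. simpl. apply markov_mono; auto.
Qed.

Context (mu : nat -> meas) (Herg : ergodic N Pi F mu).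
Context (A B qA qB : nat -> R) (HH : hull N Pi F mu A B qA qB).

Let p := fun k => mu k inI.
Let D m := spread N p A B (Nat.iter m T (fun _ z => z)).

Lemma id_incr : incr N (fun _ z => z).
Proof using. intros k x y _ _ _ H. exact H. Qed.

(** Within a block of [l] steps the spread does not grow, and across blocks it decays by [rho]; the
    bound stays below a limit independent of [b]. *)
Lemma spread_sum_le l rho : 0 < rho < 1 ->
  (forall g, incr N g -> spread N p A B (Nat.iter l T g) <= rho * spread N p A B g) ->
  forall b, rsum D (b * l) <= INR l * D 0%nat * ((1 - rho ^ b) / (1 - rho)).
Proof using HS Herg HH.
  intros Hr Hl. induction b as [|b IH].
  - simpl. unfold Rdiv. rewrite Rminus_diag. lra.
  - replace (S b * l)%nat with (b * l + l)%nat by lia. rewrite rsum_add.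
    assert (H : rsum (fun i => D (b * l + i)%nat) l <= INR l * (rho ^ b * D 0%nat)).
    { rewrite <- rsum_const. apply rsum_le. intros i Hi.
      rewrite Nat.add_comm. eapply Rle_trans.
      - apply (spread_iter_antitone _ _ _ _ HS mu Herg A B qA qB HH); exact id_incr.
      - apply (spread_iter_pow _ _ _ _ HS mu A B l rho); [lra|exact Hl|exact id_incr]. }
    simpl pow. replace (INR l * D 0%nat * ((1 - rho * rho ^ b) / (1 - rho)))
      with (INR l * D 0%nat * ((1 - rho ^ b) / (1 - rho)) + INR l * (rho ^ b * D 0%nat))
      by (field; lra). lra.
Qed.

(** The iterates of a step function below [phi] stay below those of [phi] and all have the same
    integral, so integrating the pointwise bound over the hull yields [n] times that integral. *)
Lemma simple_lower_bound e C c n s : 0 < c -> 0 <= C ->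
  (forall k x y, (k < N)%nat -> inI x -> inI y -> phi k x - phi k y <= e + C * Rabs (x - y)) ->
  (forall k, (k < N)%nat -> sborel (s k)) ->
  (forall k x, (k < N)%nat -> inI x -> sev (s k) x <= phi k x) ->
  INR n * ssint N mu s <= ln c - 1 + D n / c - rsum (fun k => p k * ln (B k - A k)) N
    + INR n * e + C * rsum D n.
Proof using HS Herg HH.
  intros Hc HC Hmod Hs Hle. pose proof (proj1 Herg) as Hst.
  pose proof (sys_N _ _ _ _ HS) as HN.
  set (sn := fun m => Nat.iter m (spull N Pi F) s).
  assert (Hsn : forall m, (forall k, (k < N)%nat -> sborel (sn m k)) /\
    ssint N mu (sn m) = ssint N mu s).
  { intros m. apply (ssint_iter N Pi F F' mu HN (sys_S _ _ _ _ HS) Hst s m Hs). }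
  set (M := fun k => ln c + width n k (A k) (B k) / c - 1 - ln (B k - A k) + INR n * e +
                     C * rsum (fun m => width m k (A k) (B k)) n).
  assert (HM : forall k, (k < N)%nat -> rsum (fun m => sint (mu k) (sn m k)) n <= M k * p k).
  { intros k Hk. rewrite <- sint_catn.
    pose proof (stationary_fmeas _ _ _ _ Hst k Hk) as Hm.
    apply (sint_le _ _ (fun y => A k <= y <= B k) _ Hm).
    - intros b B0 Hin. apply in_catn in Hin as [m [_ Hin]]. exact (proj1 (Hsn m) k Hk _ _ Hin).
    - apply borel_and; [apply borel_ge|apply borel_le].
    - apply (hull_full _ _ _ mu Herg A B qA qB HH k Hk).
    - intros x Hx HxI. pose proof (hull_in _ _ _ _ _ _ _ _ HH k Hk) as Hin.
      apply Rle_trans with (rsum (fun m => Nat.iter m T phi k x) n).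
      + assert (E : forall n, sev (catn (fun m => sn m k) n) x = rsum (fun m => sev (sn m k) x) n).
        { induction n0 as [|n0 IH]; simpl; [reflexivity|]. rewrite sev_app, IH. reflexivity. }
        rewrite E. apply rsum_le. intros m _. unfold sn.
        pose proof (f_equal (fun f => f k x) (sev_iter N Pi F s m)) as Ev. simpl in Ev. rewrite Ev.
        apply (markov_iter_mono (fun j => sev (s j)) phi m); auto.
      + apply birkhoff_sum_le; auto; unfold inI; lra. }
  assert (Hsum : INR n * ssint N mu s = rsum (fun k => rsum (fun m => sint (mu k) (sn m k)) n) N).
  { rewrite rsum_swap, <- rsum_const. apply rsum_ext. intros m _. symmetry. apply (proj2 (Hsn m)). }
  rewrite Hsum. eapply Rle_trans; [apply rsum_le, HM|].
  assert (Hp : rsum p N = 1) by apply (stationary_total _ _ _ _ HN Hst).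
  assert (ED : D n / c = rsum (fun k => / c * (p k * width n k (A k) (B k))) N).
  { rewrite rsum_scal. unfold Rdiv. rewrite Rmult_comm. reflexivity. }
  assert (EDs : C * rsum D n = rsum (fun k => C * (p k * rsum (fun m => width m k (A k) (B k)) n)) N).
  { rewrite rsum_scal. f_equal. unfold D, spread. rewrite rsum_swap.
    apply rsum_ext. intros k _. rewrite <- rsum_scal. reflexivity. }
  rewrite ED, EDs.
  replace (ln c - 1 + rsum (fun k => / c * (p k * width n k (A k) (B k))) N -
      rsum (fun k => p k * ln (B k - A k)) N + INR n * e)
    with ((ln c - 1 + INR n * e) * rsum p N + rsum (fun k => / c * (p k * width n k (A k) (B k))) N -
      rsum (fun k => p k * ln (B k - A k)) N) by (rewrite Hp; lra).
  rewrite <- rsum_scal, <- rsum_plus, <- rsum_minus, <- rsum_plus.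
  apply rsum_le. intros k _. unfold M, Rdiv. apply Req_le. ring.
Qed.

Lemma lyapunov_negative : exists Ls : nat -> R,
  (forall i, (i < N)%nat -> is_integral (mu i) (fun x => ln (F' i x)) (Ls i)) /\ rsum Ls N < 0.
Proof using HS Herg HH.
  pose proof (proj1 Herg) as Hst. pose proof (sys_N _ _ _ _ HS) as HN.
  destruct (spread_contraction _ _ _ _ HS mu Herg A B qA qB HH) as [l [rho [Hl1 [Hr Hl]]]].
  fold T p in Hl.
  assert (Hlnr : ln rho < 0) by (rewrite <- ln_1; apply ln_increasing; lra).
  assert (Hlr : 1 <= INR l) by (apply (le_INR 1); exact Hl1).
  (* With [n = b * l] steps and tangent point [rho ^ b], the gain is [b * ln rho]. This [e] spends
     half of it on distortion; [K], free of [b], gathers the bounded terms and spends at most a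
     quarter once [b] is large; the remaining quarter is [- n * kap]. The maximum with 1 keeps [b]
     positive. *)
  set (e := - ln rho / (2 * INR l)).
  assert (He : 0 < e) by (apply Rdiv_lt_0_compat; lra).
  destruct (phi_modulus e He) as [C [HC Hmod]].
  set (D0 := D 0%nat).
  assert (HD0 : 0 <= D0) by (apply (spread_nonneg _ _ _ _ HS mu Herg A B qA qB HH), id_incr).
  set (K := - 1 + D0 - rsum (fun k => p k * ln (B k - A k)) N + C * (INR l * D0 * / (1 - rho))).
  destruct (archimed_nat (Rmax 1 (K / (- ln rho / 4)))) as [b Hb].
  pose proof (Rmax_l 1 (K / (- ln rho / 4))) as Hb1. pose proof (Rmax_r 1 (K / (- ln rho / 4))) as Hb2.
  set (kap := - ln rho / (4 * INR l)).
  assert (Hkap : 0 < kap) by (apply Rdiv_lt_0_compat; lra).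
  assert (Hmain : forall s, (forall k, (k < N)%nat -> sborel (s k)) ->
    (forall k x, (k < N)%nat -> inI x -> sev (s k) x <= phi k x) -> ssint N mu s <= - kap).
  { intros s Hs Hle.
    assert (Hc : 0 < rho ^ b) by (apply pow_lt; lra).
    pose proof (simple_lower_bound e C (rho ^ b) (b * l) s Hc HC Hmod Hs Hle) as H.
    assert (HDn : D (b * l)%nat / rho ^ b <= D0).
    { apply (Rmult_le_reg_r (rho ^ b)); [exact Hc|]. unfold Rdiv.
      rewrite Rmult_assoc, Rinv_l, Rmult_1_r, Rmult_comm by lra.
      apply (spread_iter_pow _ _ _ _ HS mu A B l rho); [lra|exact Hl|exact id_incr]. }
    assert (HDs : C * rsum D (b * l) <= C * (INR l * D0 * / (1 - rho))).
    { apply Rmult_le_compat_l; [exact HC|].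
      eapply Rle_trans; [apply (spread_sum_le l rho Hr Hl b)|]. fold D0.
      apply Rmult_le_compat_l; [apply Rmult_le_pos; lra|]. unfold Rdiv.
      rewrite <- (Rmult_1_l (/ (1 - rho))) at 2. apply Rmult_le_compat_r; [|lra].
      left. apply Rinv_0_lt_compat. lra. }
    rewrite ln_pow, mult_INR in H by lra.
    assert (E1 : INR b * INR l * e = - INR b * ln rho / 2) by (unfold e; field; lra).
    assert (E2 : INR b * INR l * - kap = INR b * ln rho / 4) by (unfold kap; field; lra).
    assert (HK : K <= - INR b * ln rho / 4).
    { assert (Hq : 0 < - ln rho / 4) by lra.
      assert (Hb3 : K / (- ln rho / 4) <= INR b) by lra.
      apply (Rmult_le_compat_r (- ln rho / 4)) in Hb3; [|lra].
      replace (K / (- ln rho / 4) * (- ln rho / 4)) with K in Hb3 by (field; lra). lra. }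
    apply (Rmult_le_reg_l (INR b * INR l)); [apply Rmult_lt_0_compat; lra|].
    unfold K in HK. lra. }
  assert (Hint : forall i, (i < N)%nat -> exists L, is_integral (mu i) (phi i) L /\
    forall e, 0 < e -> exists s, sborel s /\ (forall x, inI x -> sev s x <= phi i x) /\
      L - e <= sint (mu i) s).
  { intros i Hi. apply integral_exists; [apply (stationary_fmeas _ _ _ _ Hst i Hi)|].
    intros x. apply phi_continuity, Hi. }
  destruct (finite_choice 0 N _ Hint) as [Ls HLs]. exists Ls.
  split; [intros i Hi; apply (HLs i Hi)|].
  assert (HNR : 0 < INR N) by (apply lt_0_INR; lia).
  (* This error in each of the [N] fibres adds up to half the margin [kap]. *)
  assert (Hd : 0 < kap / (2 * INR N)) by (apply Rdiv_lt_0_compat; lra).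
  destruct (finite_choice ([] : list (R * (R -> Prop))) N
    (fun i s => sborel s /\ (forall x, inI x -> sev s x <= phi i x) /\
      Ls i - kap / (2 * INR N) <= sint (mu i) s)) as [s Hs].
  { intros i Hi. apply (HLs i Hi), Hd. }
  assert (H1 : ssint N mu s <= - kap) by (apply Hmain; intros k; [|intros x]; intros Hk; apply (Hs k Hk)).
  assert (H2 : rsum (fun i => Ls i - kap / (2 * INR N)) N <= ssint N mu s).
  { apply rsum_le. intros i Hi. apply (Hs i Hi). }
  rewrite rsum_minus, rsum_const in H2.
  replace (INR N * (kap / (2 * INR N))) with (kap / 2) in H2 by (field; lra). lra.
Qed.

End Lyapunov.

(** * Finiteness and order *)

(** Compactness as a supremum argument: isolation at the supremum of the levels up to which [S] is
    finite pushes that level further, until it reaches 1. *)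
Lemma discrete_in_I_finite (S : R -> Prop) : (forall x, S x -> inI x) ->
  (forall x, inI x -> exists e, 0 < e /\ forall y, S y -> Rabs (y - x) < e -> y = x) ->
  exists L : list R, forall y, S y -> In y L.
Proof.
  intros HS Hd.
  set (Z := fun t => inI t /\ exists L : list R, forall y, S y -> y <= t -> In y L).
  assert (H0 : Z 0).
  { split; [unfold inI; lra|]. exists [0]. intros y Hy Hle. left.
    specialize (HS y Hy). unfold inI in HS. lra. }
  destruct (completeness Z) as [t [Ht1 Ht2]].
  { exists 1. intros x [Hx _]. apply Hx. }
  { exists 0. exact H0. }
  assert (HtI : inI t).
  { split; [apply Ht1, H0|]. apply Ht2. intros x [Hx _]. apply Hx. }
  destruct (Hd t HtI) as [e [He Hiso]].
  assert (Hex : exists u, Z u /\ t - e < u).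
  { apply NNPP. intros Hn. assert (t <= t - e); [|lra].
    apply Ht2. intros u Hu. apply Rnot_lt_le. intros Hl. eauto. }
  destruct Hex as [u [[_ [L HL]] Hut]].
  assert (HZ : Z (Rmin 1 (t + e / 2))).
  { pose proof (Rmin_l 1 (t + e / 2)). pose proof (Rmin_r 1 (t + e / 2)).
    split; [split; [apply Rmin_glb; unfold inI in HtI; lra|assumption]|].
    exists (t :: L). intros y Hy Hle. destruct (Rle_lt_dec y u) as [Hyu|Hyu].
    - right. auto.
    - left. symmetry. apply Hiso; [exact Hy|]. apply Rabs_def1; lra. }
  pose proof (Ht1 _ HZ) as Hle. destruct HZ as [_ [L' HL']]. exists L'. intros y Hy.
  apply HL'; [exact Hy|]. apply Rmin_glb; [apply HS, Hy|].
  destruct (Rle_lt_dec 1 (t + e / 2)) as [H1|H1].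
  - specialize (HS y Hy). unfold inI in HS. lra.
  - rewrite Rmin_right in Hle by lra. lra.
Qed.

(** The difference quotient between two fixed points is 1, so (G1) isolates each fixed point; near
    any other point continuity excludes fixed points. *)
Lemma fixed_points_finite N Pi F F' r : system N Pi F F' -> simple_return N Pi r ->
  exists L : list R, forall q, fixed_pt F r q -> In q L.
Proof.
  intros HS Hr. apply discrete_in_I_finite; [intros x [Hx _]; exact Hx|].
  intros x Hx. set (d := wderiv F F' r x).
  assert (Hd : derivable_pt_lim (wmap F r) x d).
  { eapply wmap_derivable; [apply (sys_S _ _ _ _ HS)|apply Hr]. }
  destruct (Req_dec (wmap F r x) x) as [Hfix|Hfix].
  - assert (Hd1 : d <> 1).
    { intros E. rewrite E in Hd. exact (sys_G1 _ _ _ _ HS r x Hr (conj Hx Hfix) Hd). }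
    destruct (Hd (Rabs (d - 1))) as [[e He] Hlim]; [apply Rabs_pos_lt; lra|].
    exists e. split; [exact He|]. intros y [_ Hy] Hyx. apply NNPP. intros Hne.
    specialize (Hlim (y - x) ltac:(lra) Hyx).
    replace (x + (y - x)) with y in Hlim by lra. rewrite Hy, Hfix in Hlim.
    replace ((y - x) / (y - x)) with 1 in Hlim by (field; lra).
    rewrite Rabs_minus_sym in Hlim. lra.
  - assert (Hc : continuity_pt (fun y => wmap F r y - y) x).
    { apply continuity_pt_minus; [|apply derivable_continuous_pt, derivable_pt_id].
      apply derivable_continuous_pt. exists d. exact Hd. }
    destruct (Hc (Rabs (wmap F r x - x))) as [e [He H]]; [apply Rabs_pos_lt; lra|].
    exists e. split; [exact He|]. intros y [_ Hy] Hyx. apply NNPP. intros Hne.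
    assert (Hne' : x <> y) by auto.
    specialize (H y (conj (conj I Hne') Hyx)). simpl in H. unfold Rdist in H.
    rewrite Hy in H. replace (y - y - (wmap F r x - x)) with (- (wmap F r x - x)) in H by lra.
    rewrite Rabs_Ropp in H. lra.
Qed.

Lemma simple_return_cycle N Pi r : simple_return N Pi r -> simple_cycle (edge N Pi) r.
Proof.
  intros [H1 [H2 [H3 H4]]]. split; [apply word_ok_epath, H1|auto].
Qed.

Lemma attracting_images_finite N Pi F F' : system N Pi F F' ->
  exists L : list R, forall r a w, attracting N Pi F r a -> simple_transition N Pi w ->
    In (wmap F w a) L.
Proof.
  intros HS.
  assert (Hfix : forall Ws : list (list nat), exists L : list R, forall r q,
    In r Ws -> simple_return N Pi r -> fixed_pt F r q -> In q L).
  { induction Ws as [|r0 Ws [L IH]]; [exists []; easy|].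
    destruct (classic (simple_return N Pi r0)) as [Hr0|Hr0].
    - destruct (fixed_points_finite N Pi F F' r0 HS Hr0) as [L0 HL0].
      exists (L0 ++ L). intros r q [<-|Hin] Hr Hq; apply in_or_app; eauto.
    - exists L. intros r q [<-|Hin] Hr Hq; [easy|eauto]. }
  destruct (Hfix (words N (S N))) as [L HL].
  exists (flat_map (fun w => map (wmap F w) L) (words N N)).
  intros r a w [Hr [Ha _]] [Hw Hd]. apply in_flat_map. exists w. split.
  - apply in_words; [apply NoDup_below_length; [exact Hd|]|]; apply Hw.
  - apply in_map, (HL r); [|exact Hr|exact Ha].
    destruct (simple_cycle_length N (edge N Pi) r) as [H1 H2];
      [unfold edge; tauto|apply simple_return_cycle, Hr|]. apply in_words; assumption.
Qed.

Lemma sorted_insert x l : StronglySorted Rlt l ->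
  exists l', StronglySorted Rlt l' /\ forall y, In y l' <-> y = x \/ In y l.
Proof.
  induction l as [|a l IH]; intros Hs.
  - exists [x]. split; [constructor; [constructor|constructor]|]. simpl. intuition.
  - inversion Hs as [|? ? Hsl Hall]; subst. destruct (Rtotal_order x a) as [Hlt|[->|Hgt]].
    + exists (x :: a :: l). split; [|simpl; intuition].
      constructor; [exact Hs|]. constructor; [exact Hlt|].
      eapply Forall_impl; [|exact Hall]. intros; lra.
    + exists (a :: l). split; [exact Hs|simpl; intuition].
    + destruct (IH Hsl) as [l' [Hs' Hin]]. exists (a :: l'). split.
      * constructor; [exact Hs'|]. apply Forall_forall. intros y Hy.
        apply Hin in Hy as [->|Hy]; [exact Hgt|]. rewrite Forall_forall in Hall. auto.
      * intros y. simpl. rewrite Hin. intuition.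
Qed.

Lemma sorted_filter (L : list R) (Q : R -> Prop) :
  exists l, StronglySorted Rlt l /\ forall y, In y l <-> In y L /\ Q y.
Proof.
  induction L as [|a L [l [Hs Hin]]].
  - exists []. split; [constructor|simpl; tauto].
  - destruct (classic (Q a)) as [Ha|Ha].
    + destruct (sorted_insert a l Hs) as [l' [Hs' Hin']]. exists l'. split; [exact Hs'|].
      intros y. rewrite Hin', Hin. simpl. intuition subst; auto.
    + exists l. split; [exact Hs|]. intros y. rewrite Hin. simpl. intuition subst; easy.
Qed.

Lemma sorted_nth l i j : StronglySorted Rlt l -> (i < j)%nat -> (j < length l)%nat ->
  nth i l 0 < nth j l 0.
Proof.
  intros Hs. revert i j. induction Hs as [|a l Hs IH Hall]; intros i j Hij Hj; [simpl in Hj; lia|].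
  destruct j as [|j]; [lia|]. simpl in Hj. destruct i as [|i]; simpl.
  - rewrite Forall_forall in Hall. apply Hall, nth_In. lia.
  - apply IH; lia.
Qed.

Lemma meq_supp N mu nu k x : (k < N)%nat -> meq N mu nu -> supp (mu k) x -> supp (nu k) x.
Proof.
  intros Hk H Hx e He. rewrite <- H; [apply Hx, He|exact Hk|apply borel_interval].
Qed.

(** Hulls of distinct measures are disjoint in every fibre. Their order passes along an edge from
    [i] to [j]: reversed order at [j] would put [F i (B' i)] below [F i (A i)], against
    monotonicity. *)
Lemma hulls_ordered N Pi F F' mu nu A B qA qB A' B' qA' qB' : system N Pi F F' ->
  ergodic N Pi F mu -> ergodic N Pi F nu ->
  hull N Pi F mu A B qA qB -> hull N Pi F nu A' B' qA' qB' -> A 0%nat < A' 0%nat ->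
  forall k, (k < N)%nat -> B k < A' k.
Proof.
  intros HS Hmu Hnu HH HH' H0. pose proof (sys_N _ _ _ _ HS) as HN.
  assert (Hdis : forall k, (k < N)%nat -> B k < A' k \/ B' k < A k).
  { intros k Hk. apply NNPP. intros Hno.
    pose proof (hull_in _ _ _ _ _ _ _ _ HH k Hk). pose proof (hull_in _ _ _ _ _ _ _ _ HH' k Hk).
    assert (Heq : meq N mu nu).
    { apply (hulls_overlap_eq N Pi F F' mu nu A B qA qB A' B' qA' qB' k (Rmax (A k) (A' k)));
        auto; (split; [apply Rmax_l || apply Rmax_r|apply Rmax_lub; lra]). }
    assert (A 0%nat = A' 0%nat); [|lra].
    pose proof (hull_A_min _ _ _ _ _ _ _ _ HH 0%nat HN) as [M1 M2].
    pose proof (hull_A_min _ _ _ _ _ _ _ _ HH' 0%nat HN) as [M3 M4].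
    apply Rle_antisym.
    - apply M2. eapply meq_supp; [exact HN| |exact M3].
      intros j C Hj HC. symmetry. apply Heq; assumption.
    - apply M4. eapply meq_supp; [exact HN|exact Heq|exact M1]. }
  intros k Hk. pose proof (irreducible _ _ _ _ HS 0%nat k HN Hk) as Hc. clear Hk.
  induction Hc as [|i j Hc IH Hij].
  - destruct (Hdis 0%nat HN) as [H|H]; [exact H|].
    pose proof (hull_in _ _ _ _ _ _ _ _ HH' 0%nat HN). lra.
  - pose proof Hij as [Hi [Hj _]]. destruct (Hdis j Hj) as [H|H]; [exact H|].
    pose proof (hull_in _ _ _ _ _ _ _ _ HH i Hi). pose proof (hull_in _ _ _ _ _ _ _ _ HH' i Hi).
    pose proof (hull_A_edge _ _ _ _ _ _ _ _ HH i j Hij).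
    pose proof (hull_B_edge _ _ _ _ _ _ _ _ HH' i j Hij).
    assert (F i (A i) < F i (B' i)); [|lra].
    apply (F_lt _ _ _ _ HS); unfold inI; auto; lra.
Qed.

Theorem mainTheorem2 (N : nat) (Pi : nat -> nat -> R) (F F' : nat -> R -> R)
  (HN : (1 <= N)%nat) (Hstoch : stochastic N Pi) (Hprim : primitive_mat N Pi)
  (HF : in_S N F F') (HG1 : G1 N Pi F) (HG2 : G2 N Pi F) (HG3 : G3 N Pi F) :
  exists (n : nat) (mus : nat -> nat -> meas) (Ds : nat -> nat -> R -> Prop),
    (* (1) finitely many ergodic measures: exactly mus 0, ..., mus (n-1) *)
    (forall l, (l < n)%nat -> ergodic N Pi F (mus l)) /\
    (forall mu, ergodic N Pi F mu -> exists l, (l < n)%nat /\ meq N mu (mus l)) /\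
    (* (2) supports in trapping domains, pairwise disjoint and vertically ordered *)
    (forall l, (l < n)%nat ->
       is_domain N (Ds l) /\ trapping N Pi F (Ds l) /\
       forall k x, (k < N)%nat -> supp (mus l k) x -> Ds l k x) /\
    (forall l l' k x y, (l < l')%nat -> (l' < n)%nat -> (k < N)%nat ->
       Ds l k x -> Ds l' k y -> x < y) /\
    (* (3) A_{mu,k} and B_{mu,k} are images of attracting fixed points *)
    (forall mu k, ergodic N Pi F mu -> (k < N)%nat ->
       (exists r a w, attracting N Pi F r a /\ simple_transition N Pi w /\
          hd 0%nat w = hd 0%nat r /\ last w 0%nat = k /\
          is_min (supp (mu k)) (wmap F w a)) /\
       (exists r a w, attracting N Pi F r a /\ simple_transition N Pi w /\
          hd 0%nat w = hd 0%nat r /\ last w 0%nat = k /\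
          is_max (supp (mu k)) (wmap F w a))) /\
    (* (4) negative Lyapunov exponent *)
    (forall mu, ergodic N Pi F mu ->
       exists Ls : nat -> R,
         (forall i, (i < N)%nat -> is_integral (mu i) (fun x => ln (F' i x)) (Ls i)) /\
         sum_f_R0 Ls (N - 1) < 0).
Proof.
  assert (HS : system N Pi F F') by (constructor; assumption).
  set (X := ((nat -> meas) * ((nat -> R) * (nat -> R) * (nat -> R) * (nat -> R)))%type).
  (* The label of an ergodic measure is the lower end of its support in fibre 0. Labels lie in the
     finite list [L], equal labels mean overlapping hulls and hence equal measures, and sorting the
     labels gives the vertical order. *)
  set (realizes := fun v (d : X) => let '(mu, (A, B, qA, qB)) := d in
    ergodic N Pi F mu /\ hull N Pi F mu A B qA qB /\ A 0%nat = v).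
  destruct (attracting_images_finite N Pi F F' HS) as [L HL].
  destruct (sorted_filter L (fun v => exists d, realizes v d)) as [vs [Hsort Hvs]].
  set (n := length vs).
  (* The zero data only inhabit the type; indices below [n] never meet them. *)
  destruct (finite_choice ((fun _ _ => 0, (fun _ => 0, fun _ => 0, fun _ => 0, fun _ => 0)) : X) n
    (fun l d => realizes (nth l vs 0) d)) as [d Hd].
  { intros l Hl. apply (Hvs (nth l vs 0)), nth_In, Hl. }
  set (mus := fun l => fst (d l)). set (A := fun l => fst (fst (fst (snd (d l))))).
  set (B := fun l => snd (fst (fst (snd (d l))))). set (qA := fun l => snd (fst (snd (d l)))).
  set (qB := fun l => snd (snd (d l))).
  assert (Hdata : forall l, (l < n)%nat -> ergodic N Pi F (mus l) /\
    hull N Pi F (mus l) (A l) (B l) (qA l) (qB l) /\ A l 0%nat = nth l vs 0).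
  { intros l Hl. specialize (Hd l Hl). unfold realizes in Hd. unfold mus, A, B, qA, qB.
    destruct (d l) as [m [[[a b] u] v]]. exact Hd. }
  assert (Hord : forall l l', (l < l')%nat -> (l' < n)%nat -> forall k, (k < N)%nat -> B l k < A l' k).
  { intros l l' Hll Hl'. destruct (Hdata l) as [E1 [H1 V1]]; [lia|].
    destruct (Hdata l' Hl') as [E2 [H2 V2]].
    apply (hulls_ordered N Pi F F' _ _ _ _ _ _ _ _ _ _ HS E1 E2 H1 H2).
    rewrite V1, V2. apply sorted_nth; assumption. }
  (* One [t] for all measures: small enough for every enlarged hull to be trapping and for
     consecutive ones to stay apart. *)
  assert (Hev : evsmall (fun t =>
    (forall l, (l < n)%nat ->
      (forall k, (k < N)%nat -> 0 < A l k - qA l k * t /\ B l k + qB l k * t < 1) /\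
      forall i j, edge N Pi i j -> A l j - qA l j * t < F i (A l i - qA l i * t) /\
                                   F i (B l i + qB l i * t) < B l j + qB l j * t) /\
    forall l', (l' < n)%nat -> forall l, (l < n)%nat -> forall k, (k < N)%nat -> (l < l')%nat ->
      B l k + (qB l k + qA l' k) * t < A l' k)).
  { apply evsmall_and.
    - apply evsmall_fin. intros l Hl.
      apply (hull_trap _ _ _ _ _ _ _ _ (proj1 (proj2 (Hdata l Hl)))).
    - apply evsmall_fin. intros l' Hl'. apply evsmall_fin. intros l Hl.
      apply evsmall_fin. intros k Hk. apply evsmall_imp. intros Hll.
      apply evsmall_linear_lt, Hord; assumption. }
  destruct (evsmall_ex _ Hev) as [t [Ht [Htrap Hsep]]]. clear Hev.
  exists n, mus, (fun l k x => A l k - qA l k * t < x < B l k + qB l k * t).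
  split; [|split; [|split; [|split; [|split]]]].
  - intros l Hl. apply (Hdata l Hl).
  - intros mu Hmu. destruct (hull_exists _ _ _ _ mu HS (proj1 Hmu)) as [a [b [u [v HH]]]].
    assert (Hin : In (a 0%nat) vs).
    { apply Hvs. split.
      - destruct (hull_A_att _ _ _ _ _ _ _ _ HH 0%nat HN) as [r [q [w [H1 [H2 [_ [_ <-]]]]]]].
        eapply HL; eauto.
      - exists (mu, (a, b, u, v)). split; [exact Hmu|]. split; [exact HH|reflexivity]. }
    apply (In_nth _ _ 0) in Hin as [l [Hl El]]. exists l. split; [exact Hl|].
    destruct (Hdata l Hl) as [E1 [H1 V1]].
    apply (hulls_overlap_eq N Pi F F' mu (mus l) a b u v (A l) (B l) (qA l) (qB l) 0%nat (a 0%nat));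
      auto.
    + pose proof (hull_in _ _ _ _ _ _ _ _ HH 0%nat HN). lra.
    + pose proof (hull_in _ _ _ _ _ _ _ _ H1 0%nat HN). lra.
  - intros l Hl. destruct (Hdata l Hl) as [E1 [H1 V1]]. destruct (Htrap l Hl) as [T1 T2].
    assert (Hq : forall k, 0 < qA l k * t /\ 0 < qB l k * t).
    { intros k. destruct (hull_q _ _ _ _ _ _ _ _ H1 k). split; apply Rmult_lt_0_compat; assumption. }
    split; [|split].
    + intros k Hk. pose proof (hull_in _ _ _ _ _ _ _ _ H1 k Hk). specialize (T1 k Hk).
      specialize (Hq k). split; [exists (A l k); lra|]. split; [intros; lra|].
      unfold inI. intros; lra.
    + intros i j Hi Hj HP x Hx. assert (Hij : edge N Pi i j) by (repeat split; assumption).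
      destruct (T2 i j Hij) as [T3 T4]. specialize (T1 i Hi).
      pose proof (hull_in _ _ _ _ _ _ _ _ H1 i Hi). specialize (Hq i).
      assert (K1 : F i (A l i - qA l i * t) < F i x)
        by (apply (F_lt _ _ _ _ HS); unfold inI; auto; lra).
      assert (K2 : F i x < F i (B l i + qB l i * t))
        by (apply (F_lt _ _ _ _ HS); unfold inI; auto; lra).
      set (e1 := F i x - (A l j - qA l j * t)). set (e2 := B l j + qB l j * t - F i x).
      exists (Rmin e1 e2). split; [apply Rmin_pos; unfold e1, e2; lra|].
      intros z Hz. pose proof (Rmin_l e1 e2). pose proof (Rmin_r e1 e2). unfold e1, e2 in *. lra.
    + intros k x Hk Hx. specialize (Hq k).
      pose proof (proj2 (hull_A_min _ _ _ _ _ _ _ _ H1 k Hk) x Hx).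
      pose proof (proj2 (hull_B_max _ _ _ _ _ _ _ _ H1 k Hk) x Hx). lra.
  - intros l l' k x y Hll Hl' Hk Hx Hy.
    specialize (Hsep l' Hl' l ltac:(lia) k Hk Hll). lra.
  - intros mu k Hmu Hk. destruct (hull_exists _ _ _ _ mu HS (proj1 Hmu)) as [a [b [u [v HH]]]].
    split.
    + destruct (hull_A_att _ _ _ _ _ _ _ _ HH k Hk) as [r [q [w [H1 [H2 [H3 [H4 H5]]]]]]].
      exists r, q, w. rewrite H5. pose proof (hull_A_min _ _ _ _ _ _ _ _ HH k Hk). auto 6.
    + destruct (hull_B_att _ _ _ _ _ _ _ _ HH k Hk) as [r [q [w [H1 [H2 [H3 [H4 H5]]]]]]].
      exists r, q, w. rewrite H5. pose proof (hull_B_max _ _ _ _ _ _ _ _ HH k Hk). auto 6.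
  - intros mu Hmu. destruct (hull_exists _ _ _ _ mu HS (proj1 Hmu)) as [a [b [u [v HH]]]].
    destruct (lyapunov_negative N Pi F F' HS mu Hmu a b u v HH) as [Ls [H1 H2]].
    exists Ls. split; [exact H1|]. rewrite sum_f_R0_rsum by exact HN. exact H2.
Qed.
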